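(* Let $f:C_1\to\mathbb{CP}^1$, $g:C_2\to\mathbb{CP}^1$ be holomorphic functions, and let $h_j=f\circ u_j=g\circ v_j$, with $h_j:R_j\to\mathbb{CP}^1$, $u_j:R_j\to C_1$, $v_j:R_j\to C_2$, $1\le j\le o(f,g)$, be the functions associated with the pair $f,g$ in the context. Suppose that $h:R\to\mathbb{CP}^1$, $p:R\to C_1$, $q:R\to C_2$ are holomorphic functions such that $$h=f\circ p=g\circ q.$$ Then there exist $j$, $1\le j\le o(f,g)$, and holomorphic functions $w:R\to R_j$, $\tilde p:R_j\to C_1$, $\tilde q:R_j\to C_2$ such that $$h=h_j\circ w,\qquad p=\tilde p\circ w,\qquad q=\tilde q\circ w,$$ and $$f\circ\tilde p\sim f\circ u_j,\qquad g\circ\tilde q\sim g\circ v_j.$$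
   Context: All Riemann surfaces are connected and compact, and holomorphic functions are nonconstant. Two decompositions $f\circ q$ and $\tilde f\circ\tilde q$ of the same holomorphic function, with $q:R\to C$, $f:C\to\mathbb{CP}^1$, $\tilde q:R\to\tilde C$, $\tilde f:\tilde C\to\mathbb{CP}^1$, are equivalent, written $f\circ q\sim\tilde f\circ\tilde q$, if there is an isomorphism $\mu:\tilde C\to C$ with $f=\tilde f\circ\mu^{-1}$, $q=\mu\circ\tilde q$. Construction of $h_j,u_j,v_j$. Let $n=\deg f$, $m=\deg g$, let $S=\{z_1,\dots,z_r\}$ be the union of the branch points (critical values) of $f$ and $g$, let $z_0\in\mathbb{CP}^1\setminus S$, and let $\beta_i$ be small loops around $z_i$, based at $z_0$, with $\beta_1\beta_2\cdots\beta_r=1$ in $\pi_1(\mathbb{CP}^1\setminus S,z_0)$. For a holomorphic function $p$ unramified outside $S$, lifting $\beta_i$ by $p$ gives a permutation $\alpha_i(p)$ of $p^{-1}\{z_0\}$; after numbering $f^{-1}\{z_0\}$ and $g^{-1}\{z_0\}$, regard $\alpha_i(f)\in S_n$ and $\alpha_i(g)\in S_m$. Define permutations $\delta_i$, $1\le i\le r$, of the set of $nm$ elements $c_{j_1,j_2}$, $1\le j_1\le n$, $1\le j_2\le m$ (the entries of an $n\times m$ matrix $M$), by $c_{j_1,j_2}^{\delta_i}=c_{j_1',j_2'}$ with $j_1'=j_1^{\alpha_i(f)}$, $j_2'=j_2^{\alpha_i(g)}$. Let $\Gamma(f,g)$ be the group generated by $\delta_1,\dots,\delta_r$, let $o(f,g)$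 be the number of its orbits $U_1,\dots,U_{o(f,g)}$, and let $\delta_i(j)$ be the permutation induced by $\delta_i$ on $U_j$. Since $\delta_1(j)\cdots\delta_r(j)=1$ and the $\delta_i(j)$ generate a transitive group on $U_j$, there is a holomorphic function $h_j:R_j\to\mathbb{CP}^1$ on a Riemann surface $R_j$, unramified outside $S$ and unique up to isomorphism, together with an identification of $h_j^{-1}\{z_0\}$ with $U_j$ under which $\alpha_i(h_j)=\delta_i(j)$ for all $i$. The intersections of $U_j$ with the rows (respectively columns) of $M$ form an imprimitivity system on which the $\delta_i(j)$ act as $\alpha_i(f)$ (respectively $\alpha_i(g)$); accordingly there exist holomorphic $u_j:R_j\to C_1$, $v_j:R_j\to C_2$ with $h_j=f\circ u_j=g\circ v_j$ such that the fibres of $u_j$ (respectively $v_j$) over the points of $f^{-1}\{z_0\}$ (respectively $g^{-1}\{z_0\}$) are exactly the intersections of $U_j$ with the rows (respectively columns) of $M$. *)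

(* Defs.v *)
From HB Require Import structures.
From mathcomp Require Import all_boot all_order all_algebra all_fingroup.
From mathcomp Require Import complex.
From mathcomp Require Import all_classical all_reals all_analysis.

Set Implicit Arguments.
Unset Strict Implicit.
Unset Printing Implicit Defensive.

Import Order.TTheory GRing.Theory Num.Theory numFieldNormedType.Exports.

Local Open Scope classical_set_scope.
Local Open Scope ring_scope.

(* R[i] with the topology and normed structure of its modulus; packing it as a
   numClosedFieldType is what makes these structures inferable. *)
Definition Cplx (R : realType) : numClosedFieldType := R[i].

Section RiemannSurfaces.
Variable R : realType.
Local Notation C := (Cplx R).

(* [chart_map] and [chart_inv] are total functions, only meaningful on
   [chart_dom] and on its image. *)
Record chart (X : topologicalType) := Chart {
  chart_dom : set X;
  chart_map :> X -> C;
  chart_inv : C -> X;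
  chart_dom_open : open chart_dom;
  chart_img_open : open (chart_map @` chart_dom);
  chart_mapK : forall x, chart_dom x -> chart_inv (chart_map x) = x;
  chart_continuous : forall x, chart_dom x -> {for x, continuous chart_map};
  chart_inv_continuous : forall x, chart_dom x ->
    {for chart_map x, continuous chart_inv} }.

(* [F] read in the charts [a] and [b]. *)
Definition in_charts (X Y : topologicalType) (a : chart X) (b : chart Y)
    (F : X -> Y) : C -> C :=
  b \o F \o chart_inv a.

(* Compactness and connectedness are part of the structure. *)
Record riemann_surface := RiemannSurface {
  rs_space :> topologicalType;
  atlas : set (chart rs_space);
  atlas_cover : forall x, exists2 a, atlas a & chart_dom a x;
  atlas_compat : forall a b, atlas a -> atlas b ->
    forall x, chart_dom a x -> chart_dom b x ->
      derivable (in_charts a b id) (a x : C) 1;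
  rs_hausdorff : hausdorff_space rs_space;
  rs_connected : connected [set: rs_space];
  rs_compact : compact [set: rs_space];
  rs_nonempty : [set: rs_space] !=set0 }.

Arguments atlas : clear implicits.

Definition holomorphic (X Y : riemann_surface) (F : X -> Y) : Prop :=
  [/\ continuous F,
      forall a b, atlas X a -> atlas Y b ->
        forall x, chart_dom a x -> chart_dom b (F x) ->
          derivable (in_charts a b F) (a x : C) 1
    & exists x y, F x <> F y].

Definition ramified_at (X Y : riemann_surface) (F : X -> Y) (x : X) : Prop :=
  exists a b, [/\ atlas X a, atlas Y b, chart_dom a x, chart_dom b (F x)
    & (in_charts a b F)^`()%classic (a x : C) = 0].

Definition critical_values (X Y : riemann_surface) (F : X -> Y) : set Y :=
  F @` [set x | ramified_at F x].

Definition unramified_outside (X Y : riemann_surface) (S : set Y) (F : X -> Y)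
  : Prop := critical_values F `<=` S.

Definition has_degree (X Y : riemann_surface) (F : X -> Y) (n : nat) : Prop :=
  forall z, ~ critical_values F z -> (F @^-1` [set z] #= `I_n)%card.

(* Equivalence of the decompositions [f \o q] and [f' \o q']. *)
Definition decomp_equiv (X D D' Y : riemann_surface)
    (f : D -> Y) (q : X -> D) (f' : D' -> Y) (q' : X -> D') : Prop :=
  exists (mu : D' -> D) (mu' : D -> D'),
    [/\ holomorphic mu, holomorphic mu', cancel mu mu' & cancel mu' mu] /\
    (f = f' \o mu' /\ q = mu \o q').

(* Paths are functions on R, only meaningful on [0, 1]. *)
Section Paths.
Variable X : topologicalType.
Implicit Types (A : set X) (x y : X) (g : R -> X).

Definition path_in A x y g : Prop :=
  [/\ {within `[0, 1], continuous g}, g 0 = x, g 1 = y & g @` `[0, 1] `<=` A].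

(* Homotopy in [A] with fixed end points. *)
Definition homotopic A x y g0 g1 : Prop :=
  exists H : R * R -> X,
    [/\ {within `[0, 1] `*` `[0, 1], continuous H},
        H @` (`[0, 1] `*` `[0, 1]) `<=` A,
        forall t, 0 <= t <= 1 -> H (t, 0) = g0 t /\ H (t, 1) = g1 t
      & forall s, 0 <= s <= 1 -> H (0, s) = x /\ H (1, s) = y].

Definition path_concat g g' : R -> X :=
  fun t => if t <= 2^-1 then g (2 * t) else g' (2 * t - 1).

Definition path_rev g : R -> X := fun t => g (1 - t).

Definition path_prod x (s : seq (R -> X)) : R -> X :=
  foldr path_concat (cst x) s.

End Paths.

Definition expi (t : R) : C := (cos t +i* sin t)%C.

(* The loop going once counterclockwise round the circle of centre [z] and
   radius [rho] in the coordinate [a]. *)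
Definition circle (X : topologicalType) (a : chart X) (rho : R) (z : X)
  : R -> X := fun t => chart_inv a (a z + rho%:C%C * expi (2 * pi * t)).

(* [b] is, up to homotopy, a tail followed by a circle around [z] bounding a
   coordinate disc without other points of [S], followed by the tail reversed. *)
Definition small_loop (X : riemann_surface) (S : set X) (z0 z : X)
    (b : R -> X) : Prop :=
  path_in (~` S) z0 z0 b /\
  exists (a : chart X) (rho : R) (tail : R -> X),
    let c := circle a rho z in
    [/\ atlas X a /\ chart_dom a z,
        0 < rho,
        forall w : C, `|w - a z| <= rho%:C%C ->
          (a @` chart_dom a) w /\ (S (chart_inv a w) -> w = a z),
        path_in (~` S) z0 (c 0) tail
      & homotopic (~` S) z0 z0 b
          (path_concat tail (path_concat c (path_rev tail)))].

(* The standard system of generators of pi_1(X \ S, z0), where S = {z_i}: small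
   loops around the z_i, the product of which, in the order of the indices, is
   trivial, and which generate the group.  On the sphere the generation clause
   is implied by the other two (a self-map of a compact surface which has degree
   one on the boundary circles has degree one, hence is onto on pi_1). *)
Definition standard_loops (X : riemann_surface) (S : set X) (z0 : X) (r : nat)
    (z : 'I_r -> X) (beta : 'I_r -> R -> X) : Prop :=
  [/\ forall i, small_loop S z0 (z i) (beta i),
      homotopic (~` S) z0 z0 (path_prod z0 [seq beta i | i <- enum 'I_r])
        (cst z0)
    & forall g, path_in (~` S) z0 z0 g -> exists s : seq ('I_r * bool),
        homotopic (~` S) z0 z0 g (path_prod z0
          [seq if e.2 then beta e.1 else path_rev (beta e.1) | e <- s])].

(* The lift of [b] by [F] that starts at [x] ends at [y]. *)
Definition lift_ends (X Y : topologicalType) (F : X -> Y) (b : R -> Y) (x y : X)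
  : Prop :=
  exists2 g, path_in [set: X] x y g & forall t, 0 <= t <= 1 -> F (g t) = b t.

(* When [lab] identifies [A] with a fibre of [F], the restriction of [alpha]
   to [A] is the permutation given by lifting [b]. *)
Definition monodromy (X Y : topologicalType) (F : X -> Y) (b : R -> Y)
    (T : finType) (A : {set T}) (lab : T -> X) (alpha : {perm T}) : Prop :=
  forall c, c \in A -> lift_ends F b (lab c) (lab (alpha c)).

Definition fibre_labelling (X Y : Type) (F : X -> Y) (z0 : Y) (T : finType)
    (A : {set T}) (lab : T -> X) : Prop :=
  set_bij [set` A] (F @^-1` [set z0]) lab.

End RiemannSurfaces.

Arguments atlas {R} _.

Section RiemannSphere.
Variable R : realType.
Local Notation C := (Cplx R).
Local Notation sphere := (one_point_compactification C).

Lemma Cplx_norm_le (a b : R) :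
  `|(a +i* b)%C : C| <= (`|a| + `|b|)%:C%C.
Proof.
rewrite (_ : (a +i* b)%C = (a%:C + 'i * b%:C)%C :> C); last first.
  exact: (complexE (a +i* b)%C).
rewrite (le_trans (ler_normD _ _))// normrM (_ : `|'i%C : C| = 1); last first.
  by rewrite normc_def/= expr0n/= add0r expr1n sqrtr1.
rewrite mul1r !normc_def/= !expr0n/= !addr0 !sqrtr_sqr.
by rewrite lecE/= addr0 eqxx/=.
Qed.

Lemma Cplx_continuous : continuous (fun p : R * R => (p.1 +i* p.2)%C : C).
Proof.
move=> [a b]; apply/cvgrPdist_lt => /= e e0.
have eE : e = (complex.Re e)%:C%C by rewrite RRe_real// gtr0_real.
have d0 : 0 < complex.Re e by rewrite -(@ltcR R) -eE.
have e2 : 0 < complex.Re e / 2 by rewrite divr_gt0.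
have h1 : \forall p \near (a, b), `|a - p.1| < complex.Re e / 2.
  exact: (@cvgr_dist_lt _ _ _ _ _ (fun p : R * R => p.1) a (@cvg_fst _ _ (nbhs a) (nbhs b) _)).
have h2 : \forall p \near (a, b), `|b - p.2| < complex.Re e / 2.
  exact: (@cvgr_dist_lt _ _ _ _ _ (fun p : R * R => p.2) b (@cvg_snd _ _ (nbhs a) (nbhs b) _)).
near=> p; rewrite eE (_ : _ - _ = ((a - p.1) +i* (b - p.2))%C)//.
apply: (le_lt_trans (Cplx_norm_le _ _)); rewrite ltcR.
by rewrite (splitr (complex.Re e)) ltrD//; near: p.
Unshelve. all: by end_near. Qed.

Lemma Cplx_ball_closed (M : C) : 0 <= M -> closed [set w : C | `|w| <= M].
Proof.
move=> M0; rewrite (_ : [set _ | _] = ~` [set w : C | M < `|w|]); last first.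
  apply/seteqP; split=> w /=.
    by move=> wM /(le_lt_trans wM); rewrite ltxx.
  by move=> /negP; rewrite real_ltNge ?negbK// ger0_real.
apply: open_closedC; rewrite openE => w /= Mw.
have e0 : 0 < `|w| - M by rewrite subr_gt0.
apply/nbhs_ballP; exists (`|w| - M) => //= y; rewrite -ball_normE/= => h.
have := le_lt_trans (lerB_dist w y) h.
by rewrite ltrD2l ltrN2.
Qed.

Lemma Cplx_ball_compact (M : C) : 0 <= M -> compact [set w : C | `|w| <= M].
Proof.
move=> M0; have ME : M = (complex.Re M)%:C%C by rewrite RRe_real// ger0_real.
pose m := complex.Re M.
have cS : compact (`[- m, m] `*` `[- m, m]).
  by apply: compact_setX; exact: segment_compact.
have /continuous_compact/(_ cS) :=
  @continuous_subspaceT _ _ (`[- m, m] `*` `[- m, m]) _ Cplx_continuous.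
move=> cI; apply: (subclosed_compact _ cI); first exact: Cplx_ball_closed.
move=> [a b] /=; rewrite normc_def ME lecR/= => h.
have H (x y : R) : Num.sqrt (x ^+ 2 + y ^+ 2) <= m -> x \in `[- m, m].
  move=> sm; rewrite in_itv/= -ler_norml -sqrtr_sqr (le_trans _ sm)//.
  by rewrite ler_wsqrtr// lerDl sqr_ge0.
exists (a, b) => //=; split => /=; apply: H; first exact: h.
by rewrite addrC; exact: h.
Qed.

Lemma sphere_nbhs_infty (M : C) : 0 <= M ->
  nbhs (None : sphere) [set x : sphere | if x is Some w then ~ `|w| <= M else True].
Proof.
move=> M0; exists [set w : C | `|w| <= M].
  by split; [exact: Cplx_ball_compact|exact: Cplx_ball_closed].
by move=> [w|] //= [[y /= yM [<-]]|//].
Qed.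

Lemma sphere_hausdorff : hausdorff_space sphere.
Proof.
have sep (w : C) : exists A B, [/\ nbhs (Some w : sphere) A,
    nbhs (None : sphere) B & A `&` B = set0].
  exists (Some @` ball w 1), [set x : sphere | if x is Some y
    then ~ `|y| <= `|w| + 1 else True]; split.
  - exact/one_point_compactification_some_nbhs/nbhsx_ballx.
  - exact: sphere_nbhs_infty.
  - rewrite -subset0 => _ [[y wy <-]]; apply; rewrite -lerBlDl.
    move: wy; rewrite -ball_normE/= distrC => /ltW; apply: le_trans.
    exact: lerB_dist.
move=> [x|] [y|] //= cxy.
- congr Some; apply: (@norm_hausdorff _ C^o) => A B Ax By.
  have [_ [[a Aa <-] [b Bb [ba]]]] := cxy _ _
    (one_point_compactification_some_nbhs _ _ Ax)
    (one_point_compactification_some_nbhs _ _ By).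
  by exists a; split=> //; rewrite -ba.
- by have [A [B [+ + AB]]] := sep x => /cxy/[apply]; rewrite AB => -[].
- have [A [B [Ax Bx AB]]] := sep y.
  by have := cxy _ _ Bx Ax; rewrite setIC AB => -[].
Qed.

Lemma compact_away (K : set C) : compact K ->
  \forall w \near (0 : C), forall x, K x -> x * w != 1.
Proof.
move/compact_near_coveringP.
move=> /(_ C (nbhs (0 : C)) (fun w x => x * w != 1)); apply => x Kx.
have : (p.1 * p.2 @[p --> (nbhs x, nbhs (0 : C))]) --> x * 0.
  apply: (@cvgM C (C * C)%type (filter_prod (nbhs x) (nbhs (0 : C))) _ fst snd); 
    [exact: (@cvg_fst _ _ (nbhs x) (nbhs (0 : C)))|
     exact: (@cvg_snd _ _ (nbhs x) (nbhs (0 : C)))].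
rewrite mulr0 => /cvgrPdist_lt/(_ 1 ltr01); apply: filterS => -[y v]/=.
by rewrite sub0r normrN; apply: contraTneq => ->; rewrite normr1 ltxx.
Qed.

Lemma sphere_connected : connected [set: sphere].
Proof.
pose L (w : C) : set sphere := Some @` ((fun t : R => t%:C%C * w) @` [set: R]).
have cmul w : continuous (fun t : R => (t%:C%C * w : C)).
  move=> t; apply: (@cvgM C R (nbhs t) _ (fun t : R => t%:C%C : C) (cst w)).
    apply: (cvg_comp (fun t : R => (t, 0 : R))
      (fun p : R * R => (p.1 +i* p.2)%C : C) _ (@Cplx_continuous (t, 0))).
    by apply: (@cvg_pair _ _ _ (nbhs t) (nbhs t) (nbhs (0 : R)) _ _ _ id (cst 0)); [exact: cvg_id|exact: cvg_cst].
  exact: cvg_cst.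
have cL w : connected (L w).
  apply: (@connected_continuous_connected C sphere _ Some).
    apply: (@connected_continuous_connected R C _ (fun t : R => t%:C%C * w)).
      exact/connected_intervalP.
    exact: continuous_subspaceT.
  apply: continuous_subspaceT.
  exact: one_point_compactification_some_continuous.
have -> : [set: sphere] = closure (\bigcup_(w in setT) L w).
  apply/seteqP; split=> // -[w|] _.
    apply: subset_closure; exists w => //.
    by exists w => //; exists 1; rewrite ?mul1r.
  move=> A [K [cK _] KA]; have Kw := compact_away cK.
  near (0 : C)^' => w.
  have w0 : w != 0 by near: w; exact: nbhs_dnbhs_neq.
  have Kw1 x : K x -> x * w != 1.
    by move: x; near: w; apply: (@nbhs_dnbhs C 0); exact: Kw.
  exists (Some w^-1); split; last first.
    by apply: KA; left; exists w^-1 => // /Kw1; rewrite mulVf// eqxx.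
  by exists w^-1 => //; exists w^-1 => //; exists 1; rewrite ?mul1r.
apply: connected_closure; apply: bigcup_connected => //.
by exists (Some 0) => w _; exists 0 => //; exists 0; rewrite ?mul0r.
Unshelve. all: by end_near. Qed.

Definition affine_map (x : sphere) : C := if x is Some w then w else 0.
Definition infty_map (x : sphere) : C := if x is Some w then w^-1 else 0.
Definition infty_inv (w : C) : sphere := if w == 0 then None else Some w^-1.

Lemma infty_invK w : infty_map (infty_inv w) = w.
Proof. by rewrite /infty_inv; case: eqP => [->//|_] /=; rewrite invrK. Qed.

Lemma infty_dom_open : open [set x : sphere | x <> Some 0].
Proof.
rewrite (_ : [set _ | _] = ~` [set (Some 0 : sphere)])//.
apply: closed_openC; apply: accessible_closed_set1.
exact/hausdorff_accessible/sphere_hausdorff.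
Qed.

Lemma infty_map_continuous (x : sphere) : x <> Some 0 -> {for x, continuous infty_map}.
Proof.
case: x => [w w0|_].
  have {}w0 : w != 0 by apply/eqP => h; apply: w0; rewrite h.
  have := @inv_continuous C w w0.
  by move=> + A => /(_ A).
apply/(@cvgrPdist_lt _ C^o _ (nbhs (None : sphere)) _ infty_map 0) => /= e e0.
have := @sphere_nbhs_infty e^-1; rewrite invr_ge0 (ltW e0) => /(_ isT).
apply: filterS => -[w|] /=; last by rewrite subr0 normr0.
move/negP; rewrite sub0r normrN normfV -real_ltNge ?normr_real ?gtr0_real ?invr_gt0//.
by move=> we; rewrite invf_plt// posrE (le_lt_trans _ we)// invr_ge0 ltW.
Qed.

Lemma infty_inv_continuous : continuous infty_inv.
Proof.
move=> w; have [->|w0] := eqVneq w 0; last first.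
  rewrite /continuous_at {2}/infty_inv (negbTE w0).
  have near_w : \forall v \near w, Some v^-1 = infty_inv v :> sphere.
    have : open [set~ (0 : C)].
      apply/closed_openC/accessible_closed_set1/hausdorff_accessible.
      exact: (@norm_hausdorff _ C^o).
    rewrite openE => /(_ w)/= /(_ _); rewrite /interior.
    have /[swap]/[apply] : w <> 0 by exact/eqP.
    by apply: filterS => v /eqP v0; rewrite /infty_inv (negbTE v0).
  apply: cvg_trans (near_eq_cvg near_w) _.
  apply: (@cvg_comp _ _ _ (@GRing.inv C) Some _ (nbhs w^-1)).
    exact: inv_continuous.
  exact: one_point_compactification_some_continuous.
rewrite /continuous_at {2}/infty_inv eqxx => A [K [cK _] KA].
move: (compact_away cK); apply: filterS => v h; apply: KA; rewrite /infty_inv.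
case: (eqVneq v 0) => [_|v0]; first by right.
by left; exists v^-1 => // /h; rewrite mulVf// eqxx.
Qed.

Definition affine_dom : set sphere := range Some.
Definition infty_dom : set sphere := [set x | x <> Some 0].

Lemma affine_dom_open : open affine_dom.
Proof. exact/one_point_compactification_open_some/openT. Qed.

Lemma affine_img_open : open (affine_map @` affine_dom).
Proof.
rewrite (_ : _ @` _ = setT); first exact: openT.
by apply/seteqP; split=> // w _; exists (Some w) => //; exists w.
Qed.

Lemma affine_mapK x : affine_dom x -> Some (affine_map x) = x.
Proof. by case=> w _ <-. Qed.

Lemma affine_map_continuous x : affine_dom x -> {for x, continuous affine_map}.
Proof. by case=> w _ <- A. Qed.

Lemma affine_inv_continuous x : affine_dom x ->
  {for affine_map x, continuous (Some : C -> sphere)}.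
Proof. by move=> _; exact: one_point_compactification_some_continuous. Qed.

Definition affine_chart : chart R sphere := Chart affine_dom_open
  affine_img_open affine_mapK affine_map_continuous affine_inv_continuous.

Lemma infty_img_open : open (infty_map @` infty_dom).
Proof.
rewrite (_ : _ @` _ = setT); first exact: openT.
apply/seteqP; split=> // w _; exists (infty_inv w); last exact: infty_invK.
rewrite /infty_dom /infty_inv/=; case: eqVneq => // w0 [/eqP].
by rewrite invr_eq0 (negbTE w0).
Qed.

Lemma infty_mapK x : infty_dom x -> infty_inv (infty_map x) = x.
Proof.
rewrite /infty_dom /infty_inv; case: x => [w|] /=; last by rewrite eqxx.
by rewrite invr_eq0 invrK; case: eqP => // ->.
Qed.

Definition infty_chart : chart R sphere := Chart infty_dom_open
  infty_img_open infty_mapK infty_map_continuous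
  (fun x _ => infty_inv_continuous (x := infty_map x)).

Definition sphere_atlas : set (chart R sphere) := [set affine_chart; infty_chart].

Lemma sphere_atlas_cover x : exists2 a, sphere_atlas a & chart_dom a x.
Proof.
case: x => [w|]; first by exists affine_chart; [left|exists w].
by exists infty_chart; [right|].
Qed.

Lemma sphere_atlas_compat a b : sphere_atlas a -> sphere_atlas b ->
  forall x, chart_dom a x -> chart_dom b x ->
    derivable (in_charts a b id) (a x : C) 1.
Proof.
have dinv (w : C) : w != 0 -> derivable (fun v : C => v^-1) w 1.
  by move=> w0; exact: derivableV.
move=> [] -> [] -> x /=.
- move=> [w _ <-] _; rewrite (_ : in_charts _ _ _ = id)//; exact: derivable_id.
- move=> [w _ <-] w0; rewrite (_ : in_charts _ _ _ = fun v => v^-1)//.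
  by apply: dinv; apply/eqP => h; apply: w0; congr Some; exact: h.
- move=> + [w _ wx]; rewrite -wx /= => w0.
  rewrite (_ : in_charts _ _ _ = fun v => v^-1).
    by apply: dinv; rewrite invr_eq0; apply/eqP => h; apply: w0; rewrite h.
  apply/funext => v; rewrite /in_charts/= /infty_inv.
  by case: eqP => // ->; rewrite invr0.
- move=> _ _; rewrite (_ : in_charts _ _ _ = id); first exact: derivable_id.
  by apply/funext => v; exact: infty_invK.
Qed.

(* CP^1 as C with a point at infinity, with the coordinates w and 1/w. *)
Definition CP1 : riemann_surface R := RiemannSurface sphere_atlas_cover
  sphere_atlas_compat sphere_hausdorff sphere_connected
  one_point_compactification_compact (ex_intro _ None I).

End RiemannSphere.

Section MatrixAction.
Variables (n m r : nat) (alf : 'I_r -> 'S_n) (alg : 'I_r -> 'S_m).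

Lemma delta_inj i :
  injective (fun c : 'I_n * 'I_m => (alf i c.1, alg i c.2)).
Proof. by move=> [j1 j2] [k1 k2] /= [/perm_inj -> /perm_inj ->]. Qed.

(* The pair (j1, j2) stands for c_{j1,j2}; rows are indexed by 'I_n. *)
Definition delta i : {perm 'I_n * 'I_m} := perm (@delta_inj i).

Definition Gamma : {group {perm 'I_n * 'I_m}} :=
  <<[set delta i | i : 'I_r]>>%G.

Definition Gamma_orbits : {set {set 'I_n * 'I_m}} :=
  [set orbit 'P Gamma c | c : 'I_n * 'I_m].

Definition o_fg : nat := #|Gamma_orbits|.

Definition U_ (j : 'I_o_fg) : {set 'I_n * 'I_m} := enum_val j.

Definition delta_ (j : 'I_o_fg) (i : 'I_r) : {perm 'I_n * 'I_m} :=
  restr_perm (U_ j) (delta i).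

End MatrixAction.

Definition mrow (n m : nat) (k : 'I_n) : {set 'I_n * 'I_m} :=
  [set c | c.1 == k].
Definition mcol (n m : nat) (k : 'I_m) : {set 'I_n * 'I_m} :=
  [set c | c.2 == k].

(* The fibres of [u] over the points of [P] are exactly the blocks [lab (B k)]. *)
Definition fibres_are (X Y : Type) (u : X -> Y) (P : set Y)
    (T I : finType) (lab : T -> X) (B : I -> {set T}) : Prop :=
  [set u @^-1` [set y] | y in P] = [set lab @` [set` B k] | k in [set: I]].

(* Main.v *)
Require Import Defs.
From HB Require Import structures.
From mathcomp Require Import all_boot all_order all_algebra all_fingroup.
From mathcomp Require Import complex ring lra.
From mathcomp Require Import all_classical all_reals all_analysis.

Set Implicit Arguments.
Unset Strict Implicit.
Unset Printing Implicit Defensive.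

Import Order.TTheory GRing.Theory Num.Theory numFieldNormedType.Exports.

Local Open Scope classical_set_scope.
Local Open Scope ring_scope.

(** Why the theorem holds.  Choose x0 in X over the base point z0, which is
    possible because h is onto, and let c0 be the pair of the labels of p x0 and
    q x0.  It lies in one orbit U_j.  If the image under h of a loop at x0 is
    lifted through f and g, the lifts are the images of the loop under p and q,
    hence closed, so the monodromy action of that image fixes both entries of c0
    and therefore c0.  As the covering h_j has the monodromy action on U_j, the
    lift through h_j starting at the point labelled c0 is closed too.  By the
    lifting criterion ([lifting]) there is a holomorphic w with h = h_j \o w that
    sends x0 to that point.

    The map u_j need not send the point labelled c0 to p x0, for its fibres are the
    rows of U_j only as a family of sets.  But its image under u_j and p x0 have the
    same stabilizer ([row_stabilizer]), so an automorphism mu of C1 over f sends the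
    former to the latter ([deck_transformation]), and p' = mu \o u_j satisfies
    p = p' \o w because both sides are lifts of h that agree at x0 ([lift_eq]).
    The same is done for q.

    The lifting criterion rests on two bodies of theory, developed here as far as
    the argument uses them.  One is topological: paths and homotopies can be
    lifted through a map that has local sections ([lift_exists],
    [lift_homotopic]).  The other is complex analysis in one variable, obtained
    from Goursat's lemma for rectangles ([goursat], [cauchy_formula]).  Removable
    singularities ([removable]) serve twice, for the holomorphy of lifts at the
    preimages of the critical values and for dividing f z - f a by z - a
    ([division]).  With a weak maximum principle ([square_bound]) they yield that
    fibres are discrete ([isolated_value]), that holomorphic maps are open
    ([open_value]) and that they are injective near a point where the derivative
    does not vanish ([local_inj]); so a holomorphic map of compact surfaces is a
    covering away from its critical values ([holo_covering]).  A lift constructed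
    off the preimage of the critical values extends to the whole surface
    ([extension], [lift_holomorphic]). *)

(** * The modulus on C *)

Section Modulus.
Variable R : realType.
Local Notation C := (Cplx R).
Implicit Types (z w a : C) (x y r e : R).

(** Typed at [C], so that the field operations applied to these numbers are
    those of [C] and not those of the convertible type [R[i]]. *)
Definition mkC (x y : R) : C := (x +i* y)%C.
Definition iC : C := mkC 0 1.
Definition rC (x : R) : C := mkC x 0.

(** The norm of [C] takes its values in [C]; real inequalities are proved with this
    modulus instead. *)
Definition cabs (z : C) : R := complex.Re `|z|.

Lemma normE z : `|z| = (cabs z)%:C%C.
Proof. by rewrite /cabs RRe_real// normr_real. Qed.

Lemma cabs_ge0 z : 0 <= cabs z.
Proof. by rewrite -(@lecR R) -normE; exact: normr_ge0. Qed.

Lemma cabsD z w : cabs (z + w) <= cabs z + cabs w.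
Proof. by rewrite -(@lecR R) rmorphD/= -!normE ler_normD. Qed.

Lemma cabsM z w : cabs (z * w) = cabs z * cabs w.
Proof. by apply: (@complexI R); rewrite rmorphM/= -!normE normrM. Qed.

Lemma cabsN z : cabs (- z) = cabs z.
Proof. by rewrite /cabs normrN. Qed.

Lemma cabsC z w : cabs (z - w) = cabs (w - z).
Proof. by rewrite -cabsN opprB. Qed.

Lemma cabs0 : cabs 0 = 0.
Proof. by rewrite /cabs normr0. Qed.

Lemma cabs1 : cabs 1 = 1.
Proof. by rewrite /cabs normr1. Qed.

Lemma cabsX z n : cabs (z ^+ n) = cabs z ^+ n.
Proof. by elim: n => [|n ih]; rewrite ?expr0 ?cabs1// !exprS cabsM ih. Qed.

Lemma cabsV z : cabs z^-1 = (cabs z)^-1.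
Proof. by apply: (@complexI R); rewrite fmorphV/= -!normE normfV. Qed.

Lemma cabs_eq0 z : (cabs z == 0) = (z == 0).
Proof.
rewrite -[RHS]normr_eq0 normE; apply/eqP/eqP => [->//|h].
exact: (@complexI R).
Qed.

Lemma cabs_gt0 z : (0 < cabs z) = (z != 0).
Proof. by rewrite lt_neqAle cabs_ge0 eq_sym cabs_eq0 andbT. Qed.

Lemma cabs_rC x : cabs (rC x) = `|x|.
Proof. by rewrite /cabs normc_def/= expr0n/= addr0 sqrtr_sqr. Qed.

Lemma cabsB z w a : cabs (z - w) <= cabs (z - a) + cabs (a - w).
Proof. by rewrite -[z - w](subrKA a) cabsD. Qed.

Lemma cabs_iC : cabs iC = 1.
Proof. by rewrite /cabs normc_def/= expr0n expr1n add0r sqrtr1. Qed.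

Lemma cabs_lip z w : `|cabs z - cabs w| <= cabs (z - w).
Proof.
rewrite ler_norml; apply/andP; split.
  by rewrite lerNl opprB lerBlDr cabsC -{1}(subrK z w) cabsD.
by rewrite lerBlDr -{1}(subrK w z) cabsD.
Qed.

Lemma cabs_Re z : `|complex.Re z| <= cabs z.
Proof. by rewrite -(@lecR R) -normE; exact: normc_ge_Re. Qed.

Lemma cabs_Im z : `|complex.Im z| <= cabs z.
Proof.
case: z => x y /=; rewrite /cabs normc_def/= -sqrtr_sqr ler_wsqrtr//.
by rewrite lerDr sqr_ge0.
Qed.

Lemma cabs_le z : cabs z <= `|complex.Re z| + `|complex.Im z|.
Proof. by case: z => x y; rewrite -(@lecR R) -normE; exact: Cplx_norm_le. Qed.

Lemma nbhs_cabsP (a : C) (A : set C) :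
  nbhs a A <-> exists2 r : R, 0 < r & forall z, cabs (z - a) < r -> A z.
Proof.
split=> [/nbhs_ballP[e/= e0 eA]|[r r0 rA]].
  have eE : e = (complex.Re e)%:C%C by rewrite RRe_real// gtr0_real.
  exists (complex.Re e); first by rewrite -(@ltcR R) -eE.
  move=> z za; apply: eA; rewrite -ball_normE/= distrC normE eE ltcR; exact: za.
apply/nbhs_ballP; exists r%:C%C => /=; first by rewrite ltcR.
by move=> z; rewrite -ball_normE/= distrC normE ltcR; exact: rA.
Qed.

Lemma cvg_cabsP T (F : set_system T) {FF : Filter F} (f : T -> C) (l : C) :
  f @ F --> l <-> forall e : R, 0 < e -> \forall x \near F, cabs (f x - l) < e.
Proof.
split=> [fl e e0|h A /nbhs_cabsP[r r0 rA]].
  by apply: (fl [set y | cabs (y - l) < e]); apply/nbhs_cabsP; exists e.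
by apply: filterS (h _ r0) => x /rA.
Qed.

Lemma continuous_cabsP (f : C -> C) (a : C) : {for a, continuous f} <->
  forall e, 0 < e -> exists2 d, 0 < d &
    forall z, cabs (z - a) < d -> cabs (f z - f a) < e.
Proof.
have P := @cvg_cabsP C (nbhs a) _ f (f a).
split=> [/P h e /h /nbhs_cabsP//|h].
by apply/P => e e0; apply/nbhs_cabsP; exact: h.
Qed.

Lemma derivable_slope (f : C -> C) (a : C) : derivable f a 1 ->
  forall e, 0 < e -> exists2 d, 0 < d & forall z, cabs (z - a) < d ->
    cabs (f z - f a - f^`()%classic a * (z - a)) <= e * cabs (z - a).
Proof.
move=> df e e0; rewrite derive1E.
have : (fun h : C => h^-1 *: ((f \o shift a) (h *: 1) - f a)) @ 0^' --> 'D_1 f a by [].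
move=> /cvg_cabsP/(_ _ e0); rewrite /nbhs/=/dnbhs/within/= => /nbhs_cabsP[d d0 H].
exists d => // z zd; have [->|za] := eqVneq z a.
  by rewrite !subrr mulr0 subrr cabs0 mulr0.
have := H (z - a); rewrite subr0 subr_eq0 => /(_ zd za).
rewrite /shift/= [(z - a) *: 1]mulr1 subrK => /ltW.
rewrite -(ler_pM2r (_ : 0 < cabs (z - a))) ?cabs_gt0 ?subr_eq0//.
rewrite -cabsM; congr (cabs _ <= _).
rewrite mulrBl; congr (_ - _).
by rewrite [_ *: _]mulrC mulfVK// subr_eq0.
Qed.

Lemma derivable_slopeP (f : C -> C) (a l : C) :
  (forall e, 0 < e -> exists2 d, 0 < d & forall z, cabs (z - a) < d ->
    cabs (f z - f a - l * (z - a)) <= e * cabs (z - a)) ->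
  derivable f a 1 /\ f^`()%classic a = l.
Proof.
move=> H; rewrite derive1E.
have h : (fun h : C => h^-1 *: ((f \o shift a) (h *: 1) - f a)) @ 0^' --> l.
  apply/cvg_cabsP => e e0.
  have e2 : 0 < e / 2 by lra.
  have [d d0 Hd] := H _ e2.
  rewrite /nbhs/=/dnbhs/within/=; apply/nbhs_cabsP; exists d => // h; rewrite subr0 => hd h0.
  have := Hd (h + a); rewrite addrK => /(_ hd).
  rewrite /shift/= [h *: 1]mulr1 => hh.
  have c0 : 0 < cabs h by rewrite cabs_gt0.
  rewrite -(ltr_pM2r c0) -cabsM mulrBl [_ *: _]mulrC mulfVK//.
  by apply: le_lt_trans hh _; rewrite ltr_pM2r//; lra.
split; first by apply/cvg_ex; exists l.
by apply: (cvg_lim _ h); exact: (@norm_hausdorff _ C^o).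
Qed.

End Modulus.

(** * Complex-valued integrals over real intervals *)

Section ComplexIntegral.
Variable R : realType.
Local Notation C := (Cplx R).
Local Notation mu := (@lebesgue_measure R).
Implicit Types (a b c M : R) (phi psi : R -> C).

Definition Cint a b phi : C :=
  mkC (\int[mu]_(t in `[a, b]) complex.Re (phi t)) 
   (\int[mu]_(t in `[a, b]) complex.Im (phi t)).

Lemma complex_ext (z w : C) : complex.Re z = complex.Re w ->
  complex.Im z = complex.Im w -> z = w.
Proof. by case: z w => [x y] [x' y'] /= -> ->. Qed.

Lemma cReM (z w : C) :
  complex.Re (z * w) = complex.Re z * complex.Re w - complex.Im z * complex.Im w.
Proof. by case: z w => [x y] [x' y']. Qed.

Lemma cImM (z w : C) :
  complex.Im (z * w) = complex.Re z * complex.Im w + complex.Im z * complex.Re w.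
Proof. by case: z w => [x y] [x' y']. Qed.

Lemma cReD (z w : C) : complex.Re (z + w) = complex.Re z + complex.Re w.
Proof. by case: z w => [x y] [x' y']. Qed.

Lemma cImD (z w : C) : complex.Im (z + w) = complex.Im z + complex.Im w.
Proof. by case: z w => [x y] [x' y']. Qed.

Lemma cReN (z : C) : complex.Re (- z) = - complex.Re z.
Proof. by case: z. Qed.

Lemma cImN (z : C) : complex.Im (- z) = - complex.Im z.
Proof. by case: z. Qed.

Definition cont_on a b phi := forall t, a <= t <= b -> {for t, continuous phi}.

Lemma integrable_comp a b phi (u : C -> R) :
  (forall z w, `|u z - u w| <= cabs (z - w)) -> cont_on a b phi ->
  mu.-integrable `[a, b] (EFin \o (u \o phi)).
Proof.
move=> hu ct; apply: continuous_compact_integrable; first exact: segment_compact.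
apply: continuous_in_subspaceT => t; rewrite inE/= in_itv/= => /ct/cvg_cabsP h.
apply/cvgrPdist_lt => /= e e0; have := h _ e0; apply: filterS => s /=.
by rewrite distrC; apply: le_lt_trans; exact: hu.
Qed.

Lemma Re_lip (z w : C) : `|complex.Re z - complex.Re w| <= cabs (z - w).
Proof. by rewrite -raddfB/= cabs_Re. Qed.

Lemma Im_lip (z w : C) : `|complex.Im z - complex.Im w| <= cabs (z - w).
Proof. by rewrite -raddfB/= cabs_Im. Qed.

Let iRe a b phi (h : cont_on a b phi) :
  mu.-integrable `[a, b] (EFin \o (fun t => complex.Re (phi t))).
Proof. exact: (integrable_comp Re_lip h). Qed.

Let iIm a b phi (h : cont_on a b phi) :
  mu.-integrable `[a, b] (EFin \o (fun t => complex.Im (phi t))).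
Proof. exact: (integrable_comp Im_lip h). Qed.

Lemma eq_Cint a b phi psi : (forall t, a <= t <= b -> phi t = psi t) ->
  Cint a b phi = Cint a b psi.
Proof.
by move=> h; congr (_ +i* _)%C; apply: eq_Rintegral => t;
  rewrite inE/= in_itv/= => /h ->.
Qed.

Lemma CintD a b phi psi : cont_on a b phi -> cont_on a b psi ->
  Cint a b (fun t => phi t + psi t) = Cint a b phi + Cint a b psi.
Proof.
move=> h1 h2; apply: complex_ext; rewrite raddfD/= -RintegralD//;
  try (exact: iRe || exact: iIm);
  by apply: eq_Rintegral => t _; rewrite raddfD.
Qed.

Lemma CintZ a b (k : C) phi : cont_on a b phi ->
  Cint a b (fun t => k * phi t) = k * Cint a b phi.
Proof.
move=> h; have cR := iRe h; have cI := iIm h.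
have Z (r : R) (f : R -> R) : mu.-integrable `[a, b] (EFin \o f) ->
    mu.-integrable `[a, b] (EFin \o (fun t => r * f t)).
  by move=> hf; apply: eq_integrable (integrableZl _ r hf).
apply: complex_ext; rewrite ?cReM ?cImM/= -!RintegralZl//.
  rewrite -RintegralB//; try exact: Z.
  by apply: eq_Rintegral => t _; rewrite cReM.
rewrite -RintegralD//; try exact: Z.
by apply: eq_Rintegral => t _; rewrite cImM.
Qed.

Lemma CintB a b phi psi : cont_on a b phi -> cont_on a b psi ->
  Cint a b (fun t => phi t - psi t) = Cint a b phi - Cint a b psi.
Proof.
move=> h1 h2.
have h3 : cont_on a b (fun t => -1 * psi t).
  by move=> t /h2/cvg_cabsP H; apply/cvg_cabsP => e /H; apply: filterS => s;
    rewrite !mulN1r -opprD cabsN.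
rewrite -[X in _ = _ + X]mulN1r -CintZ// -CintD//.
by apply: eq_Cint => t _; rewrite mulN1r.
Qed.

Lemma Rint_cst a b (k : R) : a <= b -> \int[mu]_(t in `[a, b]) k = k * (b - a).
Proof.
move=> ab; rewrite Rintegral_cst//= lebesgue_measure_itv/= lte_fin.
case: ltP => [//|ba]; have -> : a = b by apply/eqP; rewrite eq_le ab ba.
by rewrite subrr.
Qed.

Lemma Cint_cst a b (k : C) : a <= b -> Cint a b (fun=> k) = k * rC (b - a).
Proof.
move=> ab; rewrite /Cint !Rint_cst//.
by apply: complex_ext; rewrite ?cReM ?cImM/=; ring.
Qed.

Lemma Rint_split a b c (f : R -> R) : a <= c -> c <= b ->
  mu.-integrable `[a, b] (EFin \o f) ->
  \int[mu]_(t in `[a, b]) f t =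
  \int[mu]_(t in `[a, c]) f t + \int[mu]_(t in `[c, b]) f t.
Proof.
move=> ac cb h.
have := @Rintegral_itvB R f (BLeft a) (BRight b) c h.
rewrite !bnd_simp => /(_ ac cb) hh.
rewrite -(@Rintegral_itv_obnd_cbnd _ c (BRight b)).
  by rewrite -hh addrC subrK.
apply: integrableS h => //; apply: subset_itv; rewrite ?bnd_simp//.
Qed.

Lemma Cint_split a b c phi : a <= c -> c <= b -> cont_on a b phi ->
  Cint a b phi = Cint a c phi + Cint c b phi.
Proof.
move=> ac cb h; apply: complex_ext; rewrite raddfD/=; apply: Rint_split => //.
  exact: iRe.
exact: iIm.
Qed.

Lemma integrable_cst a b (k : R) : mu.-integrable `[a, b] (EFin \o cst k).
Proof.
apply: continuous_compact_integrable; first exact: segment_compact.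
by apply: continuous_in_subspaceT => t _; exact: cvg_cst.
Qed.

Lemma Rint_ge a b m (f : R -> R) : a <= b -> mu.-integrable `[a, b] (EFin \o f) ->
  (forall t, a <= t <= b -> m <= f t) -> m * (b - a) <= \int[mu]_(t in `[a, b]) f t.
Proof.
move=> ab h hm; rewrite -Rint_cst//; by apply: le_Rintegral => //; exact: integrable_cst.
Qed.

Lemma Rint_le a b m (f : R -> R) : a <= b -> mu.-integrable `[a, b] (EFin \o f) ->
  (forall t, a <= t <= b -> f t <= m) -> \int[mu]_(t in `[a, b]) f t <= m * (b - a).
Proof.
move=> ab h hm; rewrite -Rint_cst//; by apply: le_Rintegral => //; exact: integrable_cst.
Qed.

Lemma Im_Cint_ge a b m phi : a <= b -> cont_on a b phi ->
  (forall t, a <= t <= b -> m <= complex.Im (phi t)) ->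
  m * (b - a) <= complex.Im (Cint a b phi).
Proof. by move=> ab h hm; apply: Rint_ge => //; exact: iIm. Qed.

(** The factor 2 comes from bounding the real and the imaginary parts
    separately; no later argument depends on sharp constants. *)
Lemma cabs_Cint a b M phi : a <= b -> cont_on a b phi ->
  (forall t, a <= t <= b -> cabs (phi t) <= M) ->
  cabs (Cint a b phi) <= 2 * M * (b - a).
Proof.
move=> ab h hM; apply: le_trans (cabs_le _) _ => /=.
have H (u : C -> R) : (forall z, `|u z| <= cabs z) ->
    mu.-integrable `[a, b] (EFin \o (u \o phi)) ->
    `|\int[mu]_(t in `[a, b]) u (phi t)| <= M * (b - a).
  move=> hu iu; rewrite ler_norml -mulNr; apply/andP; split.
    apply: Rint_ge => // t /hM; have := hu (phi t); rewrite ler_norml; lra.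
  apply: Rint_le => // t /hM; have := hu (phi t); rewrite ler_norml; lra.
have := H _ (@cabs_Re R) (iRe h); have := H _ (@cabs_Im R) (iIm h); lra.
Qed.

End ComplexIntegral.

(** * Integrals along the boundary of a rectangle *)

Section RectangleIntegral.
Variable R : realType.
Local Notation C := (Cplx R).
Implicit Types (f g : C -> C) (z w : C) (x y : R).

Definition inrect x0 x1 y0 y1 z : Prop :=
  x0 <= complex.Re z <= x1 /\ y0 <= complex.Im z <= y1.

Definition onbd x0 x1 y0 y1 z : Prop :=
  inrect x0 x1 y0 y1 z /\ [\/ complex.Re z = x0, complex.Re z = x1,
    complex.Im z = y0 | complex.Im z = y1].

Definition cont_bd x0 x1 y0 y1 f : Prop :=
  forall z, onbd x0 x1 y0 y1 z -> {for z, continuous f}.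

(** The integral of f along the boundary of a rectangle, opposite sides being
    paired so that only two integrals over intervals are needed. *)
Definition rectint f x0 x1 y0 y1 : C :=
  Cint x0 x1 (fun x => f (mkC x y0) - f (mkC x y1)) +
  iC R * Cint y0 y1 (fun y => f (mkC x1 y) - f (mkC x0 y)).

Lemma continuous_hline y x : {for x, continuous (fun x => (mkC x y) : C)}.
Proof.
apply/cvg_cabsP => e e0; have := @cvg_id _ (nbhs x) => /cvgrPdist_lt/(_ _ e0).
apply: filterS => t /= h; apply: le_lt_trans (cabs_le _) _.
by rewrite /= subrr normr0 addr0 distrC.
Qed.

Lemma continuous_vline x y : {for y, continuous (fun y => (mkC x y) : C)}.
Proof.
apply/cvg_cabsP => e e0; have := @cvg_id _ (nbhs y) => /cvgrPdist_lt/(_ _ e0).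
apply: filterS => t /= h; apply: le_lt_trans (cabs_le _) _.
by rewrite /= subrr normr0 add0r distrC.
Qed.

Lemma continuous_subC T (F : set_system T) {FF : Filter F} (u v : T -> C) a b :
  u @ F --> a -> v @ F --> b -> (fun t => u t - v t) @ F --> a - b.
Proof.
move=> /cvg_cabsP hu /cvg_cabsP hv; apply/cvg_cabsP => e e0.
have e2 : 0 < e / 2 by lra.
near=> t.
rewrite (_ : _ - _ = (u t - a) + - (v t - b)); last by ring.
apply: le_lt_trans (cabsD _ _) _; rewrite cabsN (splitr e); apply: ltrD.
  by near: t; exact: hu.
by near: t; exact: hv.
Unshelve. all: by end_near. Qed.

Section Fixed.
Variables x0 x1 y0 y1 : R.
Hypothesis (x01 : x0 <= x1) (y01 : y0 <= y1).

Lemma cont_bd_h f : cont_bd x0 x1 y0 y1 f ->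
  cont_on x0 x1 (fun x => f (mkC x y0) - f (mkC x y1)).
Proof.
move=> h x xx.
have c y : y = y0 \/ y = y1 -> {for x, continuous (fun x => f (mkC x y))}.
  move=> yy; apply: (@continuous_comp _ _ _ (fun x => (mkC x y) : C) f).
    exact: continuous_hline.
  by apply: h; case: yy => ->; split; try (by split; rewrite /= ?xx ?lexx ?y01);
    [constructor 3|constructor 4].
exact: (continuous_subC (c _ (or_introl erefl)) (c _ (or_intror erefl))).
Qed.

Lemma cont_bd_v f : cont_bd x0 x1 y0 y1 f ->
  cont_on y0 y1 (fun y => f (mkC x1 y) - f (mkC x0 y)).
Proof.
move=> h y yy.
have c x : x = x0 \/ x = x1 -> {for y, continuous (fun y => f (mkC x y))}.
  move=> xx; apply: (@continuous_comp _ _ _ (fun y => (mkC x y) : C) f).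
    exact: continuous_vline.
  by apply: h; case: xx => ->; split; try (by split; rewrite /= ?yy ?lexx ?x01);
    [constructor 1|constructor 2].
exact: (continuous_subC (c _ (or_intror erefl)) (c _ (or_introl erefl))).
Qed.

Lemma onbd_h x y : x0 <= x <= x1 -> y = y0 \/ y = y1 ->
  onbd x0 x1 y0 y1 (mkC x y).
Proof.
move=> xx [] ->; split; first by split; rewrite //= lexx.
- by constructor 3.
- by split; rewrite //= lexx andbT.
- by constructor 4.
Qed.

Lemma onbd_v x y : y0 <= y <= y1 -> x = x0 \/ x = x1 ->
  onbd x0 x1 y0 y1 (mkC x y).
Proof.
move=> yy [] ->; split; first by split; rewrite //= lexx.
- by constructor 1.
- by split; rewrite //= lexx andbT.
- by constructor 2.
Qed.

Lemma rectint_eq f g : (forall z, onbd x0 x1 y0 y1 z -> f z = g z) ->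
  rectint f x0 x1 y0 y1 = rectint g x0 x1 y0 y1.
Proof.
move=> fg; congr (_ + _ * _); apply: eq_Cint => t tt; congr (_ - _); apply: fg.
- by apply: onbd_h => //; left.
- by apply: onbd_h => //; right.
- by apply: onbd_v => //; right.
- by apply: onbd_v => //; left.
Qed.

Lemma rectint_sub f g : cont_bd x0 x1 y0 y1 f -> cont_bd x0 x1 y0 y1 g ->
  rectint (fun z => f z - g z) x0 x1 y0 y1 = rectint f x0 x1 y0 y1 - rectint g x0 x1 y0 y1.
Proof.
move=> hf hg; rewrite /rectint.
rewrite opprD addrACA -mulrBr -CintB; [|exact: cont_bd_h|exact: cont_bd_h].
rewrite -CintB; [|exact: cont_bd_v|exact: cont_bd_v].
by congr (_ + _ * _); apply: eq_Cint => t _; ring.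
Qed.

Lemma rectint_scale (k : C) f : cont_bd x0 x1 y0 y1 f ->
  rectint (fun z => k * f z) x0 x1 y0 y1 = k * rectint f x0 x1 y0 y1.
Proof.
move=> hf; rewrite /rectint mulrDr mulrCA -(CintZ k (cont_bd_h hf)) -(CintZ k (cont_bd_v hf)).
by congr (_ + _ * _); apply: eq_Cint => t _; ring.
Qed.

Lemma rectint_affine (a b : C) : rectint (fun z => a + b * z) x0 x1 y0 y1 = 0.
Proof.
rewrite /rectint (@eq_Cint _ _ _ _ (fun=> b * mkC 0 (y0 - y1))).
  rewrite (@eq_Cint _ y0 _ _ (fun=> b * rC (x1 - x0))).
    rewrite !Cint_cst//; by apply: complex_ext; rewrite !(cReD, cImD, cReM, cImM)/=; ring.
  move=> t _; rewrite opprD addrACA subrr add0r -mulrBr; congr (_ * _).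
  by apply: complex_ext; rewrite !(cReD, cImD, cReN, cImN)/= ?subrr.
move=> t _; rewrite opprD addrACA subrr add0r -mulrBr; congr (_ * _).
by apply: complex_ext; rewrite !(cReD, cImD, cReN, cImN)/= ?subrr.
Qed.

Lemma rectint_bound f M : cont_bd x0 x1 y0 y1 f ->
  (forall z, onbd x0 x1 y0 y1 z -> cabs (f z) <= M) ->
  cabs (rectint f x0 x1 y0 y1) <= 4 * M * ((x1 - x0) + (y1 - y0)).
Proof.
move=> hf hM; apply: le_trans (cabsD _ _) _; rewrite cabsM.
rewrite cabs_iC.
have h1 := @cabs_Cint R x0 x1 (M + M) _ x01 (cont_bd_h hf).
have h2 := @cabs_Cint R y0 y1 (M + M) _ y01 (cont_bd_v hf).
rewrite mul1r mulrDr; apply: lerD.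
  apply: le_trans (h1 _) _; last by lra.
  move=> t tt; apply: le_trans (cabsD _ _) _; rewrite cabsN.
  by apply: lerD; apply: hM; apply: onbd_h => //; [left|right].
apply: le_trans (h2 _) _; last by lra.
move=> t tt; apply: le_trans (cabsD _ _) _; rewrite cabsN.
by apply: lerD; apply: hM; apply: onbd_v => //; [right|left].
Qed.

End Fixed.

Lemma cont_bd_splitx x0 x1 x2 y0 y1 f : x0 <= x1 -> x1 <= x2 ->
  cont_bd x0 x1 y0 y1 f -> cont_bd x1 x2 y0 y1 f -> cont_bd x0 x2 y0 y1 f.
Proof.
move=> h1 h2 c1 c2 z [[/andP[z1 z2] z3] b].
have [zx|zx] := leP (complex.Re z) x1.
  case: b => b; first by apply: c1; split; [split; rewrite ?z1|constructor 1].
  - have e : complex.Re z = x1 by apply/eqP; rewrite eq_le zx b h2.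
    by apply: c1; split; [split; rewrite ?z1|constructor 2].
  - by apply: c1; split; [split; rewrite ?z1|constructor 3].
  - by apply: c1; split; [split; rewrite ?z1|constructor 4].
case: b => b.
- by move: zx; rewrite b ltNge h1.
- by apply: c2; split; [split; rewrite ?(ltW zx)|constructor 2].
- by apply: c2; split; [split; rewrite ?(ltW zx)|constructor 3].
- by apply: c2; split; [split; rewrite ?(ltW zx)|constructor 4].
Qed.

Lemma cont_bd_splity x0 x1 y0 y1 y2 f : y0 <= y1 -> y1 <= y2 ->
  cont_bd x0 x1 y0 y1 f -> cont_bd x0 x1 y1 y2 f -> cont_bd x0 x1 y0 y2 f.
Proof.
move=> h1 h2 c1 c2 z [[z3 /andP[z1 z2]] b].
have [zx|zx] := leP (complex.Im z) y1.
  case: b => b; first by apply: c1; split; [split; rewrite ?z1|constructor 1].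
  - by apply: c1; split; [split; rewrite ?z1|constructor 2].
  - by apply: c1; split; [split; rewrite ?z1|constructor 3].
  - have e : complex.Im z = y1 by apply/eqP; rewrite eq_le zx b h2.
    by apply: c1; split; [split; rewrite ?z1|constructor 4].
case: b => b.
- by apply: c2; split; [split; rewrite ?(ltW zx)|constructor 1].
- by apply: c2; split; [split; rewrite ?(ltW zx)|constructor 2].
- by move: zx; rewrite b ltNge h1.
- by apply: c2; split; [split; rewrite ?(ltW zx)|constructor 4].
Qed.

Lemma rectint_splitx x0 x1 x2 y0 y1 f : x0 <= x1 -> x1 <= x2 -> y0 <= y1 ->
  cont_bd x0 x1 y0 y1 f -> cont_bd x1 x2 y0 y1 f ->
  rectint f x0 x2 y0 y1 = rectint f x0 x1 y0 y1 + rectint f x1 x2 y0 y1.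
Proof.
move=> h1 h2 h3 c1 c2; rewrite /rectint (@Cint_split _ x0 x2 x1)//; last first.
  by apply: cont_bd_h => //; exact: cont_bd_splitx c1 c2.
rewrite (@eq_Cint _ y0 y1 _ (fun y => (f (mkC x2 y) - f (mkC x1 y)) +
  (f (mkC x1 y) - f (mkC x0 y)))); last by move=> t _; rewrite subrKA.
rewrite (CintD (cont_bd_v h2 c2) (cont_bd_v h1 c1)).
ring.
Qed.

Lemma rectint_splity x0 x1 y0 y1 y2 f : x0 <= x1 -> y0 <= y1 -> y1 <= y2 ->
  cont_bd x0 x1 y0 y1 f -> cont_bd x0 x1 y1 y2 f ->
  rectint f x0 x1 y0 y2 = rectint f x0 x1 y0 y1 + rectint f x0 x1 y1 y2.
Proof.
move=> h1 h2 h3 c1 c2; rewrite /rectint (@Cint_split _ y0 y2 y1)//; last first.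
  by apply: cont_bd_v => //; exact: cont_bd_splity c1 c2.
rewrite (@eq_Cint _ x0 x1 _ (fun x => (f (mkC x y0) - f (mkC x y1)) +
  (f (mkC x y1) - f (mkC x y2)))); last by move=> t _; rewrite subrKA.
rewrite (CintD (cont_bd_h h2 c1) (cont_bd_h h3 c2)).
ring.
Qed.

End RectangleIntegral.

(** * Goursat's lemma *)

Section Goursat.
Variable R : realType.
Local Notation C := (Cplx R).
Implicit Types (f g : C -> C) (z w : C) (x y : R).

Lemma derivable_cont f z : derivable f z 1 -> {for z, continuous f}.
Proof. by move=> /derivable1_diffP; exact: differentiable_continuous. Qed.

Lemma nested_point (u v : nat -> R) : (forall n, u n <= u n.+1) ->
  (forall n, v n.+1 <= v n) -> (forall n, u n <= v n) ->
  exists X, forall n, u n <= X <= v n.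
Proof.
move=> hu hv huv.
have mu m n : (m <= n)%N -> u m <= u n.
  by move=> mn; apply: (@homo_leq _ u (fun a b => a <= b)) => //; exact: le_trans.
have mv m n : (m <= n)%N -> v n <= v m.
  move=> mn; apply: (@homo_leq _ v (fun a b => b <= a)) => // a b c h1 h2.
  exact: le_trans h2 h1.
have uv m n : u m <= v n.
  by apply: le_trans (mu _ _ (leq_maxl m n)) (le_trans (huv _) (mv _ _ (leq_maxr m n))).
exists (sup (range u)) => n; apply/andP; split.
  by apply: ub_le_sup; [exists (v 0%N) => _ [m _ <-]|exists n].
by apply: ge_sup; [exists (u 0%N), 0%N|move=> _ [m _ <-]].
Qed.

Lemma small_half (A d : R) : 0 < d -> exists n, A / 2 ^+ n < d.
Proof.
move=> d0; exists (Num.bound (`|A| / d)).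
have h : `|A| / d < (Num.bound (`|A| / d))%:R.
  by apply: archi_boundP; rewrite divr_ge0// ltW.
rewrite ltr_pdivrMr ?exprn_gt0//; apply: le_lt_trans (ler_norm A) _.
rewrite -ltr_pdivrMl// mulrC; apply: lt_le_trans h _.
by rewrite -natrX ler_nat ltnW// ltn_expl.
Qed.

Lemma inrectS x0 x1 y0 y1 a b p q z : x0 <= a -> b <= x1 -> y0 <= p -> q <= y1 ->
  inrect a b p q z -> inrect x0 x1 y0 y1 z.
Proof.
move=> ? ? ? ? [/andP[h1 h2] /andP[h3 h4]]; split; apply/andP; split.
- exact: le_trans h1.
- exact: le_trans h2 _.
- exact: le_trans h3.
- exact: le_trans h4 _.
Qed.

Lemma inrect_dist a b p q z w : inrect a b p q z -> inrect a b p q w ->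
  cabs (z - w) <= (b - a) + (q - p).
Proof.
move=> [/andP[? ?] /andP[? ?]] [/andP[? ?] /andP[? ?]].
apply: le_trans (cabs_le _) _; rewrite !(cReD, cImD, cReN, cImN).
by apply: lerD; rewrite ler_norml; apply/andP; split; lra.
Qed.

Let goursat_arith (j L e : R) n : 0 < j -> 0 <= L -> e = j / (8 * (L ^+ 2 + 1)) ->
  j <= 4 ^+ n * (4 * (e * (L / 2 ^+ n)) * (L / 2 ^+ n)) -> False.
Proof.
move=> j0 L0 ->; have L2 : 0 <= L ^+ 2 by rewrite sqr_ge0.
have -> : 4 ^+ n * (4 * (j / (8 * (L ^+ 2 + 1)) * (L / 2 ^+ n)) * (L / 2 ^+ n)) =
    j * (L ^+ 2 / (L ^+ 2 + 1) / 2).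
  have -> : (4 : R) ^+ n = 2 ^+ n * 2 ^+ n by rewrite -exprMn; congr (_ ^+ _); lra.
  by field; rewrite expf_neq0//= lt0r_neq0//; lra.
apply/negP; rewrite -ltNge gtr_pMr// ltr_pdivrMr// mul1r.
by apply: (@le_lt_trans _ _ 1); [rewrite ler_pdivrMr ?mul1r|]; lra.
Qed.

Lemma max4 (A p q r s : R) : A <= (p + q) + (r + s) ->
  A <= 4 * p \/ A <= 4 * q \/ A <= 4 * r \/ A <= 4 * s.
Proof.
move=> h; have [?|?] := leP A (4 * p); first by left.
have [?|?] := leP A (4 * q); first by right; left.
have [?|?] := leP A (4 * r); first by right; right; left.
by right; right; right; lra.
Qed.

Let box (s : R * R * (R * R)) f := rectint f s.1.1 (s.1.1 + s.2.1) s.1.2 (s.1.2 + s.2.2).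

Lemma quarter f x0 xm x1 y0 ym y1 : x0 <= xm -> xm <= x1 -> y0 <= ym -> ym <= y1 ->
  (forall z, inrect x0 x1 y0 y1 z -> {for z, continuous f}) ->
  rectint f x0 x1 y0 y1 = (rectint f x0 xm y0 ym + rectint f x0 xm ym y1) +
                    (rectint f xm x1 y0 ym + rectint f xm x1 ym y1).
Proof.
move=> h1 h2 h3 h4 c.
have cB a b p q : x0 <= a -> b <= x1 -> y0 <= p -> q <= y1 -> cont_bd a b p q f.
  by move=> p1 p2 p3 p4 z [zr _]; apply: c; exact: inrectS p1 p2 p3 p4 zr.
rewrite (rectint_splitx h1 h2 (le_trans h3 h4)); [|by apply: cB; lra|by apply: cB; lra].
rewrite (rectint_splity h1 h3 h4); [|by apply: cB; lra|by apply: cB; lra].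
by rewrite (rectint_splity h2 h3 h4)//; apply: cB; lra.
Qed.

(** Goursat's lemma, by repeated quartering: a rectangle carrying a quarter of
    the integral at each step shrinks to a point, where f is affine up to an
    error that is too small. *)
Lemma goursat f x0 x1 y0 y1 : x0 <= x1 -> y0 <= y1 ->
  (forall z, inrect x0 x1 y0 y1 z -> derivable f z 1) -> rectint f x0 x1 y0 y1 = 0.
Proof.
move=> x01 y01 df.
have cf z : inrect x0 x1 y0 y1 z -> {for z, continuous f}.
  by move=> /df; exact: derivable_cont.
pose valid (s : R * R * (R * R)) := [/\ 0 <= s.2.1, 0 <= s.2.2 &
  [/\ x0 <= s.1.1, s.1.1 + s.2.1 <= x1, y0 <= s.1.2 & s.1.2 + s.2.2 <= y1]].
pose Rel (s t : R * R * (R * R)) := valid s -> [/\ valid t,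
  t.2 = (s.2.1 / 2, s.2.2 / 2),
  s.1.1 <= t.1.1 /\ t.1.1 + t.2.1 <= s.1.1 + s.2.1,
  s.1.2 <= t.1.2 /\ t.1.2 + t.2.2 <= s.1.2 + s.2.2 &
  cabs (box s f) <= 4 * cabs (box t f)].
have step s : {t | Rel s t}.
  apply/cid; have [vs|nvs] := pselect (valid s); last by exists s => /nvs.
  move: s vs => [[x y] [a b]] [/= a0 b0 [/= xa xb ya yb]].
  have e : box (x, y, (a, b)) f =
      (box (x, y, (a / 2, b / 2)) f + box (x, y + b / 2, (a / 2, b / 2)) f) +
      (box (x + a / 2, y, (a / 2, b / 2)) f +
       box (x + a / 2, y + b / 2, (a / 2, b / 2)) f).
    have hh (u c : R) : u + c / 2 + c / 2 = u + c by lra.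
    rewrite /box/= !hh.
    apply: quarter; [lra|lra|lra|lra|].
    by move=> z; move/(inrectS xa xb ya yb); exact: cf.
  have le4 : cabs (box (x, y, (a, b)) f) <=
      (cabs (box (x, y, (a / 2, b / 2)) f) +
       cabs (box (x, y + b / 2, (a / 2, b / 2)) f)) +
      (cabs (box (x + a / 2, y, (a / 2, b / 2)) f) +
       cabs (box (x + a / 2, y + b / 2, (a / 2, b / 2)) f)).
    rewrite e; apply: le_trans (cabsD _ _) _; apply: lerD; exact: cabsD.
  have mk x' y' : x <= x' -> x' + a / 2 <= x + a -> y <= y' -> y' + b / 2 <= y + b ->
      cabs (box (x, y, (a, b)) f) <= 4 * cabs (box (x', y', (a / 2, b / 2)) f) ->
      exists t, Rel (x, y, (a, b)) t.
    move=> p1 p2 p3 p4 p5; exists (x', y', (a / 2, b / 2)) => _; split => //.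
    have a2 : 0 <= a / 2 by rewrite divr_ge0.
    have b2 : 0 <= b / 2 by rewrite divr_ge0.
    split => //; split => /=.
    - exact: le_trans xa p1.
    - exact: le_trans p2 xb.
    - exact: le_trans ya p3.
    - exact: le_trans p4 yb.
  by case: (max4 le4) => [h|[h|[h|h]]]; apply: (mk _ _ _ _ _ _ h); clear le4 h e mk; lra.
pose s0 := (x0, y0, (x1 - x0, y1 - y0)).
have [s [s00 sR]] := dependent_choice step s0.
have v n : valid (s n).
  elim: n => [|n ih]; last by have [] := sR n ih.
  by rewrite s00; split => /=; [lra|lra|split; lra].
have sz n : (s n).2 = ((x1 - x0) / 2 ^+ n, (y1 - y0) / 2 ^+ n).
  elim: n => [|n ih]; first by rewrite s00 !expr0 !divr1.
  by have [_ -> _ _ _] := sR n (v n); rewrite ih/= -!mulrA -!invfM -!exprSr.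
have Jn n : cabs (rectint f x0 x1 y0 y1) <= 4 ^+ n * cabs (box (s n) f).
  elim: n => [|n ih].
    rewrite s00 expr0 mul1r /box/= (_ : x0 + (x1 - x0) = x1); last by ring.
    by rewrite (_ : y0 + (y1 - y0) = y1); last by ring.
  apply: le_trans ih _; rewrite exprSr -mulrA ler_wpM2l ?exprn_ge0//.
  by have [] := sR n (v n).
have [X hX] : exists X, forall n, (s n).1.1 <= X <= (s n).1.1 + (s n).2.1.
  apply: nested_point => n; first by have [_ _ []] := sR n (v n).
    by have [_ _ []] := sR n (v n).
  by have [a0 _ _] := v n; rewrite lerDl.
have [Y hY] : exists Y, forall n, (s n).1.2 <= Y <= (s n).1.2 + (s n).2.2.
  apply: nested_point => n; first by have [_ _ _ []] := sR n (v n).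
    by have [_ _ _ []] := sR n (v n).
  by have [_ a0 _] := v n; rewrite lerDl.
apply/eqP; rewrite -cabs_eq0; apply/negP => /negP Jn0.
have J0 : 0 < cabs (rectint f x0 x1 y0 y1) by rewrite lt_def Jn0 cabs_ge0.
set L := (x1 - x0) + (y1 - y0).
have L0 : 0 <= L by rewrite /L; lra.
have zr : inrect x0 x1 y0 y1 (mkC X Y).
  have := hX 0%N; have := hY 0%N; rewrite s00/= => h1 h2; split => /=.
    by move: h2; rewrite addrC subrK.
  by move: h1; rewrite addrC subrK.
(* chosen so that the estimate bn below contradicts Jn for every n *)
set e := cabs (rectint f x0 x1 y0 y1) / (8 * (L ^+ 2 + 1)).
have e0 : 0 < e.
  by apply: divr_gt0 => //; rewrite mulr_gt0// ltr_wpDl ?sqr_ge0.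
have [d d0 Hd] := derivable_slope (df _ zr) e0.
have [n hn] := small_half L d0.
have [xs ys [xx0 xx1 yy0 yy1]] := v n.
set l := f^`()%classic (mkC X Y) in Hd.
set z0 := mkC X Y in zr Hd.
have dn0 : 0 <= L / 2 ^+ n by rewrite divr_ge0// exprn_ge0.
have dist z : inrect (s n).1.1 ((s n).1.1 + (s n).2.1) (s n).1.2
    ((s n).1.2 + (s n).2.2) z -> cabs (z - z0) <= L / 2 ^+ n.
  move=> zr'; apply: le_trans (inrect_dist zr' (_ : inrect _ _ _ _ z0)) _.
    by split; [exact: hX|exact: hY].
  by rewrite ![_ + _ - _]addrAC !subrr !add0r sz/= -mulrDl.
have cBf : cont_bd (s n).1.1 ((s n).1.1 + (s n).2.1) (s n).1.2
    ((s n).1.2 + (s n).2.2) f.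
  by move=> z [zr' _]; apply: cf; exact: inrectS xx0 xx1 yy0 yy1 zr'.
pose A z := (f z0 - l * z0) + l * z.
have cA z : {for z, continuous A}.
  apply: derivable_cont; apply: derivableD; first exact: derivable_cst.
  by apply: derivableM; [exact: derivable_cst|exact: derivable_id].
have sa : (s n).1.1 <= (s n).1.1 + (s n).2.1 by rewrite lerDl.
have sb : (s n).1.2 <= (s n).1.2 + (s n).2.2 by rewrite lerDl.
have JA := rectint_sub sa sb cBf (fun z _ => cA z).
have JA0 : rectint A (s n).1.1 ((s n).1.1 + (s n).2.1) (s n).1.2
    ((s n).1.2 + (s n).2.2) = 0 by exact: rectint_affine sa sb _ _.
have cBA : cont_bd (s n).1.1 ((s n).1.1 + (s n).2.1) (s n).1.2
    ((s n).1.2 + (s n).2.2) (fun z => f z - A z).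
  by move=> z zb; exact: (continuous_subC (cBf z zb) (cA z)).
have bA z : onbd (s n).1.1 ((s n).1.1 + (s n).2.1) (s n).1.2
    ((s n).1.2 + (s n).2.2) z -> cabs (f z - A z) <= e * (L / 2 ^+ n).
  move=> [zb _]; have dz := dist _ zb.
  have -> : f z - A z = f z - f z0 - l * (z - z0) by rewrite /A; ring.
  apply: le_trans (Hd _ (le_lt_trans dz hn)) _.
  by rewrite ler_wpM2l// ltW.
have bn : cabs (box (s n) f) <= 4 * (e * (L / 2 ^+ n)) * (L / 2 ^+ n).
  have := rectint_bound sa sb cBA bA.
  rewrite JA JA0 subr0 [_ + _ - _]addrC addKr [(s n).1.2 + _ - _]addrC addKr.
  by rewrite (_ : (s n).2.1 + (s n).2.2 = L / 2 ^+ n)// sz/= -mulrDl.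
have := le_trans (Jn n) (ler_wpM2l (exprn_ge0 n (ler0n _ 4)) bn).
exact: goursat_arith.
Qed.

End Goursat.

Section ShrinkingRectangles.
Variable R : realType.
Local Notation C := (Cplx R).
Implicit Types (f g : C -> C) (z w k : C) (x y : R).

Definition inside x0 x1 y0 y1 w : Prop :=
  x0 < complex.Re w < x1 /\ y0 < complex.Im w < y1.

Lemma inside_onbd x0 x1 y0 y1 z : onbd x0 x1 y0 y1 z -> ~ inside x0 x1 y0 y1 z.
Proof.
move=> [_ b] [/andP[h1 h2] /andP[h3 h4]]; case: b => e.
- by rewrite e ltxx in h1.
- by rewrite e ltxx in h2.
- by rewrite e ltxx in h3.
- by rewrite e ltxx in h4.
Qed.

Lemma inside_inrect x0 x1 y0 y1 z : inside x0 x1 y0 y1 z -> inrect x0 x1 y0 y1 z.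
Proof. by move=> [/andP[h1 h2] /andP[h3 h4]]; split; rewrite !ltW. Qed.

Lemma onbd_neq x0 x1 y0 y1 z w : inside x0 x1 y0 y1 w -> onbd x0 x1 y0 y1 z -> z != w.
Proof. by move=> iw bz; apply/eqP => zw; apply: (inside_onbd bz); rewrite zw. Qed.

Lemma onbd_dist x0 x1 y0 y1 w : inside x0 x1 y0 y1 w -> exists2 d, 0 < d &
  forall z, onbd x0 x1 y0 y1 z -> d <= cabs (z - w).
Proof.
move=> [/andP[h1 h2] /andP[h3 h4]].
exists (Num.min (Num.min (complex.Re w - x0) (x1 - complex.Re w))
   (Num.min (complex.Im w - y0) (y1 - complex.Im w))).
  by rewrite !lt_min !subr_gt0 h1 h2 h3.
move=> z [_ b]; have := cabs_Re (z - w); have := cabs_Im (z - w).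
rewrite !(cReD, cImD, cReN, cImN) => hi hr; rewrite !ge_min.
case: b => e; rewrite e in hi hr.
- by rewrite distrC in hr; rewrite (le_trans (ler_norm _) hr).
- by rewrite (le_trans (ler_norm _) hr) ?orbT.
- by rewrite distrC in hi; rewrite (le_trans (ler_norm _) hi) ?orbT.
- by rewrite (le_trans (ler_norm _) hi) ?orbT.
Qed.

Lemma derivable_mul f g z : derivable f z 1 -> derivable g z 1 ->
  derivable (fun z => f z * g z) z 1.
Proof. by move=> hf hg; exact: (derivableM hf hg). Qed.

Lemma derivable_sub f g z : derivable f z 1 -> derivable g z 1 ->
  derivable (fun z => f z - g z) z 1.
Proof. by move=> hf hg; exact: (derivableB hf hg). Qed.

Lemma derivable_inv f z : f z != 0 -> derivable f z 1 ->
  derivable (fun z => (f z)^-1) z 1.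
Proof. by move=> hf hg; exact: (derivableV hf hg). Qed.

Lemma derivable_subc w z : derivable (fun z => z - w) z 1.
Proof. exact: (derivable_sub (@derivable_id _ _ z 1) (derivable_cst w z 1)). Qed.

Lemma derivable_scale k f z : derivable f z 1 -> derivable (fun z => k * f z) z 1.
Proof. by move=> hf; exact: (derivable_mul (derivable_cst k z 1) hf). Qed.

Lemma continuous_inv_sub w z : z != w -> {for z, continuous (fun z => (z - w)^-1)}.
Proof.
move=> zw; apply: derivable_cont; apply: derivableV; first by rewrite subr_eq0.
by apply: derivableB; [exact: derivable_id|exact: derivable_cst].
Qed.

Lemma derivable_inv_sub w z : z != w -> derivable (fun z => (z - w)^-1) z 1.
Proof.
move=> zw; apply: derivableV; first by rewrite subr_eq0.
by apply: derivableB; [exact: derivable_id|exact: derivable_cst].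
Qed.

Lemma continuous_mulC f g z : {for z, continuous f} -> {for z, continuous g} ->
  {for z, continuous (fun z => f z * g z)}.
Proof. by move=> hf hg; exact: (cvgM hf hg). Qed.

Lemma cont_bd_quot x0 x1 y0 y1 f w : inside x0 x1 y0 y1 w -> cont_bd x0 x1 y0 y1 f ->
  cont_bd x0 x1 y0 y1 (fun z => f z * (z - w)^-1).
Proof.
move=> iw cf z bz; apply: continuous_mulC; first exact: cf.
exact/continuous_inv_sub/(onbd_neq iw).
Qed.

Section Shrink.
Variables (x0 x1 y0 y1 e u v : R) (f : C -> C).
Let w := mkC u v.
Hypothesis (e0 : 0 < e) (xu : x0 <= u - e) (ux : u + e <= x1)
  (yv : y0 <= v - e) (vy : v + e <= y1).
Hypothesis df : forall z, inrect x0 x1 y0 y1 z -> z != w -> derivable f z 1.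

Let sub_cont a b p q : x0 <= a -> b <= x1 -> y0 <= p -> q <= y1 ->
  ~ onbd a b p q w -> cont_bd a b p q f.
Proof.
move=> h1 h2 h3 h4 nw z zb; apply: derivable_cont; apply: df.
  by case: zb => zr _; exact: inrectS h1 h2 h3 h4 zr.
by apply/eqP => zw; apply: nw; rewrite -zw.
Qed.

Let sub_zero a b p q : a <= b -> p <= q -> x0 <= a -> b <= x1 -> y0 <= p -> q <= y1 ->
  ~ inrect a b p q w -> rectint f a b p q = 0.
Proof.
move=> ab pq h1 h2 h3 h4 nw; apply: goursat => // z zr; apply: df.
  exact: inrectS h1 h2 h3 h4 zr.
by apply/eqP => zw; apply: nw; rewrite -zw.
Qed.

(** The integral around w may be taken over any small square centred at w: the
    remaining four rectangles do not contain w. *)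
Lemma rectint_shrink : rectint f x0 x1 y0 y1 = rectint f (u - e) (u + e) (v - e) (v + e).
Proof.
have := (e0, xu, ux, (yv, vy)) => -[[[pe px] qx] [py qy]].
have ue : u - e <= u + e by lra.
have ve : v - e <= v + e by lra.
have yy : y0 <= y1 by lra.
have uL : ~ inrect x0 (u - e) y0 y1 w.
  by move=> [/andP[_ /= ?] _]; lra.
have uR : ~ inrect (u + e) x1 y0 y1 w.
  by move=> [/andP[/= ? _] _]; lra.
have vL : ~ inrect (u - e) (u + e) y0 (v - e) w.
  by move=> [_ /andP[_ /= ?]]; lra.
have vR : ~ inrect (u - e) (u + e) (v + e) y1 w.
  by move=> [_ /andP[/= ? _]]; lra.
have nb a b p q : a < u -> u < b -> p < v -> v < q -> ~ onbd a b p q w.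
  by move=> ? ? ? ? /inside_onbd; apply; split; apply/andP.
rewrite (@rectint_splitx _ x0 (u - e))//; [|by lra| |]; last 2 first.
- by apply: sub_cont; try lra; case.
- by apply: sub_cont; try lra; apply: nb; lra.
rewrite (@rectint_splitx _ (u - e) (u + e))//; last 2 first.
- by apply: sub_cont; try lra; apply: nb; lra.
- by apply: sub_cont; try lra; case.
rewrite (@rectint_splity _ (u - e) (u + e) y0 (v - e))//; [|by lra| |]; last 2 first.
- by apply: sub_cont; try lra; case.
- by apply: sub_cont; try lra; apply: nb; lra.
rewrite (@rectint_splity _ (u - e) (u + e) (v - e) (v + e))//; last 2 first.
- by apply: sub_cont; try lra; apply: nb; lra.
- by apply: sub_cont; try lra; case.
have -> : rectint f x0 (u - e) y0 y1 = 0 by apply: (sub_zero _ _ _ _ _ _ uL); lra.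
have -> : rectint f (u + e) x1 y0 y1 = 0 by apply: (sub_zero _ _ _ _ _ _ uR); lra.
have -> : rectint f (u - e) (u + e) y0 (v - e) = 0.
  by apply: (sub_zero _ _ _ _ _ _ vL); lra.
have -> : rectint f (u - e) (u + e) (v + e) y1 = 0.
  by apply: (sub_zero _ _ _ _ _ _ vR); lra.
by rewrite !add0r !addr0.
Qed.

End Shrink.

End ShrinkingRectangles.

(** * Cauchy's formula *)

Section CauchyTransform.
Variable R : realType.
Local Notation C := (Cplx R).
Implicit Types (f g : C -> C) (z w : C) (x y : R).

(** The Cauchy transform of the boundary values of f. *)
Definition cauchy_tr x0 x1 y0 y1 f w : C := rectint (fun z => f z * (z - w)^-1) x0 x1 y0 y1.

(** Up to the factor 2 pi i, the winding number around w. *)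
Definition winding x0 x1 y0 y1 w : C := rectint (fun z => (z - w)^-1) x0 x1 y0 y1.

Lemma square_dist (u v e : R) z : 0 < e ->
  onbd (u - e) (u + e) (v - e) (v + e) z -> e <= cabs (z - mkC u v) <= 2 * e.
Proof.
move=> e0 [[/andP[h1 h2] /andP[h3 h4]] b]; apply/andP; split.
  have := cabs_Re (z - mkC u v); have := cabs_Im (z - mkC u v).
  rewrite !(cReD, cImD, cReN, cImN)/= !ler_norml => /andP[? ?] /andP[? ?].
  by case: b => b; lra.
apply: le_trans (cabs_le _) _; rewrite !(cReD, cImD, cReN, cImN)/= mulr_natl mulr2n.
by apply: lerD; rewrite ler_norml; apply/andP; split; lra.
Qed.

Lemma shrink_room x0 x1 y0 y1 (u v : R) : inside x0 x1 y0 y1 (mkC u v) ->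
  exists2 r, 0 < r & forall e, e <= r ->
    [/\ x0 <= u - e, u + e <= x1, y0 <= v - e & v + e <= y1].
Proof.
move=> [/= /andP[h1 h2] /andP[h3 h4]].
exists (Num.min (Num.min (u - x0) (x1 - u)) (Num.min (v - y0) (y1 - v))).
  by rewrite !lt_min !subr_gt0 h1 h2 h3.
by move=> e; rewrite !le_min => /andP[/andP[? ?] /andP[? ?]]; split; lra.
Qed.

(** Around w the quotient (f z - f w) / (z - w) is bounded, so its integral over
    a small square vanishes in the limit. *)
Lemma cauchy_formula x0 x1 y0 y1 f w : inside x0 x1 y0 y1 w ->
  (forall z, inrect x0 x1 y0 y1 z -> derivable f z 1) ->
  cauchy_tr x0 x1 y0 y1 f w = f w * winding x0 x1 y0 y1 w.
Proof.
move: w => [u v] iw df; rewrite -/(mkC u v) in iw *; set w := mkC u v in iw *.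
have x01 : x0 <= x1 by case: iw => /andP[h1 h2] _; rewrite ltW// (lt_trans h1).
have y01 : y0 <= y1 by case: iw => _ /andP[h1 h2]; rewrite ltW// (lt_trans h1).
pose g z := f z * (z - w)^-1 - f w * (z - w)^-1.
have cf : cont_bd x0 x1 y0 y1 f.
  by move=> z [zr _]; apply: derivable_cont; exact: df.
have ci : cont_bd x0 x1 y0 y1 (fun z => (z - w)^-1).
  by move=> z zb; apply: continuous_inv_sub; exact: onbd_neq iw zb.
have cfi : cont_bd x0 x1 y0 y1 (fun z => f w * (z - w)^-1).
  move=> z zb; apply: (continuous_mulC (f := fun=> f w)); last exact: ci.
  exact/derivable_cont/derivable_cst.
have Jg : rectint g x0 x1 y0 y1 = cauchy_tr x0 x1 y0 y1 f w - f w * winding x0 x1 y0 y1 w.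
  have := rectint_sub x01 y01 (cont_bd_quot iw cf) cfi.
  by rewrite (rectint_scale x01 y01 (f w) ci).
suff : rectint g x0 x1 y0 y1 = 0 by rewrite Jg => /eqP; rewrite subr_eq0 => /eqP.
have dg z : inrect x0 x1 y0 y1 z -> z != w -> derivable g z 1.
  move=> zr zw; have di := derivable_inv_sub zw.
  have d1 := derivable_mul (df z zr) di.
  have d2 := derivable_scale (k := f w) di.
  exact: (derivable_sub d1 d2).
have [r r0 hr] := shrink_room iw.
have [d d0 Hd] := derivable_slope (df _ (inside_inrect iw)) ltr01.
set l := f^`()%classic w in Hd; set K := 1 + cabs l.
have K0 : 0 < K by rewrite ltr_wpDr// cabs_ge0.
have bg z : z != w -> cabs (z - w) < d -> cabs (g z) <= K.
  move=> zw zd; have zw0 : 0 < cabs (z - w) by rewrite cabs_gt0 subr_eq0.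
  rewrite /g -mulrBl cabsM cabsV ler_pdivrMr// /K mulrDl -cabsM.
  apply: le_trans (_ : cabs (f z - f w - l * (z - w)) + cabs (l * (z - w)) <= _).
    by apply: le_trans (cabsD _ _); rewrite subrK.
  by rewrite lerD2r; exact: Hd.
have small e : 0 < e -> e <= r -> 2 * e < d -> cabs (rectint g x0 x1 y0 y1) <= 16 * K * e.
  move=> e0 er ed; have [e1 e2 e3 e4] := hr _ er.
  rewrite (rectint_shrink e0 e1 e2 e3 e4 dg).
  have ue : u - e <= u + e by rewrite lerD2l; lra.
  have ve : v - e <= v + e by rewrite lerD2l; lra.
  have bz z : onbd (u - e) (u + e) (v - e) (v + e) z -> z != w /\ cabs (z - w) < d.
    move=> /(square_dist e0)/andP[z1 z2]; split; last exact: le_lt_trans z2 ed.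
    by rewrite -subr_eq0 -cabs_gt0; exact: lt_le_trans z1.
  apply: le_trans (rectint_bound ue ve (M := K) _ _) _.
  - move=> z zb; have [zw _] := bz _ zb.
    apply: derivable_cont; apply: dg => //; case: zb => zr _.
    exact: inrectS e1 e2 e3 e4 zr.
  - by move=> z /bz[zw zd]; exact: bg.
  - by lra.
apply/eqP; rewrite -cabs_eq0 eq_le cabs_ge0 andbT.
apply/ler_addgt0Pr => t t0; rewrite add0r.
pose e := Num.min (Num.min r (d / 4)) (t / (16 * K)).
have d4 : 0 < d / 4 by rewrite divr_gt0.
have K16 : 0 < 16 * K by rewrite mulr_gt0.
have e0 : 0 < e by rewrite !lt_min r0 d4 divr_gt0.
have [er [ed et]] : e <= r /\ e <= d / 4 /\ e <= t / (16 * K).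
  by rewrite /e !ge_min !lexx ?orbT.
apply: le_trans (small e e0 er _) _.
  by move: ed d0; clear; lra.
by rewrite mulrC -ler_pdivlMr.
Qed.

Lemma cImV (u v : R) : complex.Im ((mkC u v)^-1 : C) = - v / (u ^+ 2 + v ^+ 2).
Proof. by rewrite mulNr. Qed.

Lemma cReV (u v : R) : complex.Re ((mkC u v)^-1 : C) = u / (u ^+ 2 + v ^+ 2).
Proof. by []. Qed.

(** On a square of half side e centred at w, each of the four sides contributes an
    imaginary part of at least 1 to the integral. *)
Lemma cabs_winding x0 x1 y0 y1 w : inside x0 x1 y0 y1 w ->
  4 <= cabs (winding x0 x1 y0 y1 w).
Proof.
move: w => [u v] iw; rewrite -/(mkC u v) in iw *; set w := mkC u v in iw *.
have [e e0 hr] := shrink_room iw; have [e1 e2 e3 e4] := hr _ (lexx e).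
have ue : u - e <= u + e by lra.
have ve : v - e <= v + e by lra.
rewrite /winding (rectint_shrink e0 e1 e2 e3 e4); last first.
  by move=> z _; exact: derivable_inv_sub.
have cB : cont_bd (u - e) (u + e) (v - e) (v + e) (fun z => (z - w)^-1).
  move=> z /(square_dist e0)/andP[z1 z2]; apply: continuous_inv_sub.
  by rewrite -subr_eq0 -cabs_gt0; exact: lt_le_trans z1.
apply: le_trans (cabs_Im _); apply: le_trans (ler_norm _); rewrite /rectint cImD.
have bnd s : - e <= s <= e -> e^-1 <= 2 * e / (s ^+ 2 + e ^+ 2).
  move=> /andP[s1 s2].
  have s2e : s ^+ 2 <= e ^+ 2 by rewrite -subr_ge0 subr_sqr mulr_ge0//; lra.
  have se0 : 0 < s ^+ 2 + e ^+ 2 by rewrite ltr_wpDl ?sqr_ge0// exprn_gt0.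
  rewrite ler_pdivlMr// mulrC ler_pdivrMr//; lra.
have sub (x y : R) : mkC x y - w = mkC (x - u) (y - v).
  by apply: complex_ext; rewrite !(cReD, cImD, cReN, cImN).
have ei : e^-1 * (u + e - (u - e)) = 2.
  by field; rewrite lt0r_neq0.
have ei' : e^-1 * (v + e - (v - e)) = 2.
  by field; rewrite lt0r_neq0.
rewrite (_ : 4 = 2 + 2 :> R); last by lra.
apply: lerD.
  rewrite -ei; apply: (Im_Cint_ge ue (cont_bd_h ve cB)) => t tt.
  rewrite !sub cImD cImN !cImV.
  have -> : v - e - v = - e by ring.
  have -> : v + e - v = e by ring.
  rewrite sqrrN opprK; apply: le_trans (bnd (t - u) _) _.
    by apply/andP; split; lra.
  by rewrite le_eqVlt; apply/orP; left; apply/eqP; ring.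
rewrite -(CintZ (iC R) (cont_bd_v ue cB)) -ei'.
apply: Im_Cint_ge => // [t tt|t tt].
  apply: (cvgM (f := fun=> iC R)); first exact: cvg_cst.
  exact: (cont_bd_v ue cB).
rewrite !sub cImM (_ : complex.Im (iC R) = 1)// (_ : complex.Re (iC R) = 0)//.
rewrite cReD cReN !cReV.
have -> : u - e - u = - e by ring.
have -> : u + e - u = e by ring.
rewrite sqrrN mul0r add0r mul1r; apply: le_trans (bnd (t - v) _) _.
  by apply/andP; split; lra.
rewrite le_eqVlt; apply/orP; left; apply/eqP; rewrite [e ^+ 2 + _]addrC; ring.
Qed.

End CauchyTransform.

(** * Removable singularities *)

Section Removable.
Variable R : realType.
Local Notation C := (Cplx R).
Implicit Types (f g : C -> C) (z w a : C) (x y r : R).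

Lemma seg_bounded (a b : R) (phi : R -> C) : a <= b -> cont_on a b phi ->
  exists M, forall t, a <= t <= b -> cabs (phi t) <= M.
Proof.
move=> ab h; have [|c _ hc] := @EVT_max R (fun t => cabs (phi t)) a b ab.
  apply: continuous_in_subspaceT => t; rewrite inE/= in_itv/= => /h/cvg_cabsP H.
  apply/cvgrPdist_lt => /= e e0; have := H _ e0; apply: filterS => s /=.
  by apply: le_lt_trans; rewrite distrC; exact: cabs_lip.
by exists (cabs (phi c)) => t tt; apply: hc; rewrite in_itv.
Qed.

Lemma cont_bd_bounded x0 x1 y0 y1 f : x0 <= x1 -> y0 <= y1 -> cont_bd x0 x1 y0 y1 f ->
  exists2 M, 0 <= M & forall z, onbd x0 x1 y0 y1 z -> cabs (f z) <= M.
Proof.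
move=> x01 y01 cf.
have H y : y = y0 \/ y = y1 -> cont_on x0 x1 (fun x => f (mkC x y)).
  move=> yy x xx; apply: (@continuous_comp _ _ _ (fun x => mkC x y) f).
    exact: continuous_hline.
  by apply: cf; exact: onbd_h.
have V x : x = x0 \/ x = x1 -> cont_on y0 y1 (fun y => f (mkC x y)).
  move=> xx y yy; apply: (@continuous_comp _ _ _ (fun y => mkC x y) f).
    exact: continuous_vline.
  by apply: cf; exact: onbd_v.
have [M1 h1] := seg_bounded x01 (H _ (or_introl erefl)).
have [M2 h2] := seg_bounded x01 (H _ (or_intror erefl)).
have [M3 h3] := seg_bounded y01 (V _ (or_introl erefl)).
have [M4 h4] := seg_bounded y01 (V _ (or_intror erefl)).
exists (Num.max 0 (Num.max (Num.max M1 M2) (Num.max M3 M4))).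
  by rewrite le_max lexx.
move=> [x y] [[/= xx yy] b]; rewrite !le_max; case: b => /= e; rewrite e -/(mkC _ _).
- by rewrite (h3 _ yy) !orbT.
- by rewrite (h4 _ yy) !orbT.
- by rewrite (h1 _ xx) !orbT.
- by rewrite (h2 _ xx) !orbT.
Qed.

Lemma inside_le x0 x1 y0 y1 w : inside x0 x1 y0 y1 w -> x0 <= x1 /\ y0 <= y1.
Proof.
by move=> [/andP[h1 h2] /andP[h3 h4]]; rewrite !ltW ?(lt_trans h1) ?(lt_trans h3).
Qed.

(** Differentiation under the integral sign: the remainder of the kernel 1 / (z - w)
    to first order in w is (v - w)^2 / ((z - v) (z - w)^2), which is bounded as long
    as v stays away from the boundary. *)
Lemma derivable_cauchy x0 x1 y0 y1 f w : inside x0 x1 y0 y1 w ->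
  cont_bd x0 x1 y0 y1 f -> derivable (cauchy_tr x0 x1 y0 y1 f) w 1.
Proof.
move=> iw cf; have [x01 y01] := inside_le iw.
have [M M0 hM] := cont_bd_bounded x01 y01 cf.
have [d d0 hd] := onbd_dist iw.
pose f2 z := f z * (z - w)^-1 * (z - w)^-1.
have c1 := cont_bd_quot iw cf; have c2 : cont_bd x0 x1 y0 y1 f2 := cont_bd_quot iw c1.
set P := (x1 - x0) + (y1 - y0).
have P0 : 0 <= P by rewrite addr_ge0// subr_ge0.
pose K := 4 * (M / (d / 2 * d * d)) * P.
have den0 : 0 < d / 2 * d * d by rewrite !mulr_gt0 ?invr_gt0.
have K0 : 0 <= K by rewrite mulr_ge0// mulr_ge0// divr_ge0// ltW.
apply: (proj1 (derivable_slopeP (l := rectint f2 x0 x1 y0 y1) _)) => e e0.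
exists (Num.min (d / 2) (e / (K + 1))).
  by rewrite lt_min !divr_gt0// ltr_wpDl.
move=> v; rewrite lt_min => /andP[vd ve].
have far z : onbd x0 x1 y0 y1 z -> d / 2 <= cabs (z - v).
  move=> /hd; have := cabsB z w v; rewrite [cabs (v - w)]cabsC in vd *.
  by move: vd; clear; lra.
have cv : cont_bd x0 x1 y0 y1 (fun z => f z * (z - v)^-1).
  move=> z zb; apply: continuous_mulC; first exact: cf.
  apply: continuous_inv_sub; rewrite -subr_eq0 -cabs_gt0.
  by apply: lt_le_trans (far _ zb); rewrite divr_gt0.
have c3 : cont_bd x0 x1 y0 y1 (fun z => (v - w) * f2 z).
  move=> z zb; apply: (continuous_mulC (f := fun=> v - w)); last exact: c2.
  exact/derivable_cont/derivable_cst.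
have c4 : cont_bd x0 x1 y0 y1 (fun z => f z * (z - v)^-1 - f z * (z - w)^-1).
  by move=> z zb; exact: (continuous_subC (cv z zb) (c1 z zb)).
rewrite mulrC -(rectint_scale x01 y01 (v - w) c2) /cauchy_tr -(rectint_sub x01 y01 cv c1).
rewrite -(rectint_sub x01 y01 c4 c3).
apply: le_trans (rectint_bound x01 y01
  (M := M * ((cabs (v - w) * cabs (v - w))) / (d / 2 * d * d)) _ _) _.
- by move=> z zb; exact: (continuous_subC (c4 z zb) (c3 z zb)).
- move=> z zb; have zd := hd _ zb; have zv := far _ zb.
  have d2 : 0 < d / 2 by rewrite divr_gt0.
  have w0 : z - w != 0 by rewrite -cabs_gt0; exact: lt_le_trans zd.
  have v0 : z - v != 0 by rewrite -cabs_gt0; exact: lt_le_trans zv.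
  have -> : f z * (z - v)^-1 - f z * (z - w)^-1 - (v - w) * f2 z =
      f z * ((v - w) * (v - w)) * ((z - v)^-1 * (z - w)^-1 * (z - w)^-1).
    by rewrite /f2; field; rewrite w0 v0.
  rewrite !cabsM !cabsV; apply: ler_pM.
  + by rewrite !mulr_ge0// cabs_ge0.
  + by rewrite !mulr_ge0// invr_ge0 cabs_ge0.
  + by rewrite ler_wpM2r ?mulr_ge0 ?cabs_ge0//; exact: hM.
  + have c0 : 0 < cabs (z - w) by exact: lt_le_trans zd.
    have c0' : 0 < cabs (z - v) by exact: lt_le_trans zv.
    rewrite -!invfM lef_pV2 ?posrE ?mulr_gt0//.
    rewrite -mulrA -[leRHS]mulrA; apply: ler_pM => //; first exact: ltW.
      by rewrite mulr_ge0// ltW.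
    by apply: ler_pM => //; exact: ltW.
have -> : 4 * (M * (cabs (v - w) * cabs (v - w)) / (d / 2 * d * d)) * (x1 - x0 + (y1 - y0)) =
  K * cabs (v - w) * cabs (v - w) by rewrite /K /P; ring.
rewrite ler_wpM2r ?cabs_ge0//.
apply: le_trans (ler_wpM2l K0 (ltW ve)) _.
rewrite mulrCA ler_piMr ?(ltW e0)// ler_pdivrMr ?mul1r; last by rewrite ltr_wpDl.
by rewrite lerDl.
Qed.

(** The winding integral is the Cauchy transform of 1. *)
Lemma derivable_winding x0 x1 y0 y1 w : inside x0 x1 y0 y1 w ->
  derivable (winding x0 x1 y0 y1) w 1.
Proof.
move=> iw; have [x01 y01] := inside_le iw.
have -> : winding x0 x1 y0 y1 = cauchy_tr x0 x1 y0 y1 (fun=> 1).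
  apply/funext => v; apply: (rectint_eq x01 y01) => z _.
  by symmetry; exact: mul1r.
apply: derivable_cauchy => // z _; exact/derivable_cont/derivable_cst.
Qed.

Lemma near_eq_derivable1 f g a : (\forall z \near a, f z = g z) ->
  derivable f a 1 -> derivable g a 1.
Proof. by move=> fg; apply: near_eq_derivable => //; exact: oner_neq0. Qed.

Lemma cont_eq_punctured f g a r : 0 < r -> {for a, continuous f} ->
  {for a, continuous g} -> (forall z, 0 < cabs (z - a) < r -> f z = g z) -> f a = g a.
Proof.
move=> r0 /continuous_cabsP cf /continuous_cabsP cg fg.
apply/eqP; rewrite -subr_eq0 -cabs_eq0 eq_le cabs_ge0 andbT.
apply/ler_addgt0Pr => e e0; rewrite add0r.
have e2 : 0 < e / 2 by rewrite divr_gt0.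
have [d1 d10 h1] := cf _ e2; have [d2 d20 h2] := cg _ e2.
pose d := Num.min r (Num.min d1 d2).
have d0 : 0 < d by rewrite !lt_min r0 d10.
have [dr [dd1 dd2]] : d <= r /\ d <= d1 /\ d <= d2 by rewrite /d !ge_min !lexx ?orbT.
pose z := a + rC (d / 2).
have za : cabs (z - a) = d / 2.
  by rewrite /z addrC addKr cabs_rC ger0_norm// divr_ge0// ltW.
have zd : cabs (z - a) < d by rewrite za; lra.
have fz : f z = g z by apply: fg; rewrite za; apply/andP; split; [lra|lra].
apply: le_trans (cabsB _ _ (f z)) _; rewrite {2}fz (splitr e).
apply: lerD; apply: ltW.
  by rewrite cabsC; apply: h1; exact: lt_le_trans zd _.
by apply: h2; exact: lt_le_trans zd _.
Qed.

(** Riemann's theorem.  The function (z - a) f z is differentiable at a as well;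
    dividing its Cauchy formula by w - a shows that f is a quotient of two Cauchy
    transforms. *)
Lemma removable f a r : 0 < r -> {for a, continuous f} ->
  (forall z, 0 < cabs (z - a) < r -> derivable f z 1) -> derivable f a 1.
Proof.
move: a => [u v]; rewrite -/(mkC u v); set a := mkC u v => r0 ca df.
pose s := r / 3; have s0 : 0 < s by rewrite divr_gt0.
have rs : 2 * s < r by rewrite /s; lra.
pose Q := inrect (u - s) (u + s) (v - s) (v + s).
pose D := inside (u - s) (u + s) (v - s) (v + s).
have Qr z : Q z -> cabs (z - a) < r.
  move=> [/andP[h1 h2] /andP[h3 h4]]; apply: le_lt_trans rs.
  apply: le_trans (cabs_le _) _; rewrite !(cReD, cImD, cReN, cImN)/= mulr_natl mulr2n.
  by apply: lerD; rewrite ler_norml; apply/andP; split; lra.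
have Dnear z : cabs (z - a) < s -> D z.
  move=> zs; have := le_lt_trans (cabs_Re _) zs; have := le_lt_trans (cabs_Im _) zs.
  rewrite !(cReD, cImD, cReN, cImN)/= !ltr_norml => /andP[h1 h2] /andP[h3 h4].
  by split; apply/andP; split; lra.
have Da : D a by apply: Dnear; rewrite subrr cabs0.
have dfz z : Q z -> z != a -> derivable f z 1.
  by move=> Qz za; apply: df; rewrite cabs_gt0 subr_eq0 za Qr.
pose h z := (z - a) * f z.
have dh z : Q z -> derivable h z 1.
  move=> Qz; have [->|za] := eqVneq z a; last first.
    have d1 : derivable (fun z => z - a) z 1 by exact: derivable_subc.
    have d2 := dfz _ Qz za.
    exact: (derivable_mul d1 d2).
  apply: (proj1 (derivable_slopeP (l := f a) _)) => e e0.
  have [d d0 hd] := proj1 (continuous_cabsP f a) ca _ e0; exists d => // y yd.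
  rewrite /h subrr mul0r subr0 [f a * _]mulrC -mulrBr cabsM mulrC.
  by rewrite ler_wpM2r ?cabs_ge0// ltW// hd.
have ch : cont_bd (u - s) (u + s) (v - s) (v + s) h.
  by move=> z [Qz _]; apply: derivable_cont; exact: dh.
have cf : cont_bd (u - s) (u + s) (v - s) (v + s) f.
  move=> z zb; apply: derivable_cont; apply: dfz; first by case: zb.
  exact: onbd_neq Da zb.
have [u0 v0] := inside_le Da.
pose Phi := cauchy_tr (u - s) (u + s) (v - s) (v + s) f.
pose kap := winding (u - s) (u + s) (v - s) (v + s).
have fk w : D w -> w != a -> Phi w = f w * kap w.
  move=> Dw wa; have e1 := cauchy_formula Dw dh; have e2 := cauchy_formula Da dh.
  have c1 := cont_bd_quot Dw ch; have c2 := cont_bd_quot Da ch.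
  have e3 := rectint_sub u0 v0 c1 c2.
  have e4 := rectint_scale u0 v0 (w - a) (cont_bd_quot Dw cf).
  have wa0 : w - a != 0 by rewrite subr_eq0.
  apply: (mulfI wa0); rewrite [LHS](_ : _ = cauchy_tr (u - s) (u + s) (v - s) (v + s) h w -
    cauchy_tr (u - s) (u + s) (v - s) (v + s) h a).
    by rewrite e1 e2 /h subrr !mul0r subr0 mulrA.
  rewrite -[RHS]e3 -[LHS]e4; apply: rectint_eq => // z zb.
  have za : z - a != 0 by rewrite subr_eq0; exact: onbd_neq Da zb.
  have zw : z - w != 0 by rewrite subr_eq0; exact: onbd_neq Dw zb.
  by rewrite /h; field; rewrite za zw.
have k0 w : D w -> kap w != 0.
  by move=> Dw; rewrite -cabs_gt0; apply: lt_le_trans (cabs_winding Dw).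
pose g z := Phi z * (kap z)^-1.
have dg w : D w -> derivable g w 1.
  move=> Dw; have d1 := derivable_cauchy Dw cf; have d2 := derivable_winding Dw.
  exact: (derivable_mul d1 (derivable_inv (k0 _ Dw) d2)).
have gf z : 0 < cabs (z - a) < s -> g z = f z.
  move=> /andP[za zs]; rewrite /g fk ?mulfK//; [exact/k0/Dnear|exact: Dnear|].
  by rewrite -subr_eq0 -cabs_gt0.
have gfa := cont_eq_punctured s0 (derivable_cont (dg _ Da)) ca gf.
apply: near_eq_derivable1 (dg _ Da).
apply/nbhs_cabsP; exists s => // z zs; have [->|za] := eqVneq z a; first exact: gfa.
by apply: gf; rewrite zs cabs_gt0 subr_eq0 za.
Qed.

End Removable.

(** * Local behaviour of holomorphic functions *)

Section LocalTheory.
Variable R : realType.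
Local Notation C := (Cplx R).
Implicit Types (f g : C -> C) (z w a c : C) (r s d M : R).

Definition holo_on c r f := forall z, cabs (z - c) < r -> derivable f z 1.

Definition square a r z : Prop := inrect (complex.Re a - r) (complex.Re a + r)
  (complex.Im a - r) (complex.Im a + r) z.

Definition square_bd a r z : Prop := onbd (complex.Re a - r) (complex.Re a + r)
  (complex.Im a - r) (complex.Im a + r) z.

Lemma square_le a r z : square a r z -> cabs (z - a) <= 2 * r.
Proof.
move=> [/andP[h1 h2] /andP[h3 h4]]; apply: le_trans (cabs_le _) _.
rewrite !(cReD, cImD, cReN, cImN) mulr_natl mulr2n.
by apply: lerD; rewrite ler_norml; apply/andP; split; lra.
Qed.

Lemma square_bd_ge a r z : 0 < r -> square_bd a r z -> r <= cabs (z - a).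
Proof. by case: a => u v r0 /(square_dist r0)/andP[]. Qed.

Lemma inside_square a r z : cabs (z - a) < r ->
  inside (complex.Re a - r) (complex.Re a + r) (complex.Im a - r) (complex.Im a + r) z.
Proof.
move=> zs; have := le_lt_trans (cabs_Re _) zs; have := le_lt_trans (cabs_Im _) zs.
rewrite !(cReD, cImD, cReN, cImN) !ltr_norml => /andP[h1 h2] /andP[h3 h4].
by split; apply/andP; split; lra.
Qed.

(** A weak maximum principle, with a constant that does not depend on f. *)
Lemma square_bound f a r M : 0 < r -> (forall z, square a r z -> derivable f z 1) ->
  (forall z, square_bd a r z -> cabs (f z) <= M) ->
  forall w, cabs (w - a) <= r / 2 -> cabs (f w) <= 8 * M.
Proof.
move=> r0 df fM w wa.
have war : cabs (w - a) < r by lra.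
have iw := inside_square war; have [u0 v0] := inside_le iw.
have cf := cauchy_formula iw df.
have cB : cont_bd (complex.Re a - r) (complex.Re a + r) (complex.Im a - r)
    (complex.Im a + r) f.
  by move=> z [zr _]; apply: derivable_cont; exact: df.
have far z : square_bd a r z -> r / 2 <= cabs (z - w).
  move=> /(square_bd_ge r0); have := cabsB z a w.
  by move: wa; clear; lra.
have bz z : square_bd a r z -> cabs (f z * (z - w)^-1) <= M * (2 / r).
  move=> zb; have zw := far _ zb; rewrite cabsM cabsV; apply: ler_pM.
  - exact: cabs_ge0.
  - by rewrite invr_ge0 cabs_ge0.
  - exact: fM.
  - have r2 : 0 < r / 2 by rewrite divr_gt0.
    rewrite -[2 / r]invf_div lef_pV2 ?posrE//; exact: lt_le_trans zw.
have := rectint_bound u0 v0 (cont_bd_quot iw cB) bz; rewrite -/(cauchy_tr _ _ _ _ f w) cf cabsM.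
have kw := cabs_winding iw.
move=> h; have h2 : cabs (f w) * 4 <= 4 * (M * (2 / r)) * (4 * r).
  apply: le_trans (ler_wpM2l (cabs_ge0 _) kw) _; apply: le_trans h _.
  by rewrite le_eqVlt; apply/orP; left; apply/eqP; ring.
have e : 4 * (M * (2 / r)) * (4 * r) = 32 * M by field; rewrite lt0r_neq0.
by move: h2; rewrite e; clear; lra.
Qed.

(** The quotient extends continuously by the derivative at a, so that its singularity
    there is removable. *)
Lemma division f c r a : holo_on c r f -> cabs (a - c) < r ->
  exists2 g, holo_on c r g & forall z, f z - f a = (z - a) * g z.
Proof.
move=> hf ac; pose l := f^`()%classic a.
pose g z := if z == a then l else (f z - f a) * (z - a)^-1.
have gE z : f z - f a = (z - a) * g z.
  rewrite /g; case: eqVneq => [->|za]; first by rewrite !subrr mul0r.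
  by rewrite mulrCA divff ?mulr1// subr_eq0.
exists g; last exact: gE.
have dg z : z != a -> cabs (z - c) < r -> derivable g z 1.
  move=> za zc.
  have d1 : derivable (fun z => f z - f a) z 1.
    exact: (derivable_sub (hf z zc) (derivable_cst (f a) z 1)).
  have d2 := derivable_mul d1 (derivable_inv_sub za).
  apply: near_eq_derivable1 d2; apply/nbhs_cabsP.
  exists (cabs (z - a)); first by rewrite cabs_gt0 subr_eq0.
  move=> y yz; rewrite /g; case: eqVneq => // ya.
  by move: yz; rewrite ya cabsC ltxx.
have ga : {for a, continuous g}.
  apply/continuous_cabsP => e e0.
  have e2 : 0 < e / 2 by rewrite divr_gt0.
  have [d d0 hd] := derivable_slope (hf a ac) e2; exists d => // z zd.
  have [->|za] := eqVneq z a; first by rewrite subrr cabs0.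
  have c0 : 0 < cabs (z - a) by rewrite cabs_gt0 subr_eq0.
  rewrite {2}/g eqxx; have := hd _ zd; rewrite gE -/l [l * _]mulrC -mulrBr cabsM.
  by rewrite mulrC ler_pM2r// => h; lra.
move=> z zc; have [->|za] := eqVneq z a; last exact: dg.
have rc : 0 < r - cabs (a - c) by rewrite subr_gt0.
apply: (removable rc ga) => y /andP[ya yr]; apply: dg.
  by rewrite -subr_eq0 -cabs_gt0.
by have := cabsB y c a; lra.
Qed.

(** If f - f a is divisible by every power of z - a, then the bound above, applied
    to the quotients, forces it to vanish near a. *)
Lemma isolated_value f a r : 0 < r -> holo_on a r f ->
  (exists2 d, 0 < d & forall z, cabs (z - a) < d -> f z = f a) \/
  (exists2 d, 0 < d & forall z, 0 < cabs (z - a) < d -> f z <> f a).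
Proof.
move=> r0 hf; have aa : cabs (a - a) < r by rewrite subrr cabs0.
have [|nex] := pselect (exists n g, [/\ holo_on a r g, g a != 0 &
    forall z, f z - f a = (z - a) ^+ n * g z]).
  move=> [n [g [hg ga fE]]]; right.
  have /continuous_cabsP/(_ (cabs (g a))) := derivable_cont (hg _ aa).
  rewrite cabs_gt0 => /(_ ga)[d d0 hd]; exists d => // z /andP[za zd] fz.
  have := fE z; rewrite fz subrr => /esym/eqP; rewrite mulf_eq0 => /orP[|/eqP gz].
    by rewrite expf_eq0 -cabs_eq0 gt_eqF// andbF.
  by have := hd _ zd; rewrite gz sub0r cabsN ltxx.
left.
have divn n : exists2 g, holo_on a r g & forall z, f z - f a = (z - a) ^+ n * g z.
  elim: n => [|n [g hg gE]].
    exists (fun z => f z - f a); last by move=> z; rewrite expr0 mul1r.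
    by move=> z /hf dz; exact: (derivable_sub dz (derivable_cst (f a) z 1)).
  have [k hk kE] := division hg aa.
  exists k => // z; rewrite exprSr -mulrA -kE gE; congr (_ * _).
  suff -> : g a = 0 by rewrite subr0.
  by apply: contra_notP nex => /eqP ga; exists n, g.
have [d d0 hd] := proj1 (continuous_cabsP f a) (derivable_cont (hf _ aa)) _ ltr01.
(* a square of half side s lies in the disc where |f - f a| < 1 *)
pose s := Num.min d r / 4.
have m0 : 0 < Num.min d r by rewrite lt_min d0.
have s0 : 0 < s by rewrite divr_gt0.
have [sd sr] : 2 * s < d /\ 2 * s < r.
  have [h1 h2] : Num.min d r <= d /\ Num.min d r <= r by rewrite !ge_min !lexx orbT.
  by rewrite /s; lra.
exists (s / 2); first by rewrite divr_gt0.
move=> w ws; apply/eqP; rewrite -subr_eq0 -cabs_eq0 eq_le cabs_ge0 andbT.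
have key n : cabs (f w - f a) <= 8 / 2 ^+ n.
  have [g hg gE] := divn n.
  have sn0 : 0 < s ^+ n by rewrite exprn_gt0.
  have gb : cabs (g w) <= 8 * (s ^+ n)^-1.
    apply: (square_bound s0 (f := g) (a := a)); last exact: ltW.
      by move=> z /square_le zs; apply: hg; exact: le_lt_trans sr.
    move=> z zb; have zs := square_bd_ge s0 zb.
    have /square_le zs2 : square a s z by case: zb.
    have : cabs (f z - f a) <= 1 by apply/ltW/hd; exact: le_lt_trans zs2 sd.
    rewrite gE cabsM cabsX => h.
    rewrite -[leRHS]mul1r ler_pdivlMr// mulrC; apply: le_trans h.
    by rewrite ler_wpM2r ?cabs_ge0// lerXn2r ?nnegrE ?cabs_ge0// ltW.
  rewrite gE cabsM cabsX; apply: le_trans (_ : (s / 2) ^+ n * (8 * (s ^+ n)^-1) <= _).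
    apply: ler_pM => //; [by rewrite exprn_ge0 ?cabs_ge0|exact: cabs_ge0|].
    by rewrite lerXn2r ?nnegrE ?cabs_ge0 ?divr_ge0// ltW.
  rewrite expr_div_n mulrCA mulrAC divff ?mul1r//; exact: lt0r_neq0.
apply/ler_addgt0Pr => e e0; rewrite add0r.
by have [n hn] := small_half 8 e0; apply: le_trans (key n) (ltW hn).
Qed.

(** If f misses v, then 1 / (f - v) is bounded at a by its values on a square
    around a, so v cannot be much closer to f a than f is on that square. *)
Lemma open_value f a r s : 0 < r -> holo_on a r f ->
  (forall z, 0 < cabs (z - a) < r -> f z <> f a) -> 0 < s ->
  exists2 d, 0 < d & forall v, cabs (v - f a) < d ->
    exists2 z, cabs (z - a) < s & f z = v.
Proof.
move=> r0 hf nf s0; pose t := Num.min r s / 4.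
have m0 : 0 < Num.min r s by rewrite lt_min r0.
have t0 : 0 < t by rewrite divr_gt0.
have [tr ts] : 2 * t < r /\ 2 * t < s.
  have [h1 h2] : Num.min r s <= r /\ Num.min r s <= s by rewrite !ge_min !lexx orbT.
  by rewrite /t; lra.
have dsq z : square a t z -> derivable f z 1.
  by move=> /square_le zt; apply: hf; exact: le_lt_trans tr.
have aa : cabs (a - a) < t by rewrite subrr cabs0.
have [u0 v0] := inside_le (inside_square aa).
have nz z : square_bd a t z -> f z - f a != 0.
  move=> zb; rewrite subr_eq0; apply/eqP/nf; apply/andP; split.
    exact: lt_le_trans (square_bd_ge t0 zb).
  by case: zb => /square_le zt _; exact: le_lt_trans tr.
have cB : cont_bd (complex.Re a - t) (complex.Re a + t) (complex.Im a - t)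
    (complex.Im a + t) (fun z => (f z - f a)^-1).
  move=> z zb; apply: derivable_cont; apply: derivable_inv; first exact: nz.
  have dz : derivable f z 1 by apply: dsq; case: zb.
  exact: (derivable_sub dz (derivable_cst (f a) z 1)).
have [M M0 hM] := cont_bd_bounded u0 v0 cB.
pose m := (M + 1)^-1.
have m_gt0 : 0 < m by rewrite invr_gt0 ltr_wpDl.
have mle z : square_bd a t z -> m <= cabs (f z - f a).
  move=> zb; have := hM _ zb; rewrite cabsV => h.
  have c0 : 0 < cabs (f z - f a) by rewrite cabs_gt0 nz.
  rewrite -[leRHS]invrK /m lef_pV2 ?posrE ?invr_gt0//; last by rewrite ltr_wpDl.
  by apply: le_trans h _; rewrite lerDl.
(* on the square |f - v| >= m - m / 9, and 8 / (8 m / 9) = 1 / (m / 9) *)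
exists (m / 9); first by rewrite divr_gt0.
move=> v vd; apply: contrapT => nex.
have nv z : square a t z -> f z - v != 0.
  move=> zt; rewrite subr_eq0; apply/eqP => fz; apply: nex; exists z => //.
  exact: le_lt_trans (square_le zt) ts.
have := @square_bound (fun z => (f z - v)^-1) a t (9 / (8 * m)) t0 _ _ a.
rewrite subrr cabs0 => /(_ _ _ _)/wrap[].
- move=> z zt; apply: derivable_inv; first exact: nv.
  exact: (derivable_sub (dsq _ zt) (derivable_cst v z 1)).
- move=> z zb; have mz := mle _ zb.
  have : 8 * m / 9 <= cabs (f z - v).
    have := cabsB (f z) (f a) v; move: vd mz; clear; lra.
  have m8 : 0 < 8 * m / 9 by rewrite divr_gt0 ?mulr_gt0.
  move=> h; rewrite cabsV -[9 / _]invf_div lef_pV2 ?posrE//.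
  exact: lt_le_trans h.
- by rewrite divr_ge0// ltW.
have fav : f a - v != 0.
  by apply: nv; case: (inside_square aa) => /andP[? ?] /andP[? ?]; split; rewrite !ltW.
have c0 : 0 < cabs (f a - v) by rewrite cabs_gt0.
rewrite cabsV (_ : 8 * (9 / (8 * m)) = (m / 9)^-1); last by field; rewrite lt0r_neq0.
by rewrite lef_pV2 ?posrE ?divr_gt0// leNgt cabsC vd.
Qed.

(** Two close points with the same image v give a bound
    |f z - v| <= K |z - z1| |z - z2| with K independent of them; were they
    arbitrarily close to a, the derivative at a would vanish. *)
Lemma local_inj f a r : 0 < r -> holo_on a r f -> f^`()%classic a != 0 ->
  exists2 d, 0 < d & forall z1 z2, cabs (z1 - a) < d -> cabs (z2 - a) < d ->
    f z1 = f z2 -> z1 = z2.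
Proof.
move=> r0 hf fa0; have aa : cabs (a - a) < r by rewrite subrr cabs0.
have [d1 d10 hd1] := proj1 (continuous_cabsP f a) (derivable_cont (hf _ aa)) _ ltr01.
pose c := cabs (f^`()%classic a); have c0 : 0 < c by rewrite cabs_gt0.
have c2 : 0 < c / 2 by rewrite divr_gt0.
have [d2 d20 hd2] := derivable_slope (hf _ aa) c2.
have low z : cabs (z - a) < d2 -> c / 2 * cabs (z - a) <= cabs (f z - f a).
  move=> /hd2; have := cabsB (f^`()%classic a * (z - a)) 0 (f z - f a).
  by rewrite !subr0 [cabs (_ - (f z - f a))]cabsC cabsM -/c; clear; lra.
pose t := Num.min d1 r / 4.
have m0 : 0 < Num.min d1 r by rewrite lt_min d10.
have t0 : 0 < t by rewrite divr_gt0.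
have [td tr] : 2 * t < d1 /\ 2 * t < r.
  have [h1 h2] : Num.min d1 r <= d1 /\ Num.min d1 r <= r by rewrite !ge_min !lexx orbT.
  by rewrite /t; lra.
pose K := 8 * (2 * (2 / t) ^+ 2).
have K0 : 0 < K by rewrite /K mulr_gt0// mulr_gt0// exprn_gt0// divr_gt0.
have key z1 z2 z : z1 != z2 -> f z1 = f z2 -> cabs (z1 - a) <= t / 2 ->
    cabs (z2 - a) <= t / 2 -> cabs (z - a) <= t / 2 ->
    cabs (f z - f z1) <= cabs (z - z1) * cabs (z - z2) * K.
  move=> z12 f12 z1t z2t zt.
  have inr y : cabs (y - a) <= t / 2 -> cabs (y - a) < r by lra.
  have [g hg gE] := division hf (inr _ z1t).
  have [k hk kE] := division hg (inr _ z2t).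
  have g2 : g z2 = 0.
    have := gE z2; rewrite f12 subrr => /esym/eqP; rewrite mulf_eq0 subr_eq0.
    by rewrite eq_sym (negbTE z12) => /eqP.
  have fE y : f y - f z1 = (y - z1) * (y - z2) * k y.
    by rewrite gE -mulrA -kE g2 subr0.
  rewrite fE !cabsM ler_wpM2l ?mulr_ge0 ?cabs_ge0//.
  apply: (square_bound t0 (f := k) (a := a)) => //.
    by move=> y /square_le yt; apply: hk; exact: le_lt_trans tr.
  move=> y yb; have yt := square_bd_ge t0 yb.
  have /square_le yt2 : square a t y by case: yb.
  have far x : cabs (x - a) <= t / 2 -> t / 2 <= cabs (y - x).
    by move=> xa; have := cabsB y a x; lra.
  have f1 := far _ z1t; have f2 := far _ z2t.
  have t2 : 0 < t / 2 by rewrite divr_gt0.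
  have fy : cabs (f y - f z1) <= 2.
    have h1 := hd1 _ (le_lt_trans yt2 td).
    have h2 : cabs (f z1 - f a) < 1 by apply: hd1; lra.
    by have := cabsB (f y) (f z1) (f a); rewrite [cabs (f a - _)]cabsC; lra.
  rewrite fE !cabsM in fy.
  have p0 : 0 < cabs (y - z1) * cabs (y - z2).
    by rewrite mulr_gt0//; [exact: lt_le_trans f1|exact: lt_le_trans f2].
  rewrite -(ler_pM2l p0); apply: le_trans fy _.
  have -> : (2 / t) ^+ 2 = ((t / 2) ^+ 2)^-1 by field; rewrite lt0r_neq0.
  rewrite mulrCA ler_peMr//.
  rewrite ler_pdivlMr ?exprn_gt0// mul1r expr2.
  by apply: ler_pM => //; exact: ltW.
(* at distance e from a the bounds lo and key give c e / 2 <= 5 K e^2 *)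
pose e := Num.min (Num.min (d2 / 2) (t / 2)) (c / (12 * K)).
have e0 : 0 < e by rewrite !lt_min (divr_gt0 d20)// (divr_gt0 t0)// divr_gt0// mulr_gt0.
have [ed [et ec]] : e <= d2 / 2 /\ e <= t / 2 /\ e <= c / (12 * K).
  by rewrite /e !ge_min !lexx ?orbT.
exists e => // z1 z2 z1e z2e f12; apply/eqP/negPn/negP => z12.
pose z := a + rC e.
have za : cabs (z - a) = e by rewrite /z addrC addKr cabs_rC ger0_norm// ltW.
have z1t : cabs (z1 - a) <= t / 2 by apply: ltW; exact: lt_le_trans et.
have z2t : cabs (z2 - a) <= t / 2 by apply: ltW; exact: lt_le_trans et.
have zt : cabs (z - a) <= t / 2 by rewrite za.
have at2 : cabs (a - a) <= t / 2 by rewrite subrr cabs0 divr_ge0// ltW.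
have k1 := key z1 z2 z z12 f12 z1t z2t zt.
have k2 := key z1 z2 a z12 f12 z1t z2t at2.
have lo : c / 2 * e <= cabs (f z - f a).
  by rewrite -{1}za; apply: low; rewrite za; lra.
have near x : cabs (x - a) < e -> cabs (z - x) <= 2 * e.
  by move=> xe; have := cabsB z x a; rewrite za [cabs (a - x)]cabsC; lra.
have b1 : cabs (z - z1) * cabs (z - z2) * K <= 2 * e * (2 * e) * K.
  by rewrite ler_wpM2r ?(ltW K0)// ler_pM ?cabs_ge0 ?near.
have b2 : cabs (a - z1) * cabs (a - z2) * K <= e * e * K.
  rewrite ler_wpM2r ?(ltW K0)// ![cabs (a - _)]cabsC ler_pM ?cabs_ge0//; exact: ltW.
have tot : c / 2 * e <= 5 * K * e * e.
  apply: le_trans lo _; have := cabsB (f z) (f a) (f z1).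
  rewrite [cabs (f z1 - f a)]cabsC; move: k1 k2 b1 b2; clear; lra.
have : c / 2 <= 5 * K * e by rewrite -(ler_pM2r e0).
have K12 : 0 < 12 * K by rewrite mulr_gt0.
have : 12 * K * e <= c by rewrite mulrC -ler_pdivlMr.
have : 0 < K * e by rewrite mulr_gt0.
by move: c0; clear; lra.
Qed.

End LocalTheory.

(** * Paths and their lifts *)

Section Clopen.
Variable T : topologicalType.

(** Connectedness as an induction principle: P holds on an open and closed set. *)
Lemma connected_ind (P : T -> Prop) (t0 : T) : connected [set: T] -> P t0 ->
  (forall t, P t -> \forall t' \near t, P t') ->
  (forall t, ~ P t -> \forall t' \near t, ~ P t') -> forall t, P t.
Proof.
move=> cT P0 hP hN.
have oP : open [set t | P t] by rewrite openE => t /= /hP.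
have cP : closed [set t | P t].
  rewrite -[X in closed X]setCK; apply: open_closedC.
  by rewrite openE => t /= /hN.
move=> t; have /seteqP[_ /(_ t)] : [set t | P t] = setT; last by apply.
apply: cT; first by exists t0.
- by exists [set t | P t] => //; rewrite setTI.
- by exists [set t | P t] => //; rewrite setTI.
Qed.

End Clopen.

Section Clamp.
Variable R : realType.
Implicit Types a b s t : R.

Lemma connected_R : connected [set: R].
Proof. by apply/connected_intervalP => x y _ _ z _. Qed.

Definition clamp a b t : R := Num.max a (Num.min b t).

Lemma clamp_lip a b s t : `|clamp a b s - clamp a b t| <= `|s - t|.
Proof.
have H u v : u <= v -> 0 <= clamp a b v - clamp a b u <= v - u.
  move=> uv; rewrite /clamp; apply/andP; case: (leP b u) => h1; case: (leP b v) => h2;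
    case: (leP a b) => h3; case: (leP a u) => h4; case: (leP a v) => h5; lra.
have [st|ts] := leP s t.
  have /andP[h1 h2] := H _ _ st.
  by rewrite distrC ger0_norm// distrC ger0_norm// subr_ge0.
have /andP[h1 h2] := H _ _ (ltW ts).
by rewrite ger0_norm// ger0_norm// subr_ge0 ltW.
Qed.

Lemma clamp_continuous a b : continuous (clamp a b).
Proof.
move=> t; apply/cvgrPdist_lt => e e0.
have : \forall s \near t, `|t - s| < e by exact: (@cvgr_dist_lt _ _ _ (nbhs t) _ id t).
by apply: filterS => s; apply: le_lt_trans; exact: clamp_lip.
Qed.

Lemma clamp_id a b t : a <= t <= b -> clamp a b t = t.
Proof. by move=> /andP[h1 h2]; rewrite /clamp min_r// max_r. Qed.

Lemma clamp_itv a b t : a <= b -> a <= clamp a b t <= b.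
Proof. by move=> ab; rewrite /clamp le_max lexx/= ge_max ab ge_min lexx. Qed.

End Clamp.

Section Paste.
Variables (R : realType) (X Y : topologicalType).

Lemma continuous_paste (c : X -> R) (u v : X -> Y) (T : R) x :
  {for x, continuous c} -> (c x <= T -> {for x, continuous u}) ->
  (T <= c x -> {for x, continuous v}) ->
  (c x = T -> u x = v x) ->
  {for x, continuous (fun x => if c x <= T then u x else v x)}.
Proof.
move=> cc cu cv uv A; have [xT|xT|xT] := ltgtP (c x) T.
- move=> /(cu (ltW xT)) hA.
  have : \forall y \near x, c y < T by exact: (@cvgr_lt _ _ (nbhs x) _ c (c x) cc).
  by move=> hT; apply: filterS2 hT hA => y yT Ay; rewrite /= (ltW yT).
- move=> /(cv (ltW xT)) hA.
  have : \forall y \near x, T < c y by exact: (@cvgr_gt _ _ (nbhs x) _ c (c x) cc).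
  by move=> hT; apply: filterS2 hT hA => y yT Ay; rewrite /= leNgt yT.
- have h1 : c x <= T by rewrite xT.
  have h2 : T <= c x by rewrite xT.
  move=> hA; have hu : nbhs x (u @^-1` A) := cu h1 A hA.
  rewrite (uv xT) in hA; have hv : nbhs x (v @^-1` A) := cv h2 A hA.
  by apply: filterS2 hu hv => y uy vy /=; case: ifP.
Qed.

End Paste.

Section Lifts.
Variables (R : realType) (Y Z : topologicalType).
Implicit Types (F : Y -> Z) (P V : set Z) (x y : Y) (b : R -> Z).

(** Composition with [clamp 0 1] makes a path continuous on the whole of R, which is
    connected, so that no continuity on a subspace has to be handled later. *)
Lemma path_total (X : topologicalType) (A : set X) (x y : X) (g : R -> X) :
  path_in A x y g -> continuous (g \o clamp 0 1) /\
  [/\ g 0 = x, g 1 = y & forall t, A (g (clamp 0 1 t))].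
Proof.
move=> [gc g0 g1 gA]; split.
  move=> t B; have cI := clamp_itv t (@ler01 R).
  have /(_ (clamp 0 1 t)) := proj1 (@subspace_continuousP _ _ _ _) gc.
  rewrite /= in_itv/= => /(_ cI B) h /h hB.
  have {}hB : nbhs (clamp 0 1 t) [set s | `[0, 1]%classic s -> B (g s)] := hB.
  have : nbhs t (clamp 0 1 @^-1` _) := @clamp_continuous R 0 1 t _ hB.
  apply: filterS => s /=; apply.
  by rewrite /= in_itv/=; exact: clamp_itv.
split=> // t; apply: gA; exists (clamp 0 1 t) => //.
by rewrite /= in_itv/=; exact: clamp_itv.
Qed.

Lemma path_in_total (X : topologicalType) (A : set X) (g : R -> X) :
  continuous g -> (forall t, 0 <= t <= 1 -> A (g t)) -> path_in A (g 0) (g 1) g.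
Proof.
move=> gc gA; split=> //; first exact: continuous_subspaceT.
by move=> _ [t /= + <-]; rewrite in_itv/=; exact: gA.
Qed.

Lemma itv01_0 : 0 <= (0 : R) <= 1. Proof. by rewrite lexx ler01. Qed.
Lemma itv01_1 : 0 <= (1 : R) <= 1. Proof. by rewrite lexx ler01. Qed.

Lemma lift_endsP F b x y : lift_ends F b x y <-> exists g : R -> Y,
  [/\ continuous g, g 0 = x, g 1 = y & forall t, 0 <= t <= 1 -> F (g t) = b t].
Proof.
split=> [[g /path_total[gc [g0 g1 _]] gF]|[g [gc g0 g1 gF]]].
  exists (g \o clamp 0 1); split=> //=.
  - by rewrite clamp_id// itv01_0.
  - by rewrite clamp_id// itv01_1.
  - by move=> t tt; rewrite clamp_id// gF.
exists g => //; rewrite -g0 -g1; exact: path_in_total.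
Qed.

End Lifts.

Section LiftOperations.
Variables (R : realType) (Y Z : topologicalType).
Implicit Types (F : Y -> Z) (P V : set Z) (x y : Y) (b : R -> Z).

Lemma lift_comp (X : topologicalType) F (u : X -> Y) b (x y : X) : continuous u ->
  lift_ends (F \o u) b x y -> lift_ends F b (u x) (u y).
Proof.
move=> cu /lift_endsP[g [gc <- <- gF]]; apply/lift_endsP; exists (u \o g); split=> //.
by move=> t; apply: continuous_comp; [exact: gc|exact: cu].
Qed.

Lemma lift_rev F b x y : lift_ends F b x y -> lift_ends F (path_rev b) y x.
Proof.
move=> /lift_endsP[g [gc g0 g1 gF]]; apply/lift_endsP.
exists (fun t => g (1 - t)); rewrite subr0 subrr; split=> //.
  move=> t; apply: (@continuous_comp _ _ _ (fun t : R => 1 - t) g); last exact: gc.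
  by apply: cvgB; [exact: cvg_cst|exact: cvg_id].
by move=> t /andP[t0 t1]; rewrite gF// subr_ge0 t1 gerBl.
Qed.

Lemma lift_constant F x : lift_ends F (cst (F x) : R -> Z) x x.
Proof.
by apply/lift_endsP; exists (fun=> x); split=> // t; exact: cst_continuous.
Qed.

Let cont_scale (c d : R) : continuous (fun t : R => c * t + d).
Proof.
move=> t; apply: (@continuousD _ _ _ (fun t => c * t) (fun=> d) t).
  by apply: (@continuousM _ _ (fun=> c) id t); [exact: cst_continuous|exact: cvg_id].
exact: cst_continuous.
Qed.

Let half_split (t : R) : 0 <= t <= 1 ->
  (t <= 2^-1 -> 0 <= 2 * t <= 1) /\ (2^-1 < t -> 0 <= 2 * t - 1 <= 1).
Proof. by move=> /andP[t0 t1]; split=> ht; apply/andP; split; lra. Qed.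

Lemma concat_continuous (X : topologicalType) (g g' : R -> X) : continuous g ->
  continuous g' -> g 1 = g' 0 -> continuous (path_concat g g').
Proof.
move=> gc gc' e t; apply: (@continuous_paste _ _ _ id).
- exact: cvg_id.
- move=> _; apply: (@continuous_comp _ _ _ (fun t : R => 2 * t) g); last exact: gc.
  by have := @cont_scale 2 0 t; under eq_fun do rewrite addr0.
- move=> _; apply: (@continuous_comp _ _ _ (fun t : R => 2 * t - 1) g'); last exact: gc'.
  exact: cont_scale.
- by move=> /= ->; rewrite divff// subrr.
Qed.

Lemma lift_concat F b b' x y w : lift_ends F b x y -> lift_ends F b' y w ->
  lift_ends F (path_concat b b') x w.
Proof.
move=> /lift_endsP[g [gc g0 g1 gF]] /lift_endsP[g' [gc' g'0 g'1 g'F]].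
apply/lift_endsP; exists (path_concat g g'); split.
- by apply: concat_continuous => //; rewrite g1.
- by rewrite /path_concat mulr0 invr_ge0 ler0n.
- rewrite /path_concat ifF; first by rewrite mulr1 (_ : 2 - 1 = 1)//; lra.
  by apply/negbTE; rewrite -ltNge; lra.
- move=> t tt; rewrite /path_concat; have [h1 h2] := half_split tt.
  by case: leP => ht; [rewrite gF// h1|rewrite g'F// h2].
Qed.

Lemma lift_concat_inv F b b' x w : b 1 = b' 0 ->
  lift_ends F (path_concat b b') x w ->
  exists2 y, lift_ends F b x y & lift_ends F b' y w.
Proof.
move=> e /lift_endsP[g [gc g0 g1 gF]]; exists (g (2^-1)); apply/lift_endsP.
  exists (fun t => g (2^-1 * t + 0)); rewrite mulr0 mulr1 !addr0; split=> //.
    move=> t; apply: (@continuous_comp _ _ _ (fun t : R => 2^-1 * t + 0) g); last exact: gc.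
    exact: cont_scale.
  move=> t /andP[t0 t1]; rewrite gF; last by apply/andP; split; lra.
  by rewrite /path_concat ifT ?addr0 ?mulVKf//; lra.
exists (fun t => g (2^-1 * t + 2^-1)); rewrite mulr0 mulr1 add0r; split=> //.
- move=> t; apply: (@continuous_comp _ _ _ (fun t : R => 2^-1 * t + 2^-1) g); last exact: gc.
  exact: cont_scale.
- by rewrite -g1; congr g; lra.
- move=> t /andP[t0 t1]; rewrite gF; last by apply/andP; split; lra.
  rewrite /path_concat; case: leP => ht; last by congr b'; lra.
  have -> : t = 0 by lra.
  by rewrite -e; congr b; lra.
Qed.

End LiftOperations.

(** * Coverings and the monodromy theorem *)

Section Covering.
Variables (Y Z : topologicalType).
Implicit Types (F : Y -> Z) (P V : set Z).

Definition locally_injective_at F (y : Y) :=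
  exists2 N, nbhs y N & forall y1 y2, N y1 -> N y2 -> F y1 = F y2 -> y1 = y2.

Definition sectioned F V := forall y, V (F y) -> exists s : Z -> Y,
  [/\ s (F y) = y, forall v, V v -> F (s v) = v & forall v, V v -> {for v, continuous s}].

(** What is left of the notion of a covering once connectedness of the base is
    dropped; it suffices for lifting paths and homotopies. *)
Definition covering_on F P :=
  (forall y, P (F y) -> locally_injective_at F y) /\
  (forall v, P v -> exists V, [/\ open V, V v & sectioned F V]).

(** The set where two lifts agree is open because F is locally injective, and closed
    because Y is separated. *)
Lemma lift_unique (T : topologicalType) F P (a b : T -> Y) (t0 : T) :
  hausdorff_space Y -> connected [set: T] -> covering_on F P ->
  continuous a -> continuous b -> (forall t, F (a t) = F (b t)) ->
  (forall t, P (F (a t))) -> a t0 = b t0 -> forall t, a t = b t.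
Proof.
move=> hY cT [inj _] ca cb ab aP ab0.
apply: (@connected_ind T (fun t => a t = b t) t0 cT ab0) => t h.
  have [N Nt iN] := inj _ (aP t).
  have h1 : nbhs t (a @^-1` N) := ca t N Nt.
  have h2 : nbhs t (b @^-1` N) by have := cb t N; rewrite -h; exact.
  by apply: filterS2 h1 h2 => s sa sb; apply: iN.
move: (hY); rewrite open_hausdorff => /(_ (a t) (b t)).
case; first by apply/eqP.
move=> [A B] /= [/set_mem At /set_mem Bt] [oA oB /eqP AB].
have h1 : nbhs t (a @^-1` A) := ca t A (open_nbhs_nbhs (conj oA At)).
have h2 : nbhs t (b @^-1` B) := cb t B (open_nbhs_nbhs (conj oB Bt)).
apply: filterS2 h1 h2 => s sa sb e.
by have : (A `&` B) (a s); [split; [exact: sa|rewrite e; exact: sb]|rewrite AB].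
Qed.

End Covering.

Section Lifting.
Variables (R : realType) (Y Z : topologicalType) (F : Y -> Z) (P : set Z).
Hypothesis hY : hausdorff_space Y.
Hypothesis cF : covering_on F P.

Lemma lift_ends_unique (b : R -> Z) x y y' : (forall t, 0 <= t <= 1 -> P (b t)) ->
  lift_ends F b x y -> lift_ends F b x y' -> y = y'.
Proof.
move=> bP /lift_endsP[g [gc g0 <- gF]] /lift_endsP[g' [gc' g'0 <- g'F]].
have cI t := clamp_itv t (@ler01 R).
have := @lift_unique _ _ R F P (g \o clamp 0 1) (g' \o clamp 0 1) 0 hY
  (@connected_R R) cF.
rewrite /= => /(_ _ _ _ _ _ 1); rewrite !clamp_id ?itv01_0 ?itv01_1//; apply.
- by move=> t; apply: continuous_comp; [exact: clamp_continuous|exact: gc].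
- by move=> t; apply: continuous_comp; [exact: clamp_continuous|exact: gc'].
- by move=> t; rewrite gF ?g'F.
- by move=> t; rewrite gF//; apply: bP.
- by rewrite g0 g'0.
Qed.

Section Joint.
Variables (L : topologicalType) (l0 : L) (b : R * L -> Z) (y0 : Y).
Hypothesis cb : continuous b.
Hypothesis bP : forall x, P (b x).
Hypothesis b0 : forall l, b (0, l) = F y0.

Let good (T : R) := exists (U : set L) (g : R * L -> Y),
  [/\ open U, U l0, forall t l, U l -> {for (t, l), continuous g},
      forall l, U l -> g (0, l) = y0 &
      forall t l, U l -> 0 <= t <= T -> F (g (t, l)) = b (t, l)].

Let good_le T T' : T' <= T -> good T -> good T'.
Proof.
move=> TT [U [g [oU U0 gc g0 gF]]]; exists U, g; split=> // t l Ul /andP[t0 tT].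
by apply: gF => //; rewrite t0 (le_trans tT).
Qed.

Let cpair (t : R) (l : L) : {for l, continuous (fun l => (t, l))}.
Proof.
apply: (@cvg_pair _ _ _ (nbhs l) (nbhs t) (nbhs l) _ _ _ (fun=> t) id).
  exact: cvg_cst.
exact: cvg_id.
Qed.

Let cclamp (T1 T2 : R) (x : R * L) :
  {for x, continuous (fun x : R * L => (clamp T1 T2 x.1, x.2))}.
Proof.
case: x => t l.
have h : {for (t, l), continuous (fun x : R * L => clamp T1 T2 x.1)}.
  apply: (@continuous_comp _ _ _ fst (clamp T1 T2)).
    exact: (@cvg_fst _ _ (nbhs t) (nbhs l)).
  exact: clamp_continuous.
apply: (@cvg_pair _ _ _ (nbhs (t, l)) (nbhs (clamp T1 T2 t)) (nbhs l) _ _ _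
  (fun x : R * L => clamp T1 T2 x.1) snd); first exact: h.
exact: (@cvg_snd _ _ (nbhs t) (nbhs l)).
Qed.

(** A lift defined up to time T1 is continued by a local section; near l0 the two
    pieces match because F is injective near the end point. *)
Let good_step (T : R) : 0 <= T -> exists2 d, 0 < d & forall T1 T2, 0 <= T1 ->
  `|T - T1| < d -> `|T - T2| < d -> good T1 -> good T2.
Proof.
move=> T0; have [inj sec] := cF.
have [V [oV VT sV]] := sec _ (bP (T, l0)).
have : nbhs (T, l0) (b @^-1` V) := cb (open_nbhs_nbhs (conj oV VT)).
move=> [[A B] /= [/nbhs_ballP[d d0 dA] nB] AB].
exists d => // T1 T2 T10 h1 h2 gT1.
have [T21|T12] := leP T2 T1; first exact: good_le gT1.
have [U [g [oU U0 gc g0 gF]]] := gT1.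
have bV t l : T1 <= t <= T2 -> B l -> V (b (t, l)).
  move=> /andP[t1 t2] Bl; apply: (AB (t, l)); split => //=; apply: dA => /=.
  rewrite /ball/=; move: h1 h2; rewrite !ltr_norml => /andP[? ?] /andP[? ?].
  by apply/andP; split; lra.
have B0 : B l0 := nbhs_singleton nB.
have T11 : T1 <= T1 <= T2 by rewrite lexx ltW.
have F1 : F (g (T1, l0)) = b (T1, l0) by apply: gF; rewrite ?lexx ?T10.
have [s [sy sF sc]] : exists s : Z -> Y, [/\ s (b (T1, l0)) = g (T1, l0),
    forall v, V v -> F (s v) = v & forall v, V v -> {for v, continuous s}].
  by rewrite -F1; apply: sV; rewrite F1; exact: bV.
have [N Ng iN] : locally_injective_at F (g (T1, l0)).
  by apply: inj; rewrite F1; exact: bP.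
have n1 : nbhs l0 ((fun l => g (T1, l)) @^-1` N).
  have : {for l0, continuous (fun l => g (T1, l))}.
    apply: (@continuous_comp _ _ _ (fun l => (T1, l)) g); first exact: cpair.
    exact: gc.
  by apply.
have n2 : nbhs l0 ((fun l => s (b (T1, l))) @^-1` N).
  have : {for l0, continuous (fun l => s (b (T1, l)))}.
    apply: (@continuous_comp _ _ _ (fun l => b (T1, l)) s).
      apply: (@continuous_comp _ _ _ (fun l => (T1, l)) b); first exact: cpair.
      exact: cb.
    by apply: sc; exact: bV.
  by apply; rewrite sy.
have nU : nbhs l0 U by exact: open_nbhs_nbhs.
have /nbhs_interior nI : nbhs l0 (U `&` B `&` ((fun l => g (T1, l)) @^-1` N
    `&` (fun l => s (b (T1, l))) @^-1` N)).
  by apply: filterI; apply: filterI.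
set W := interior _ in nI.
have WE l : W l -> [/\ U l, B l & g (T1, l) = s (b (T1, l))].
  move=> /interior_subset[[Ul Bl] [Ng1 Ns]]; split=> //; apply: iN => //.
  rewrite gF ?lexx ?T10//; symmetry; apply: sF; exact: bV.
exists W, (fun x => if x.1 <= T1 then g x else s (b (clamp T1 T2 x.1, x.2))); split.
- exact: open_interior.
- exact: nbhs_singleton nI.
- move=> t l Wl; have [Ul Bl e] := WE _ Wl.
  apply: (@continuous_paste _ _ _ fst g
    (fun x : R * L => s (b (clamp T1 T2 x.1, x.2)))).
  + exact: (@cvg_fst _ _ (nbhs t) (nbhs l)).
  + by move=> _; exact: gc.
  + move=> _; apply: (@continuous_comp _ _ _
      (fun x : R * L => b (clamp T1 T2 x.1, x.2)) s).
      apply: (@continuous_comp _ _ _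
        (fun x : R * L => (clamp T1 T2 x.1, x.2)) b); first exact: cclamp.
      exact: cb.
    by apply: sc; apply: bV => //=; apply: clamp_itv; exact: ltW.
  + by move=> /= ->; rewrite clamp_id.
- by move=> l /WE[Ul _ _]; rewrite /= T10 g0.
- move=> t l /WE[Ul Bl e] /andP[t0 t2] /=; case: leP => tT1.
    by rewrite gF// t0.
  have tI : T1 <= t <= T2 by rewrite ltW.
  by rewrite clamp_id// sF//; exact: bV.
Qed.

(** The parameter l lets the same argument serve for single paths and for the
    deformation of a path. *)
Lemma joint_lift T : good T.
Proof.
suff : good (Num.max T 0) by apply: good_le; rewrite le_max lexx.
move: T; apply: (connected_ind (t0 := 0) (@connected_R R)).
- rewrite maxxx; exists setT, (fun=> y0); split=> //; first exact: openT.
    by move=> t l _; exact: cst_continuous.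
  move=> t l _ /andP[t0 t1]; have -> : t = 0 by apply/eqP; rewrite eq_le t0 t1.
  by rewrite b0.
- move=> t gt; have [|d d0 h] := @good_step (Num.max t 0).
    by rewrite le_max lexx orbT.
  have : \forall t' \near t, `|t - t'| < d.
    exact: (@cvgr_dist_lt _ _ _ (nbhs t) _ id t).
  apply: filterS => t' tt'; apply: h gt.
  + by rewrite le_max lexx orbT.
  + by rewrite subrr normr0.
  + by apply: le_lt_trans tt'; rewrite maxC [Num.max t' 0]maxC ler_norml;
      apply/andP; split; case: (leP 0 t) => ?; case: (leP 0 t') => ?;
      have := ler_norm (t - t'); have := ler_norm (t' - t); rewrite distrC; lra.
- move=> t gt; have [|d d0 h] := @good_step (Num.max t 0).
    by rewrite le_max lexx orbT.
  have : \forall t' \near t, `|t - t'| < d.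
    exact: (@cvgr_dist_lt _ _ _ (nbhs t) _ id t).
  apply: filterS => t' tt' gt'; apply: gt; apply: h gt'.
  + by rewrite le_max lexx orbT.
  + by apply: le_lt_trans tt'; rewrite maxC [Num.max t' 0]maxC ler_norml;
      apply/andP; split; case: (leP 0 t) => ?; case: (leP 0 t') => ?;
      have := ler_norm (t - t'); have := ler_norm (t' - t); rewrite distrC; lra.
  + by rewrite subrr normr0.
Qed.

End Joint.

Lemma lift_exists (b : R -> Z) x : path_in P (b 0) (b 1) b -> b 0 = F x ->
  exists2 y, lift_ends F b x y & F y = b 1.
Proof.
move=> /path_total[bc [_ _ bP]] b0.
have cb2 : continuous (fun z : R * R => b (clamp 0 1 z.1)).
  move=> [t l]; apply: (@continuous_comp _ _ _ fst (b \o clamp 0 1)).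
    exact: (@cvg_fst _ _ (nbhs t) (nbhs l)).
  exact: bc.
have [] := @joint_lift R 0 (fun z : R * R => b (clamp 0 1 z.1)) x cb2 _ _ 1.
- by move=> z; exact: bP.
- by move=> l /=; rewrite clamp_id ?itv01_0.
move=> U [g [oU U0 gc g0 gF]].
have gF' t : 0 <= t <= 1 -> F (g (t, 0)) = b t.
  by move=> tt; rewrite gF//= clamp_id.
exists (g (1, 0)); last by rewrite gF' ?itv01_1.
apply/lift_endsP; exists (fun t => g (t, 0)); split=> //; last exact: g0.
move=> t; apply: (@continuous_comp _ _ _ (fun t => (t, 0)) g); last exact: gc.
apply: (@cvg_pair _ _ _ (nbhs t) (nbhs t) (nbhs (0 : R)) _ _ _ id (fun=> 0)).
  exact: cvg_id.
exact: cvg_cst.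
Qed.

(** The end point of the lift varies continuously with the deformation parameter
    and stays in one fibre, which is discrete; so it is constant. *)
Lemma lift_homotopic (z z' : Z) (g0 g1 : R -> Z) x y : homotopic P z z' g0 g1 ->
  F x = z -> lift_ends F g0 x y -> lift_ends F g1 x y.
Proof.
move=> [H [Hc HP H01 Hz]] xz L0.
have cI t := clamp_itv t (@ler01 R).
pose K (x : R * R) := H (clamp 0 1 x.1, clamp 0 1 x.2).
have KP u : P (K u).
  by apply: HP; exists (clamp 0 1 u.1, clamp 0 1 u.2) => //; split; rewrite /= in_itv/=.
have cK : continuous K.
  move=> [t s] B nB.
  have HA : (`[0, 1]%classic `*` `[0, 1]%classic) (clamp 0 1 t, clamp 0 1 s).
    by split; rewrite /= in_itv/=.
  have := proj1 (@subspace_continuousP _ _ _ _) Hc _ HA B nB.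
  move=> {}nB; have {}nB : nbhs (clamp 0 1 t, clamp 0 1 s)
    [set u | (`[0, 1]%classic `*` `[0, 1]%classic) u -> B (H u)] := nB.
  have c1 : {for (t, s), continuous (fun u : R * R => clamp 0 1 u.1)}.
    apply: (@continuous_comp _ _ _ fst (clamp 0 1)).
      exact: (@cvg_fst _ _ (nbhs t) (nbhs s)).
    exact: clamp_continuous.
  have c2 : {for (t, s), continuous (fun u : R * R => clamp 0 1 u.2)}.
    apply: (@continuous_comp _ _ _ snd (clamp 0 1)).
      exact: (@cvg_snd _ _ (nbhs t) (nbhs s)).
    exact: clamp_continuous.
  have cc : {for (t, s), continuous (fun u : R * R => (clamp 0 1 u.1, clamp 0 1 u.2))}.
    exact: (@cvg_pair _ _ _ (nbhs (t, s)) (nbhs (clamp 0 1 t)) (nbhs (clamp 0 1 s))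
      _ _ _ (fun u : R * R => clamp 0 1 u.1) (fun u : R * R => clamp 0 1 u.2) c1 c2).
  have : nbhs (t, s) ((fun u : R * R => (clamp 0 1 u.1, clamp 0 1 u.2)) @^-1` _) := cc _ nB.
  by apply: filterS => u /=; apply; split; rewrite /= in_itv/=.
have K0 s : K (0, s) = F x.
  by rewrite /K/= (clamp_id (itv01_0 R)) xz; have [-> _] := Hz _ (cI s).
have K1 s : K (1, s) = z'.
  by rewrite /K/= (clamp_id (itv01_1 R)); have [_ ->] := Hz _ (cI s).
have near s y1 : lift_ends F (fun t => K (t, s)) x y1 ->
    \forall s' \near s, lift_ends F (fun t => K (t, s')) x y1.
  move=> L1; have [U [g [oU U0 gc g00 gF]]] := @joint_lift R s K x cK KP K0 1.
  have Lg s' : U s' -> lift_ends F (fun t => K (t, s')) x (g (1, s')).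
    move=> Us; apply/lift_endsP; exists (fun t => g (t, s')); split=> //.
    - move=> t; apply: (@continuous_comp _ _ _ (fun t => (t, s')) g); last exact: gc.
      apply: (@cvg_pair _ _ _ (nbhs t) (nbhs t) (nbhs s') _ _ _ id (fun=> s')).
        exact: cvg_id.
      exact: cvg_cst.
    - exact: g00.
    - by move=> t tt; rewrite gF.
  have e : g (1, s) = y1 by apply: lift_ends_unique (Lg _ U0) L1 => t _; exact: KP.
  have F1 s' : U s' -> F (g (1, s')) = z' by move=> Us; rewrite gF ?K1 ?itv01_1.
  have [N Ny iN] : locally_injective_at F (g (1, s)).
    by apply: (proj1 cF); rewrite gF ?itv01_1.
  have n1 : nbhs s ((fun s => g (1, s)) @^-1` N).
    have : {for s, continuous (fun s => g (1, s))}.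
      apply: (@continuous_comp _ _ _ (fun s => (1 : R, s)) g); last exact: gc.
      apply: (@cvg_pair _ _ _ (nbhs s) (nbhs (1 : R)) (nbhs s) _ _ _ (fun=> 1) id).
        exact: cvg_cst.
      exact: cvg_id.
    by apply.
  have nU : nbhs s U by exact: open_nbhs_nbhs.
  apply: filterS2 n1 nU => s' Ns Us; rewrite -e.
  have <- : g (1, s') = g (1, s).
    by apply: iN => //; [exact: nbhs_singleton Ny|rewrite !F1].
  exact: Lg.
have L s : lift_ends F (fun t => K (t, s)) x y.
  move: s; apply: (connected_ind (t0 := 0) (@connected_R R)).
  - move: L0 => /lift_endsP[g [gc e0 e1 gF]]; apply/lift_endsP; exists g; split=> //.
    by move=> t tt; rewrite gF// /K/= !clamp_id// ?itv01_0//; have [-> _] := H01 _ tt.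
  - by move=> s /near.
  - move=> s nL.
    have pK : path_in P (K (0, s)) (K (1, s)) (fun t => K (t, s)).
      apply: path_in_total => // t.
      apply: (@continuous_comp _ _ _ (fun t => (t, s)) K); last exact: cK.
      apply: (@cvg_pair _ _ _ (nbhs t) (nbhs t) (nbhs s) _ _ _ id (fun=> s)).
        exact: cvg_id.
      exact: cvg_cst.
    have [y' Ly' _] := lift_exists pK (K0 s).
    have := near _ _ Ly'; apply: filterS => s' Ls' Ls; apply: nL.
    suff -> : y = y' by [].
    by apply: lift_ends_unique Ls Ls' => t _; exact: KP.
have := L 1; move=> /lift_endsP[g [gc e0 e1 gF]]; apply/lift_endsP; exists g; split=> //.
by move=> t tt; rewrite gF// /K/= !clamp_id// ?itv01_1//; have [_ ->] := H01 _ tt.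
Qed.

End Lifting.

(** * Holomorphic maps between compact Riemann surfaces *)

Section Charts.
Variables (R : realType) (X : riemann_surface R).
Local Notation C := (Cplx R).
Implicit Types (a : chart R X) (x : X).

Lemma chart_nbhs_inv a x (N : set X) : chart_dom a x -> nbhs x N ->
  nbhs (a x : C) (chart_inv a @^-1` N).
Proof.
by move=> ax xN; apply: (chart_inv_continuous ax); rewrite chart_mapK.
Qed.

Lemma chart_nbhs a x (B : set C) : chart_dom a x -> nbhs (a x : C) B ->
  nbhs x (a @^-1` B).
Proof. by move=> ax aB; apply: (chart_continuous ax). Qed.

Lemma chart_dom_nbhs a x : chart_dom a x -> nbhs x (chart_dom a).
Proof. by move=> ax; apply: open_nbhs_nbhs; split => //; exact: chart_dom_open. Qed.

Lemma chart_img_inv a (w : C) : (a @` chart_dom a) w ->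
  chart_dom a (chart_inv a w) /\ a (chart_inv a w) = w.
Proof. by move=> [x ax <-]; rewrite chart_mapK. Qed.

Lemma chart_img_nbhs a x : chart_dom a x -> nbhs (a x : C) (a @` chart_dom a).
Proof.
move=> ax; apply: open_nbhs_nbhs; split; first exact: chart_img_open.
by exists x.
Qed.

Lemma chart_ball a x (N : set X) : chart_dom a x -> nbhs x N ->
  exists2 r : R, 0 < r & forall w : C, cabs (w - a x) < r ->
    [/\ chart_dom a (chart_inv a w), a (chart_inv a w) = w & N (chart_inv a w)].
Proof.
move=> ax xN.
have : nbhs (a x : C) ((a @` chart_dom a) `&` chart_inv a @^-1` N).
  by apply: filterI; [exact: chart_img_nbhs|exact: chart_nbhs_inv].
move=> /(proj1 (@nbhs_cabsP R _ _))[r r0 h]; exists r => // w /h[/chart_img_inv[h1 h2] h3].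
by split.
Qed.

Lemma chart_ball_nbhs a x (r : R) : chart_dom a x -> 0 < r ->
  nbhs x [set y | chart_dom a y /\ cabs (a y - a x) < r].
Proof.
move=> ax r0; apply: filterI; first exact: chart_dom_nbhs.
by apply: (chart_nbhs ax (B := [set w | cabs (w - a x) < r])); apply/nbhs_cabsP; exists r.
Qed.

Lemma no_isolated_point x (N : set X) : nbhs x N -> exists2 y, N y & y <> x.
Proof.
move=> xN; have [a _ ax] := atlas_cover x.
have [r r0 h] := chart_ball ax xN.
have wr : cabs (a x + rC (r / 2) - a x) < r.
  by rewrite addrC addKr cabs_rC ger0_norm ?divr_ge0 ?ltW//; lra.
have [dw aw Nw] := h _ wr; exists (chart_inv a (a x + rC (r / 2))) => // e.
rewrite e in aw.
have z0 : rC (r / 2) = 0 by apply: (addrI (a x)); rewrite addr0.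
have : cabs (rC (r / 2)) = 0 by rewrite z0 cabs0.
by rewrite cabs_rC ger0_norm ?divr_ge0 ?ltW//; lra.
Qed.

End Charts.

Section HolomorphicMaps.
Variables (R : realType) (X Y : riemann_surface R) (F : X -> Y).
Local Notation C := (Cplx R).
Hypothesis hF : holomorphic F.

Lemma holo_continuous : continuous F. Proof. by case: hF. Qed.

Lemma local_rep (a : chart R X) (b : chart R Y) x : atlas X a -> atlas Y b -> chart_dom a x ->
  chart_dom b (F x) -> exists2 r : R, 0 < r & holo_on (a x) r (in_charts a b F) /\
  forall w : C, cabs (w - a x) < r -> [/\ chart_dom a (chart_inv a w),
    a (chart_inv a w) = w & chart_dom b (F (chart_inv a w))].
Proof.
move=> Aa Ab ax bx; have [_ dF _] := hF.
have nb : nbhs x (F @^-1` chart_dom b).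
  by apply: holo_continuous; exact: chart_dom_nbhs.
have [r r0 h] := chart_ball ax nb; exists r => //; split; last first.
  by move=> w /h[].
by move=> w /h[dw aw bw]; have := dF a b Aa Ab _ dw bw; rewrite aw.
Qed.

Lemma in_charts_at (a : chart R X) (b : chart R Y) x :
  chart_dom a x -> in_charts a b F (a x) = b (F x).
Proof. by move=> ax; rewrite /in_charts/= chart_mapK. Qed.

(** At every point F is locally constant or does not take its value again nearby.
    The points where F is locally equal to a given constant form an open and closed
    set, which is empty as F is not constant. *)
Lemma fibre_isolated x : \forall y \near x, F y = F x -> y = x.
Proof.
have [cF _ [x1 [x2 x12]]] := hF.
have dich (y : X) : (\forall z \near y, F z = F y) \/ (\forall z \near y, F z = F y -> z = y).
  have [a Aa ay] := atlas_cover y; have [b Ab by_] := atlas_cover (F y).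
  have [r r0 [hr hw]] := local_rep Aa Ab ay by_.
  have [[d d0 h]|[d d0 h]] := isolated_value r0 hr.
    left; have m0 : 0 < Num.min d r by rewrite lt_min d0.
    apply: filterS (chart_ball_nbhs ay m0) => z /= [az]; rewrite lt_min => /andP[zd zr].
    have [_ _ bz] := hw _ zr; rewrite chart_mapK// in bz.
    have := h _ zd; rewrite !in_charts_at// => e.
    by rewrite -(chart_mapK bz) e chart_mapK.
  right; apply: filterS (chart_ball_nbhs ay d0) => z /= [az zd] e.
  apply: contrapT => zy; have := h (a z); rewrite zd andbT cabs_gt0 subr_eq0.
  rewrite !in_charts_at// e; apply => //; apply/eqP => azy; apply: zy.
  by rewrite -(chart_mapK az) azy chart_mapK.
have [cst|//] := dich x.
pose Q (y : X) := nbhs y [set z | F z = F x].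
have all (y : X) : Q y.
  move: y; apply: (@connected_ind X Q x (@rs_connected _ X) cst).
  - by move=> y /nbhs_interior.
  - move=> y ny; have [cy|iy] := dich y.
      have nxy : F y <> F x by move=> e; apply: ny; rewrite /Q -e.
      apply: filterS (nbhs_interior cy) => z cz nz; apply: nxy.
      by rewrite -(nbhs_singleton nz) (nbhs_singleton cz).
    have [Fy|nFy] := pselect (F y = F x); last first.
      have oN : nbhs (F y) [set~ F x].
        apply: open_nbhs_nbhs; split => //; apply: closed_openC.
        apply: accessible_closed_set1; apply: hausdorff_accessible.
        exact: rs_hausdorff.
      have : nbhs y (F @^-1` [set~ F x]) by exact: cF.
      by apply: filterS => z nz /nbhs_singleton.
    rewrite Fy in iy; apply: filterS iy => z zy nz; apply: ny.
    by rewrite -(zy (nbhs_singleton nz)).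
by exfalso; apply: x12; rewrite (nbhs_singleton (all x1)) (nbhs_singleton (all x2)).
Qed.

Lemma open_map x (N : set X) : nbhs x N -> nbhs (F x) (F @` N).
Proof.
move=> xN; have [a Aa ax] := atlas_cover x; have [b Ab bx] := atlas_cover (F x).
have [r r0 [hr hw]] := local_rep Aa Ab ax bx.
have [s s0 hs] := chart_ball ax xN.
have iso := fibre_isolated x.
have [t t0 ht] := chart_ball ax iso.
pose e := Num.min r (Num.min s t).
have e0 : 0 < e by rewrite !lt_min r0 s0.
have hre : holo_on (a x) e (in_charts a b F).
  by move=> z; rewrite lt_min => /andP[/hr].
have nf z : 0 < cabs (z - a x) < e -> in_charts a b F z <> in_charts a b F (a x).
  move=> /andP[z0]; rewrite !lt_min => /andP[zr /andP[zs zt]].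
  have [dz az iz] := ht _ zt; have [_ _ bz] := hw _ zr.
  rewrite in_charts_at// /in_charts/= => E.
  have E2 : F (chart_inv a z) = F x by rewrite -(chart_mapK bz) E chart_mapK.
  by move: z0; rewrite -az (iz E2) subrr cabs0 ltxx.
have [d d0 hd] := open_value e0 hre nf e0.
apply: filterS (chart_ball_nbhs bx d0) => y /= [by_ yd].
have := hd (b y); rewrite in_charts_at// => /(_ yd)[z].
rewrite !lt_min => /andP[zr /andP[zs zt]] zy.
have [_ _ Nz] := hs _ zs; have [_ _ bz] := hw _ zr.
by exists (chart_inv a z) => //; rewrite -(chart_mapK bz) -(chart_mapK by_) -zy.
Qed.

(** The image is compact, hence closed, and it is open. *)
Lemma holo_onto y : exists x, F x = y.
Proof.
have [x0 _] := rs_nonempty X.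
have clF : closed (range F).
  apply: compact_closed; first exact: rs_hausdorff.
  apply: continuous_compact; last exact: rs_compact.
  by apply: continuous_subspaceT; exact: holo_continuous.
move: y; apply: (@connected_ind Y (fun y => exists x, F x = y) (F x0)
  (@rs_connected _ Y) (ex_intro _ x0 erefl)).
- move=> _ [x <-]; have h : nbhs (F x) (F @` setT) by apply: open_map; exact: filterT.
  by apply: filterS h => _ [z _ <-]; exists z.
- move=> y ny; have : nbhs y (~` range F).
    apply: open_nbhs_nbhs; split; first exact: closed_openC.
    by move=> [x _ e]; apply: ny; exists x.
  by apply: filterS => z nz [x e]; apply: nz; exists x.
Qed.

Lemma unramified_inj x : ~ ramified_at F x -> locally_injective_at F x.
Proof.
move=> nr; have [a Aa ax] := atlas_cover x; have [b Ab bx] := atlas_cover (F x).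
have [r r0 [hr hw]] := local_rep Aa Ab ax bx.
have l0 : (in_charts a b F)^`()%classic (a x : C) != 0.
  by apply/eqP => e; apply: nr; exists a, b.
have [d d0 hd] := local_inj r0 hr l0.
exists [set y | chart_dom a y /\ cabs (a y - a x) < d]; first exact: chart_ball_nbhs.
move=> y1 y2 [d1 c1] [d2 c2] F12.
rewrite -(chart_mapK d1) -(chart_mapK d2); congr chart_inv; apply: hd => //.
by rewrite !in_charts_at// F12.
Qed.

Lemma unramified_nbhs S y : unramified_outside S F -> ~ S (F y) -> ~ ramified_at F y.
Proof. by move=> uF nS r; apply: nS; apply: uF; exists y. Qed.

(** Near every point of a fibre F has a local inverse; compactness of the source
    provides one neighbourhood of v on which all of them are defined. *)
Lemma holo_covering S : closed S -> unramified_outside S F -> covering_on F (~` S).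
Proof.
move=> cS uF; split.
  by move=> y nS; apply: unramified_inj; exact: unramified_nbhs nS.
move=> v nSv; have [cF _ _] := hF.
have hY := @rs_hausdorff _ Y.
have := compact_near_coveringP [set: X].
move=> [/(_ (@rs_compact _ X)) + _].
move=> /(_ _ (powerset_filter_from (nbhs v))
  (fun V y => V (F y) -> exists s : Y -> X, [/\ s (F y) = y,
     forall u, V u -> F (s u) = u & forall u, V u -> {for u, continuous s}])).
move=> /(_ (powerset_filter_from_filter _) _)/wrap[].
  move=> y _; have [Fy|nFy] := pselect (F y = v); last first.
    have := hY; rewrite open_hausdorff => /(_ (F y) v).
    case; first exact/eqP.
    move=> [A B] /= [/set_mem Ay /set_mem Bv] [oA oB /eqP AB].
    exists ([set x | A (F x)], [set V | V `<=` B]) => /=.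
      split; first by apply: cF; exact: open_nbhs_nbhs.
      by apply: small_set_sub; exact: open_nbhs_nbhs.
    move=> [x V] /= [Ax VB] VFx.
    by have : (A `&` B) (F x); [split; [exact: Ax|exact: VB]|rewrite AB].
  have ny : ~ S (F y) by rewrite Fy.
  have [N0 yN0 iN0] := unramified_inj (unramified_nbhs uF ny).
  pose N := interior N0.
  have oN : open N by exact: open_interior.
  have yN : N y by [].
  have iN y1 y2 : N y1 -> N y2 -> F y1 = F y2 -> y1 = y2.
    by move=> /interior_subset h1 /interior_subset h2; exact: iN0.
  have nV : nbhs v (F @` N).
    by rewrite -Fy; apply: open_map; exact: open_nbhs_nbhs.
  exists (N, [set V | V `<=` F @` N]) => /=.
    by split; [exact: open_nbhs_nbhs|exact: small_set_sub].
  move=> [x V] /= [Nx VN] _.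
  pose s u := if pselect (exists2 x, N x & F x = u) is left e then projT1 (cid2 e) else x.
  have sP u : (F @` N) u -> N (s u) /\ F (s u) = u.
    move=> [z Nz zu]; rewrite /s; case: pselect => [e|[]]; last by exists z.
    by case: (cid2 e).
  have sF z : N z -> s (F z) = z.
    move=> Nz; have [|h1 h2] := sP (F z); first by exists z.
    exact: iN.
  exists s; split; first exact: sF.
    by move=> u /VN/sP[].
  move=> u /VN[z Nz <-] A; rewrite sF// => zA.
  have h : nbhs (F z) (F @` (N `&` A)).
    by apply: open_map; apply: filterI => //; exact: open_nbhs_nbhs.
  by apply: filterS h => _ [t [Nt At] <-]; rewrite /= sF.
move=> hV; have [U vU hU] : exists2 U, nbhs v U & forall y, U (F y) ->
    exists s : Y -> X, [/\ s (F y) = y,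
      forall u, U u -> F (s u) = u & forall u, U u -> {for u, continuous s}].
  have /near_powerset_filter_fromP[|U vU hU] := hV; last first.
    by exists U => // y; exact: hU.
  move=> A B AB h y _ /AB Ay; have [s [s1 s2 s3]] := h y I Ay.
  by exists s; split=> // u /AB; [exact: s2|exact: s3].
exists (interior U); split; [exact: open_interior|exact: vU|].
move=> y /interior_subset /hU[s [s1 s2 s3]]; exists s.
by split=> // u /interior_subset; [exact: s2|exact: s3].
Qed.

End HolomorphicMaps.

(** * Path-connectedness of punctured surfaces *)

Section Joined.
Variables (R : realType) (X : topologicalType).
Implicit Types (A B : set X) (x y : X).

Definition joined A x y := exists g : R -> X, path_in A x y g.

Lemma joinedP A x y : joined A x y <-> exists g : R -> X,
  [/\ continuous g, g 0 = x, g 1 = y & forall t, A (g t)].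
Proof.
split=> [[g /path_total[gc [g0 g1 gA]]]|[g [gc <- <- gA]]].
  exists (g \o clamp 0 1); split=> //=; first by rewrite clamp_id// itv01_0.
  by rewrite clamp_id// itv01_1.
by exists g; apply: path_in_total.
Qed.

Lemma joined_trans A x y z : joined A x y -> joined A y z -> joined A x z.
Proof.
move=> /joinedP[g [gc g0 g1 gA]] /joinedP[g' [gc' g'0 g'1 gA']].
apply/joinedP; exists (path_concat g g'); split.
- by apply: concat_continuous => //; rewrite g1.
- by rewrite /path_concat mulr0 invr_ge0 ler0n.
- rewrite /path_concat ifF; first by rewrite mulr1 (_ : 2 - 1 = 1)//; lra.
  by apply/negbTE; rewrite -ltNge; lra.
- by move=> t; rewrite /path_concat; case: ifP.
Qed.

Lemma joined_sub A B x y : A `<=` B -> joined A x y -> joined B x y.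
Proof.
move=> AB /joinedP[g [gc g0 g1 gA]]; apply/joinedP; exists g; split=> // t.
exact: AB.
Qed.

End Joined.

Section Discs.
Variables (R : realType) (X : riemann_surface R).
Local Notation C := (Cplx R).
Implicit Types (a : chart R X) (x : X).

Definition segment (p q : C) (t : R) : C := p + rC t * (q - p).

Lemma segmentE c p q t : segment p q t - c = rC (1 - t) * (p - c) + rC t * (q - c).
Proof.
rewrite /segment; have -> : rC (1 - t) = 1 - rC t :> C.
  by apply: complex_ext; rewrite !(cReD, cImD, cReN, cImN)/= ?subr0.
ring.
Qed.

Lemma segment0 p q : segment p q 0 = p.
Proof. by rewrite /segment (_ : rC 0 = 0)// mul0r addr0. Qed.

Lemma segment1 p q : segment p q 1 = q.
Proof. by rewrite /segment (_ : rC 1 = 1)// mul1r addrC subrK. Qed.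

Lemma segment_continuous p q : continuous (segment p q).
Proof.
move=> t; apply/cvg_cabsP => e e0.
have k0 : 0 < cabs (q - p) + 1 by rewrite ltr_wpDl ?cabs_ge0.
have : \forall s \near t, `|t - s| < e / (cabs (q - p) + 1).
  by apply: (@cvgr_dist_lt _ _ _ (nbhs t) _ id t) => //; rewrite divr_gt0.
apply: filterS => s st.
have -> : segment p q s - segment p q t = rC (s - t) * (q - p).
  rewrite /segment (_ : rC (s - t) = rC s - rC t); first by ring.
  by apply: complex_ext; rewrite !(cReD, cImD, cReN, cImN)/= ?subr0.
rewrite cabsM cabs_rC distrC; rewrite ltr_pdivlMr// in st; apply: le_lt_trans st.
by rewrite ler_wpM2l// lerDl.
Qed.

Lemma segment_ball c p q (r t : R) : 0 <= t <= 1 -> cabs (p - c) < r ->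
  cabs (q - c) < r -> cabs (segment p q t - c) < r.
Proof.
move=> /andP[t0 t1] pr qr; rewrite (segmentE c).
apply: le_lt_trans (cabsD _ _) _; rewrite !cabsM !cabs_rC !ger0_norm ?subr_ge0//.
have [->|tn] := eqVneq t 0; first by rewrite subr0 mul1r mul0r addr0.
have tp : 0 < t by rewrite lt_def tn.
have h1 : (1 - t) * cabs (p - c) <= (1 - t) * r by rewrite ler_wpM2l ?subr_ge0// ltW.
have h2 : t * cabs (q - c) < t * r by rewrite ltr_pM2l.
by move: h1 h2; clear; lra.
Qed.

Lemma joined_segment (A : set C) p q :
  (forall t, 0 <= t <= 1 -> A (segment p q t)) -> joined R A p q.
Proof.
move=> hA; exists (segment p q).
by have := path_in_total (@segment_continuous p q) hA; rewrite segment0 segment1.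
Qed.

(** Two points of a punctured disc are joined by the segment between them or, if
    the centre lies on it, by way of a point at a right angle. *)
Lemma punctured_disc (c p q : C) (r : R) : 0 < cabs (p - c) < r ->
  0 < cabs (q - c) < r -> joined R [set z : C | 0 < cabs (z - c) < r] p q.
Proof.
have seg u v : 0 < cabs (u - c) < r -> 0 < cabs (v - c) < r ->
    (forall t, 0 <= t <= 1 -> segment u v t <> c) ->
    joined R [set z : C | 0 < cabs (z - c) < r] u v.
  move=> /andP[u0 ur] /andP[v0 vr] nc; apply: joined_segment.
  move=> t tt; rewrite /= segment_ball// andbT cabs_gt0 subr_eq0.
  by apply/eqP; exact: nc.
move=> hp hq; have [[t tt tc]|nt] := pselect (exists2 t, 0 <= t <= 1 & segment p q t = c);
  last by apply: seg => // t tt tc; apply: nt; exists t.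
have [/andP[p0 pr] /andP[q0 qr]] := (hp, hq).
have pc : p - c != 0 by rewrite -cabs_gt0.
have qc : q - c != 0 by rewrite -cabs_gt0.
have tn : t != 0.
  by apply/eqP => t0; move: tc pc; rewrite t0 segment0 => ->; rewrite subrr eqxx.
pose l := - (1 - t) / t.
have qE : q - c = rC l * (p - c).
  have e : rC t * (q - c) = - (rC (1 - t) * (p - c)).
    by apply/eqP; rewrite -addr_eq0 addrC -segmentE tc subrr.
  have tC : rC t != 0 :> C by rewrite -cabs_gt0 cabs_rC normr_gt0.
  apply: (mulfI tC); rewrite e mulrA -mulNr; congr (_ * _).
  apply: complex_ext; rewrite !(cReM, cImM, cReN, cImN)/=; last by ring.
  by rewrite /l; field.
pose m := c + iC R * (p - c).
have mc : m - c = iC R * (p - c) by rewrite /m addrC addKr.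
have hm : 0 < cabs (m - c) < r by rewrite mc cabsM cabs_iC mul1r p0.
apply: (joined_trans (y := m)).
  apply: seg => // s ss /eqP; rewrite -subr_eq0 (segmentE c) mc mulrA -mulrDl.
  rewrite mulf_eq0 (negbTE pc) orbF => /eqP e.
  have := congr1 (@complex.Re R) e; have := congr1 (@complex.Im R) e.
  rewrite !(cReD, cImD, cReM, cImM)/=; lra.
apply: seg => // s ss /eqP; rewrite -subr_eq0 (segmentE c) mc qE !mulrA -mulrDl.
rewrite mulf_eq0 (negbTE pc) orbF => /eqP e.
have := congr1 (@complex.Re R) e; have := congr1 (@complex.Im R) e.
rewrite !(cReD, cImD, cReM, cImM)/= => e1 e2.
have s1 : s = 1 by lra.
have l0 : l = 0 by move: e2; rewrite s1; move: (l) => l'; clear; lra.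
by move: qc; rewrite qE l0 (_ : rC 0 = 0)// mul0r eqxx.
Qed.

Lemma chart_joined a x (r : R) (A : set C) p q : chart_dom a x ->
  (forall w : C, cabs (w - a x) < r -> chart_dom a (chart_inv a w) /\
     a (chart_inv a w) = w) ->
  (forall w, A w -> cabs (w - a x) < r) ->
  joined R A p q -> joined R (chart_inv a @` A) (chart_inv a p) (chart_inv a q).
Proof.
move=> ax hr Ar /joinedP[g [gc <- <- gA]]; apply/joinedP.
exists (chart_inv a \o g); split=> //; last by move=> t; exists (g t).
move=> t; apply: continuous_comp; first exact: gc.
have [d e] := hr _ (Ar _ (gA t)).
by have := chart_inv_continuous d; rewrite e.
Qed.

(** Neighbourhoods that remain path-connected when their centre is removed. *)
Lemma small_disc x (N : set X) : nbhs x N -> exists D : set X,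
  [/\ nbhs x D, D `<=` N, forall p q, D p -> D q -> joined R D p q
    & forall p q, (D `\ x) p -> (D `\ x) q -> joined R (D `\ x) p q].
Proof.
move=> xN; have [a _ ax] := atlas_cover x.
have [r r0 h] := chart_ball ax xN.
have hr (w : C) : cabs (w - a x) < r -> chart_dom a (chart_inv a w) /\
    a (chart_inv a w) = w by move=> /h[].
exists [set y | chart_dom a y /\ cabs (a y - a x) < r]; split.
- exact: chart_ball_nbhs.
- by move=> y [dy yr]; have [_ _] := h _ yr; rewrite chart_mapK.
- move=> p q [dp pr] [dq qr].
  have : joined R [set z : C | cabs (z - a x) < r] (a p) (a q).
    by apply: joined_segment => t tt; exact: segment_ball.
  move=> /(@chart_joined a x r _ _ _ ax hr (fun _ h => h)).
  rewrite !chart_mapK//; apply: joined_sub => _ [w wr <-].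
  by have [dw aw] := hr _ wr; rewrite /= aw.
- move=> p q [[dp pr] px] [[dq qr] qx].
  have nz y : chart_dom a y -> y <> x -> 0 < cabs (a y - a x).
    move=> dy yx; rewrite cabs_gt0 subr_eq0; apply/eqP => e; apply: yx.
    by rewrite -(chart_mapK dy) e chart_mapK.
  have := @punctured_disc (a x) (a p) (a q) r; rewrite pr qr !nz// => /(_ isT isT).
  move=> /(@chart_joined a x r _ _ _ ax hr); rewrite !chart_mapK// => H.
  apply: joined_sub (H _); last by move=> w /andP[].
  move=> _ [w /andP[w0 wr] <-]; have [dw aw] := hr _ wr.
  split; first by rewrite /= aw.
  by move=> e; move: w0; rewrite -aw e subrr cabs0 ltxx.
Qed.

(** Closed and discrete: the condition is imposed at all points of X, not only at
    those of E. *)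
Definition discrete_set (E : set X) := forall x, \forall y \near x, E y -> y = x.

(** The points near which everything off E can be reached from x0 form an open and
    closed set, since small discs remain path-connected without their centres. *)
Lemma joined_off E x0 x : discrete_set E -> ~ E x0 -> ~ E x -> joined R (~` E) x0 x.
Proof.
move=> dE nx0 nx; pose P (x : X) := \forall y \near x, ~ E y -> joined R (~` E) x0 y.
suff all (y : X) : P y by exact: nbhs_singleton (all x) nx.
move: y; have dsc (y : X) : exists D : set X, nbhs y D /\
    (forall p q, D p -> D q -> ~ E p -> ~ E q -> joined R (~` E) p q).
  have [D [yD DN h1 h2]] := small_disc (dE y); exists D; split=> // p q Dp Dq nEp nEq.
  have [Ey|nEy] := pselect (E y).
    apply: joined_sub (h2 p q _ _).
    - by move=> z [Dz zy] Ez; apply: zy; exact: DN.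
    - by split => // e; apply: nEp; rewrite e.
    - by split => // e; apply: nEq; rewrite e.
  apply: joined_sub (h1 p q Dp Dq) => z Dz Ez.
  by apply: nEy; rewrite -(DN _ Dz Ez).
apply: (@connected_ind X P x0 (@rs_connected _ X)).
- have [D [xD hD]] := dsc x0; apply: filterS (xD) => y Dy nEy.
  exact: hD (nbhs_singleton xD) Dy nx0 nEy.
- by move=> y /nbhs_interior.
- move=> y nP; have [D [yD hD]] := dsc y.
  have noD p : D p -> ~ E p -> ~ joined R (~` E) x0 p.
    move=> Dp nEp j; apply: nP; apply: filterS yD => z Dz nEz.
    exact: joined_trans j (hD _ _ Dp Dz nEp nEz).
  apply: filterS (nbhs_interior yD) => z zD Pz.
  have [Ez|nEz] := pselect (E z); last first.
    exact: (noD _ (interior_subset zD) nEz (nbhs_singleton Pz nEz)).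
  have [u [uD [uP uE]] uz] := no_isolated_point (filterI zD (filterI Pz (dE z))).
  have nEu : ~ E u by move=> /uE.
  exact: (noD _ uD nEu (uP nEu)).
Qed.

End Discs.

(** * Holomorphy and extension of lifts *)

Section ImplicitDerivative.
Variable R : realType.
Local Notation C := (Cplx R).

Lemma absorb_half (L A B D : R) : L * A <= B + L / 2 * A -> B <= D -> A * L <= 2 * D.
Proof. lra. Qed.

(** As the derivative of f does not vanish, om is Lipschitz at z0; so the first-order
    errors of f and of eta are both small compared with z - z0. *)
Lemma derivable_implicit (f om eta : C -> C) (z0 : C) : {for z0, continuous om} ->
  derivable f (om z0) 1 -> f^`()%classic (om z0) != 0 -> derivable eta z0 1 ->
  (\forall z \near z0, f (om z) = eta z) -> derivable om z0 1.
Proof.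
move=> /continuous_cabsP com df l0 deta /nbhs_cabsP[r r0 hr].
set l := f^`()%classic (om z0) in l0; pose k := eta^`()%classic z0.
have cl : 0 < cabs l by rewrite cabs_gt0.
have fe z : cabs (z - z0) < r -> f (om z) - f (om z0) = eta z - eta z0.
  by move=> zr; rewrite !hr// subrr cabs0.
pose K := 2 / cabs l * (cabs k + 1).
have k0 := cabs_ge0 k.
have kp : 0 < cabs k + 1 by exact: ltr_wpDl.
have two : (0 : R) < 2 by rewrite ltr0n.
have K0 : 0 < K by exact: (mulr_gt0 (divr_gt0 two cl) kp).
have [d1 d10 h1] : exists2 d, 0 < d & forall z, cabs (z - z0) < d ->
    cabs (om z - om z0) <= K * cabs (z - z0).
  have l2 : 0 < cabs l / 2 by exact: (divr_gt0 cl two).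
  have [e1 e10 he1] := derivable_slope df l2.
  have [e2 e20 he2] := derivable_slope deta ltr01.
  have [e3 e30 he3] := com _ e10.
  exists (Num.min r (Num.min e2 e3)); first by rewrite !lt_min r0 e20.
  move=> z; rewrite !lt_min => /andP[zr /andP[z2 z3]].
  have a1 := he1 _ (he3 _ z3); have a2 := he2 _ z2.
  rewrite fe// -/l in a1; rewrite -/k mul1r in a2.
  have b1 : cabs l * cabs (om z - om z0) <= cabs (eta z - eta z0) +
      cabs l / 2 * cabs (om z - om z0).
    rewrite -cabsM; have := cabsB (l * (om z - om z0)) 0 (eta z - eta z0).
    rewrite !subr0 [cabs (_ - (eta z - eta z0))]cabsC; move: a1; clear; lra.
  have b2 : cabs (eta z - eta z0) <= (cabs k + 1) * cabs (z - z0).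
    have := cabsB (eta z - eta z0) 0 (k * (z - z0)).
    by rewrite !subr0 [cabs (k * _)]cabsM; move: a2; clear; lra.
  have -> : K * cabs (z - z0) = 2 * ((cabs k + 1) * cabs (z - z0)) / cabs l.
    by rewrite /K; ring.
  by rewrite (ler_pdivlMr _ _ cl); exact: (absorb_half b1 b2).
apply: (proj1 (derivable_slopeP (l := k / l) _)) => e e0.
pose u := e * cabs l / (2 * K); pose v := e * cabs l / 2.
have el0 : 0 < e * cabs l by exact: (mulr_gt0 e0 cl).
have K20 : 0 < 2 * K by exact: (mulr_gt0 two K0).
have u0 : 0 < u by exact: (divr_gt0 el0 K20).
have v0 : 0 < v by exact: (divr_gt0 el0 two).
have [e1 e10 he1] := derivable_slope df u0.
have [e2 e20 he2] := derivable_slope deta v0.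
have [e3 e30 he3] := com _ e10.
exists (Num.min (Num.min r d1) (Num.min e2 e3)).
  by rewrite !lt_min r0 d10 e20.
move=> z; rewrite !lt_min => /andP[/andP[zr zd] /andP[z2 z3]].
have a1 := he1 _ (he3 _ z3); have a2 := he2 _ z2.
rewrite fe// -/l in a1; rewrite -/k in a2.
have a3 := h1 _ zd.
rewrite -(ler_pM2l cl) -cabsM.
have -> : l * (om z - om z0 - k / l * (z - z0)) =
   (eta z - eta z0 - k * (z - z0)) - (eta z - eta z0 - l * (om z - om z0)).
  by field.
apply: le_trans (cabsD _ _) _; rewrite cabsN.
have a4 : u * cabs (om z - om z0) <= v * cabs (z - z0).
  apply: le_trans (ler_wpM2l (ltW u0) a3) _; rewrite mulrA ler_wpM2r ?cabs_ge0//.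
  rewrite le_eqVlt; apply/orP; left; apply/eqP; rewrite /u /v; field.
  by rewrite lt0r_neq0.
apply: le_trans (lerD a2 (le_trans a1 a4)) _.
by rewrite le_eqVlt; apply/orP; left; apply/eqP; rewrite /v; field.
Qed.

End ImplicitDerivative.

Section LiftHolomorphic.
Variables (R : realType) (X Y Z : riemann_surface R).
Variables (F : Y -> Z) (H : X -> Z) (S : set Z) (w : X -> Y).
Local Notation C := (Cplx R).
Hypotheses (hF : holomorphic F) (hH : holomorphic H) (uF : unramified_outside S F).
Hypothesis fS : finite_set S.

Lemma finite_preimage_discrete : discrete_set (H @^-1` S).
Proof.
move=> x; pose S' := S `\ H x.
have oS : open (~` S').
  apply: closed_openC; apply: (proj1 (@accessible_finite_set_closed Z)).
    exact/hausdorff_accessible/rs_hausdorff.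
  exact: finite_setD.
have : nbhs x (H @^-1` (~` S')).
  apply: (holo_continuous hH); apply: open_nbhs_nbhs; split => //.
  by move=> [_]; apply.
apply: filterS2 (fibre_isolated hH x) => y iy nS Sy; apply: iy.
by apply: contrapT => e; apply: nS.
Qed.

(** Off the preimage of the critical values a continuous lift is locally a
    composite with an inverse of F; the remaining points are removable
    singularities. *)
Lemma lift_holomorphic : continuous w -> (forall x, F (w x) = H x) -> holomorphic w.
Proof.
move=> cw FwH.
have chart_cont (a : chart R X) (b : chart R Y) x : chart_dom a x ->
    chart_dom b (w x) -> {for (a x : C), continuous (in_charts a b w)}.
  move=> ax bx; rewrite /in_charts.
  apply: (@continuous_comp _ _ _ (w \o chart_inv a) b).
    apply: (@continuous_comp _ _ _ (chart_inv a) w).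
      exact: chart_inv_continuous.
    exact: cw.
  by rewrite /= chart_mapK//; exact: chart_continuous.
have reg (a : chart R X) (b : chart R Y) x : atlas X a -> atlas Y b ->
    chart_dom a x -> chart_dom b (w x) -> ~ S (H x) ->
    derivable (in_charts a b w) (a x : C) 1.
  move=> Aa Ab ax bx nS; have [c Ac cx] := atlas_cover (H x).
  have cx' : chart_dom c (F (w x)) by rewrite FwH.
  have nr : ~ ramified_at F (w x).
    by apply: unramified_nbhs uF _; rewrite FwH.
  have [_ dF _] := hF; have [_ dH _] := hH.
  have e : in_charts a b w (a x) = b (w x) by rewrite /in_charts/= chart_mapK.
  apply: (@derivable_implicit R (in_charts b c F) _ (in_charts a c H)).
  - exact: chart_cont.
  - by rewrite e; exact: dF.
  - by rewrite e; apply/eqP => l0; apply: nr; exists b, c.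
  - exact: dH.
  - have nb : nbhs x (w @^-1` chart_dom b) by apply: cw; exact: chart_dom_nbhs.
    have := chart_nbhs_inv ax nb; apply: filterS => z /= bz.
    by rewrite /in_charts/= chart_mapK// FwH.
split=> //; last first.
  have [_ _ [x1 [x2 x12]]] := hH; exists x1, x2 => e; apply: x12.
  by rewrite -!FwH e.
move=> a b Aa Ab x ax bx.
have [nS|Sx] := pselect (~ S (H x)); first exact: reg.
have nb : nbhs x (w @^-1` chart_dom b) by apply: cw; exact: chart_dom_nbhs.
have [r r0 hr] := chart_ball ax (filterI nb (@finite_preimage_discrete x)).
apply: (removable r0 (chart_cont _ _ _ ax bx)) => z /andP[z0 zr].
have [dz az [/= bz iz]] := hr _ zr; rewrite -az; apply: reg => // /iz e.
by move: z0; rewrite -az e subrr cabs0 ltxx.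
Qed.

End LiftHolomorphic.

Section Extension.
Variables (R : realType) (X Y Z : riemann_surface R).
Variables (F : Y -> Z) (H : X -> Z) (E : set X) (w : X -> Y).
Hypotheses (hF : holomorphic F) (cH : continuous H) (dE : discrete_set E).
Hypothesis cw : forall x, ~ E x -> {for x, continuous w}.
Hypothesis FwH : forall x, ~ E x -> F (w x) = H x.

(** The image under w of the filter of punctured neighbourhoods of x. *)
Let off (x : X) : set_system Y := fun A => \forall y \near x, y <> x -> A (w y).

Let off_proper x : ProperFilter (off x).
Proof.
apply: Build_ProperFilter_ex => [A hA|].
  by have [y Ay yx] := no_isolated_point hA; exists (w y); exact: Ay.
split; first exact: nearW.
- move=> A B; rewrite /off => hA hB.
  by apply: filterS2 hA hB => y h1 h2 yx; split; [exact: h1|exact: h2].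
- move=> A B AB; rewrite /off => hA.
  by apply: filterS hA => y h1 yx; apply: AB; exact: h1.
Qed.

(** A cluster point y of w at x lies over H x.  A small neighbourhood of y has a
    boundary disjoint from the fibre, so w, which maps a punctured disc around x
    onto a connected set, stays in the neighbourhood. *)
Lemma extension_limit x : exists2 y, F y = H x &
  forall A, nbhs y A -> \forall x' \near x, x' <> x -> A (w x').
Proof.
have oF : Filter (off x) by case: (off_proper x).
have [y [_ cy]] := @rs_compact _ Y _ (off_proper x) filterT.
have cF := holo_continuous hF; have hZ := @rs_hausdorff _ Z; have hY := @rs_hausdorff _ Y.
have Fy : F y = H x.
  apply: hZ => A B FyA HxB.
  have nB : nbhs x (H @^-1` B) by exact: cH.
  have oB : off x (F @^-1` B).
    by rewrite /off; apply: filterS2 nB (dE x) => z Bz Ez zx; rewrite /= FwH// => /Ez.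
  have nA : nbhs y (F @^-1` A) by exact: cF.
  by have [t [Bt At]] := cy _ _ oB nA; exists (F t).
exists y => // A yA.
have [M yM MA] := compact_regular hY (@rs_compact _ Y) filterT
  (filterI yA (fibre_isolated hF y)).
pose N := interior M; pose B := closure N `\` N.
have oN : open N by exact: open_interior.
have yN : nbhs y N by exact: nbhs_interior.
have clN : closure N `<=` closure M by apply: closureS; exact: interior_subset.
have clB : closed B.
  by apply: closedI; [exact: closed_closure|exact: open_closedC].
have clFB : closed (F @` B).
  apply: compact_closed => //; apply: continuous_compact.
    exact: continuous_subspaceT.
  by apply: subclosed_compact (@rs_compact _ Y) _.
have nFB : ~ (F @` B) (H x).
  move=> [z [zc zN] Fz]; have [_ iz] := MA _ (clN _ zc).
  by apply: zN; rewrite iz ?Fz//; exact: nbhs_singleton.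
have nx : nbhs x (H @^-1` (~` (F @` B))).
  by apply: cH; apply: open_nbhs_nbhs; split => //; exact: closed_openC.
have [D [xD DN _ jD]] := small_disc (filterI nx (dE x)).
have wB z : (D `\ x) z -> ~ B (w z).
  move=> [Dz zx] Bw; have [nF Ez] := DN _ Dz; apply: nF.
  by exists (w z) => //; apply: FwH => /Ez.
have nE z : (D `\ x) z -> ~ E z by move=> [/DN[_ Ez] zx] /Ez.
have oD : off x (w @` (D `\ x)).
  by rewrite /off; apply: filterS (xD) => z Dz zx; exists z.
have [_ [[x1 Dx1 <-] Nx1]] := cy _ _ oD yN.
apply: filterS (xD) => x2 Dx2 x2x.
suff : N (w x2).
  by move=> /interior_subset/subset_closure/MA[].
have /joinedP[g [gc g0 g1 gD]] := jD _ _ Dx1 (conj Dx2 x2x).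
have cwg : continuous (w \o g).
  by move=> t; apply: continuous_comp; [exact: gc|apply: cw; exact: nE].
suff all t : N (w (g t)) by rewrite -g1.
move: t; apply: (@connected_ind R (fun t => N (w (g t))) 0 (@connected_R R)).
- by rewrite g0.
- by move=> t Nt; apply: (cwg t N); exact: open_nbhs_nbhs.
- move=> t Nt.
  have ncl : ~ closure N (w (g t)) by move=> ct; apply: (wB _ (gD t)).
  have : nbhs t ((w \o g) @^-1` (~` closure N)).
    apply: (cwg t); apply: open_nbhs_nbhs; split => //.
    by apply: closed_openC; exact: closed_closure.
  by apply: filterS => s ns Ns; apply: ns; exact: subset_closure.
Qed.

Lemma extension : exists W : X -> Y, [/\ continuous W,
  forall x, ~ E x -> W x = w x & forall x, F (W x) = H x].
Proof.
pose v x := projT1 (cid2 (extension_limit x)).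
have vP x : F (v x) = H x /\
    forall A, nbhs (v x) A -> \forall x' \near x, x' <> x -> A (w x').
  by rewrite /v; case: (cid2 _).
exists (fun x => if pselect (E x) then v x else w x); split.
- move=> x A; case: pselect => [Ex|nEx] /= hA.
    have [_ /(_ _ hA) h] := vP x.
    apply: filterS2 h (dE x) => z h Ez /=; case: pselect => [Ez'|nEz] /=.
      by rewrite (Ez Ez'); exact: nbhs_singleton hA.
    by apply: h => zx; apply: nEz; rewrite zx.
  have h : nbhs x (w @^-1` A) by exact: cw.
  apply: filterS2 h (dE x) => z h Ez /=; case: pselect => [Ez'|//].
  by exfalso; apply: nEx; rewrite -(Ez Ez').
- by move=> x nE; case: pselect.
- by move=> x; case: pselect => [Ex|nE]; [exact: (vP x).1|exact: FwH].
Qed.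

End Extension.

(** * The lifting criterion *)

Section EqualLifts.
Variables (R : realType) (X Y Z : riemann_surface R).
Variables (F : Y -> Z) (H : X -> Z) (S : set Z).
Hypotheses (hF : holomorphic F) (hH : holomorphic H) (uF : unramified_outside S F).
Hypothesis fS : finite_set S.

Let cF : covering_on F (~` S).
Proof.
apply: holo_covering => //; apply: (proj1 (@accessible_finite_set_closed Z)) => //.
exact/hausdorff_accessible/rs_hausdorff.
Qed.

Let E := H @^-1` S.

(** Two lifts agree along every path off E that starts at x0, and every point is a
    limit of points off E. *)
Lemma lift_eq (a b : X -> Y) x0 : continuous a -> continuous b ->
  (forall x, F (a x) = H x) -> (forall x, F (b x) = H x) -> ~ S (H x0) ->
  a x0 = b x0 -> forall x, a x = b x.
Proof.
move=> ca cb Fa Fb nS ab0.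
have dE : discrete_set E by exact: finite_preimage_discrete.
have hY := @rs_hausdorff _ Y.
have off x : ~ E x -> a x = b x.
  move=> nE; have /joinedP[g [gc g0 g1 gE]] := @joined_off _ _ E x0 x dE nS nE.
  rewrite -g1; have := @lift_unique _ _ R F (~` S) (a \o g) (b \o g) 0 hY
    (@connected_R R) cF; apply.
  - by move=> t; apply: continuous_comp; [exact: gc|exact: ca].
  - by move=> t; apply: continuous_comp; [exact: gc|exact: cb].
  - by move=> t /=; rewrite Fa Fb.
  - by move=> t /=; rewrite Fa; exact: gE.
  - by rewrite /= g0.
move=> x; apply: hY => A B aA bB.
have nA : nbhs x (a @^-1` A) by exact: ca.
have nB : nbhs x (b @^-1` B) by exact: cb.
have [y [[Ay By] Ey] yx] := no_isolated_point (filterI (filterI nA nB) (dE x)).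
exists (a y); split; first exact: Ay.
by rewrite off// => /Ey.
Qed.

(** The lifting criterion.  The value at x is found by lifting the image of a path
    from x0 to x; the hypothesis on loops makes it independent of the path. *)
Lemma lifting (x0 : X) (y0 : Y) : F y0 = H x0 -> ~ S (H x0) ->
  (forall l : R -> Z, path_in (~` S) (H x0) (H x0) l ->
     lift_ends H l x0 x0 -> lift_ends F l y0 y0) ->
  exists w : X -> Y, [/\ holomorphic w, forall x, F (w x) = H x & w x0 = y0].
Proof.
move=> Fy0 nS0 hl.
have dE : discrete_set E by exact: finite_preimage_discrete.
have hY := @rs_hausdorff _ Y; have cH := holo_continuous hH.
pose T x y := exists g : R -> X, [/\ continuous g, g 0 = x0, g 1 = x,
  forall t, ~ E (g t) & lift_ends F (H \o g) y0 y].
have cHg (g : R -> X) : continuous g -> continuous (H \o g).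
  by move=> gc t; apply: continuous_comp; [exact: gc|exact: cH].
have Ttot x : ~ E x -> exists y, T x y.
  move=> nE; have /joinedP[g [gc g0 g1 gE]] := @joined_off _ _ E x0 x dE nS0 nE.
  have [|/= |y Ly _] := lift_exists cF (b := H \o g) (x := y0).
  - by apply: path_in_total => [|t _]; [exact: cHg|exact: gE].
  - by rewrite g0.
  - by exists y, g.
have TF x y : T x y -> F y = H x.
  move=> [g [gc g0 g1 gE /lift_endsP[k [kc k0 k1 kF]]]].
  by rewrite -k1 kF ?itv01_1//= g1.
have Tfun x y y' : T x y -> T x y' -> y = y'.
  move=> [g [gc g0 g1 gE L]] [g' [gc' g'0 g'1 gE' L']].
  pose l := path_concat (H \o g) (path_rev (H \o g')).
  have e1 : (H \o g) 1 = path_rev (H \o g') 0 by rewrite /path_rev/= subr0 g1 g'1.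
  have cl : continuous l.
    apply: concat_continuous => //; first exact: cHg.
    move=> t; apply: (@continuous_comp _ _ _ (fun t : R => 1 - t) (H \o g')).
      by apply: cvgB; [exact: cvg_cst|exact: cvg_id].
    exact: cHg.
  have l0 : l 0 = H x0 by rewrite /l /path_concat mulr0 invr_ge0 ler0n/= g0.
  have l1 : l 1 = H x0.
    rewrite /l /path_concat ifF; last by apply/negbTE; rewrite -ltNge; lra.
    by rewrite /path_rev/= -g'0; congr (H (g' _)); lra.
  have lS t : (~` S) (l t).
    by rewrite /l /path_concat; case: ifP => _; [exact: gE|exact: gE'].
  have pl : path_in (~` S) (H x0) (H x0) l.
    by have := path_in_total cl (fun t _ => lS t); rewrite l0 l1.
  have Ll : lift_ends F l y0 y0.
    apply: hl => //; apply: (lift_concat (y := x)).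
      by apply/lift_endsP; exists g.
    by apply: lift_rev; apply/lift_endsP; exists g'.
  have [y1 L1 L2] := lift_concat_inv e1 Ll.
  have y1y : y1 = y by apply: (lift_ends_unique hY cF _ L1 L) => t _; exact: gE.
  have := lift_rev L2.
  have -> : path_rev (path_rev (H \o g')) = H \o g'.
    by apply/funext => t; rewrite /path_rev subKr.
  rewrite -y1y => L3.
  by apply: (lift_ends_unique hY cF _ L3 L') => t _; exact: gE'.
pose w x := if pselect (exists y, T x y) is left e then projT1 (cid e) else y0.
have wT x : ~ E x -> T x (w x).
  by move=> /Ttot e; rewrite /w; case: pselect => // e'; case: (cid e').
have w0 : w x0 = y0.
  apply: (Tfun x0); first exact: wT.
  exists (fun=> x0); split=> //; first by move=> t; exact: cst_continuous.
  by rewrite (_ : H \o _ = cst (F y0)); [exact: lift_constant|apply/funext => t /=].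
have cw x : ~ E x -> {for x, continuous w}.
  move=> nE; have [_ sec] := cF.
  have [V [oV Vx sV]] := sec _ nE.
  have Tx := wT _ nE; have Fwx := TF _ _ Tx.
  have [s [sx sF sc]] : exists s : Z -> Y, [/\ s (H x) = w x,
      forall v, V v -> F (s v) = v & forall v, V v -> {for v, continuous s}].
    by rewrite -Fwx; apply: sV; rewrite Fwx.
  have nV : nbhs x (H @^-1` V) by apply: cH; exact: open_nbhs_nbhs.
  have [D [xD DN jD _]] := small_disc (filterI nV (dE x)).
  have DE z : D z -> ~ E z by move=> Dz Ez; have [_ /(_ Ez) e] := DN _ Dz; rewrite e in Ez.
  have wD z : D z -> w z = s (H z).
    move=> Dz; apply: (Tfun z); first exact: wT _ (DE _ Dz).
    have [g [gc g0 g1 gE L]] := Tx.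
    have /joinedP[k [kc k0 k1 kD]] := jD _ _ (nbhs_singleton xD) Dz.
    exists (path_concat g k); split.
    - by apply: concat_continuous => //; rewrite g1.
    - by rewrite /path_concat mulr0 invr_ge0 ler0n.
    - rewrite /path_concat ifF; first by rewrite -k1; congr k; lra.
      by apply/negbTE; rewrite -ltNge; lra.
    - move=> t; rewrite /path_concat; case: ifP => _; first exact: gE.
      exact: DE.
    - have -> : H \o path_concat g k = path_concat (H \o g) (H \o k).
        by apply/funext => t; rewrite /path_concat/=; case: ifP.
      apply: lift_concat L _; apply/lift_endsP; exists (s \o (H \o k)).
      have VH t : V (H (k t)) by have [] := DN _ (kD t).
      split.
      + move=> t; apply: (@continuous_comp _ _ _ (H \o k) s); first exact: cHg.
        exact: (sc _ (VH t)).
      + by rewrite /= k0.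
      + by rewrite /= k1.
      + by move=> t _; rewrite /= sF.
  move=> A; rewrite wD; last exact: nbhs_singleton xD.
  move=> hA; have Vx' : V (H x) by [].
  have h : nbhs x ((s \o H) @^-1` A).
    have : {for x, continuous (s \o H)}.
      by apply: continuous_comp; [exact: cH|exact: sc].
    by apply.
  by apply: filterS2 h xD => z Az Dz; rewrite /= wD.
have FwH x : ~ E x -> F (w x) = H x by move=> /wT/TF.
have [W [cW Ww FW]] := extension hF cH dE cw FwH.
exists W; split=> //; last by rewrite Ww.
exact: lift_holomorphic hF hH uF fS cW FW.
Qed.

End EqualLifts.

(** * Loops acting on fibres, and the theorem *)

Section Words.
Variables (R : realType) (Z : topologicalType) (P : set Z) (z0 : Z).
Variables (r : nat) (beta : 'I_r -> R -> Z).

Definition letter_path (e : 'I_r * bool) : R -> Z :=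
  if e.2 then beta e.1 else path_rev (beta e.1).

Definition word_path (s : seq ('I_r * bool)) : R -> Z :=
  path_prod z0 [seq letter_path e | e <- s].

Definition letter_perm (T : finType) (al : 'I_r -> {perm T}) (e : 'I_r * bool) :=
  if e.2 then al e.1 else (al e.1)^-1%g.

(** The letters act in the order in which the loops are run through. *)
Definition word_act (T : finType) (al : 'I_r -> {perm T}) s (c : T) : T :=
  foldl (fun c e => letter_perm al e c) c s.

Lemma word_lift (Y : topologicalType) (F : Y -> Z) (T : finType) (A : {set T})
    (lab : T -> Y) (al : 'I_r -> {perm T}) :
  (forall i c, (al i c \in A) = (c \in A)) ->
  (forall i, monodromy F (beta i) A lab (al i)) ->
  (forall c, c \in A -> F (lab c) = z0) ->
  forall s c, c \in A -> word_act al s c \in A /\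
    lift_ends F (word_path s) (lab c) (lab (word_act al s c)).
Proof.
move=> inv mon fib; elim=> [|e s ih] c cA.
  by split=> //; rewrite /word_path/= -(fib _ cA); exact: lift_constant.
have [eA eL] : letter_perm al e c \in A /\
    lift_ends F (letter_path e) (lab c) (lab (letter_perm al e c)).
  case: e => i [] /=; rewrite /letter_perm /letter_path/=.
    by rewrite inv; split => //; exact: mon.
  have dA : (al i)^-1%g c \in A by rewrite -(inv i) permKV.
  by split => //; apply: lift_rev; have := mon i _ dA; rewrite permKV.
have [sA sL] := ih _ eA; split => //.
exact: lift_concat eL sL.
Qed.

(** The word is chosen before the covering; this is what makes the actions of one
    loop on the fibres of different coverings comparable. *)
Lemma loop_word (l : R -> Z) :
  (forall g, path_in P z0 z0 g -> exists s, homotopic P z0 z0 g (word_path s)) ->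
  path_in P z0 z0 l -> exists s, forall (Y : topologicalType) (F : Y -> Z)
    (T : finType) (A : {set T}) (lab : T -> Y) (al : 'I_r -> {perm T}),
    hausdorff_space Y -> covering_on F P ->
    (forall i c, (al i c \in A) = (c \in A)) ->
    (forall i, monodromy F (beta i) A lab (al i)) ->
    (forall c, c \in A -> F (lab c) = z0) ->
    forall c, c \in A -> word_act al s c \in A /\
      lift_ends F l (lab c) (lab (word_act al s c)).
Proof.
move=> gen pl; have [s hs] := gen _ pl; exists s => Y F T A lab al hY cF inv mon fib c cA.
have [sA sL] := word_lift inv mon fib s cA; split => //.
have pl' : path_in P (l 0) (l 1) l by case: pl => h1 h2 h3 h4; split.
have l0 : l 0 = F (lab c) by case: pl => _ -> _ _; rewrite fib.
have [y Ly _] := lift_exists cF pl' l0.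
have Ly' := lift_homotopic hY cF hs (fib _ cA) Ly.
suff -> : lab (word_act al s c) = y by [].
apply: (lift_ends_unique hY cF _ sL Ly') => t tt.
have [H [_ HP H01 _]] := hs; have [_ <-] := H01 _ tt.
apply: HP; exists (t, 1) => //.
by split; rewrite /= in_itv/=; [exact: tt|exact: itv01_1].
Qed.

End Words.

Section Deck.
Variables (R : realType) (D Z : riemann_surface R) (f : D -> Z) (S : set Z).
Hypotheses (hf : holomorphic f) (uf : unramified_outside S f) (fS : finite_set S).

(** The lifting criterion applies in both directions, and the two lifts are inverse
    to each other because lifts are unique. *)
Lemma deck_transformation (a b : D) : f a = f b -> ~ S (f a) ->
  (forall l : R -> Z, path_in (~` S) (f a) (f a) l ->
     lift_ends f l a a <-> lift_ends f l b b) ->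
  exists (mu mu' : D -> D), [/\ holomorphic mu, holomorphic mu',
    cancel mu mu' & cancel mu' mu] /\
    [/\ forall x, f (mu x) = f x, forall x, f (mu' x) = f x & mu a = b].
Proof.
move=> fab nS hl.
have nSb : ~ S (f b) by rewrite -fab.
have [mu [hmu fmu mua]] := lifting hf hf uf fS (esym fab) nS (fun l pl => proj1 (hl l pl)).
have hl' (l : R -> Z) : path_in (~` S) (f b) (f b) l -> lift_ends f l b b -> lift_ends f l a a.
  by rewrite -fab => pl; exact: (proj2 (hl l pl)).
have [mu' [hmu' fmu' mub]] := lifting hf hf uf fS fab nSb hl'.
exists mu, mu'; split; last by [].
have cmu := holo_continuous hmu; have cmu' := holo_continuous hmu'.
split=> //.
- apply: (lift_eq (x0 := a) hf hf uf fS) => //.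
  + by move=> x; apply: continuous_comp; [exact: cmu|exact: cmu'].
  + by move=> x; exact: cvg_id.
  + by move=> x; rewrite fmu' fmu.
  + by rewrite mua.
- apply: (lift_eq (x0 := b) hf hf uf fS) => //.
  + by move=> x; apply: continuous_comp; [exact: cmu'|exact: cmu].
  + by move=> x; exact: cvg_id.
  + by move=> x; rewrite fmu fmu'.
  + by rewrite mub.
Qed.

(** An automorphism mu that sends u (w x0) to p x0 turns u into p' = mu \o u; then p
    and p' \o w are lifts of h that agree at x0. *)
Lemma lift_factors (X Y : riemann_surface R) (h : X -> Z) (k : Y -> Z) (w : X -> Y)
    (p : X -> D) (u : Y -> D) (x0 : X) :
  holomorphic h -> holomorphic k -> holomorphic w -> holomorphic p -> holomorphic u ->
  (forall x, k (w x) = h x) -> (forall x, f (p x) = h x) ->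
  (forall y, f (u y) = k y) -> ~ S (h x0) ->
  (forall l : R -> Z, path_in (~` S) (h x0) (h x0) l ->
     lift_ends f l (u (w x0)) (u (w x0)) <-> lift_ends f l (p x0) (p x0)) ->
  exists p' : Y -> D, [/\ holomorphic p', p = p' \o w & decomp_equiv f p' f u].
Proof.
move=> hh hk hw hp hu kw fp fu nS hl.
have e1 : f (u (w x0)) = h x0 by rewrite fu kw.
have [|||mu [mu' [[hmu hmu' K K'] [fmu fmu' mua]]]] := @deck_transformation (u (w x0)) (p x0).
- by rewrite e1 fp.
- by rewrite e1.
- by rewrite e1.
have cmu := holo_continuous hmu.
have cp' : continuous (mu \o u).
  by move=> y; apply: continuous_comp; [exact: (holo_continuous hu)|exact: cmu].
exists (mu \o u); split.
- by apply: (lift_holomorphic hf hk uf fS cp') => y; rewrite /= fmu fu.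
- apply/funext; apply: (lift_eq (x0 := x0) hf hh uf fS) => //.
  + exact: holo_continuous.
  + move=> x; apply: (@continuous_comp _ _ _ w (mu \o u)); last exact: cp'.
    exact: (holo_continuous hw).
  + by move=> x; rewrite /= fmu fu kw.
- exists mu, mu'; split => //; split => //.
  by apply/funext => x; rewrite /= fmu'.
Qed.

(** The hypothesis on fibres does not say which point of D belongs to which block.
    It says that lab c1 lies in the fibre of u through lab c0 if and only if c0 and
    c1 lie in the same block, which is enough to compare the stabilizers. *)
Lemma row_stabilizer (Y : topologicalType) (u : Y -> D) (T I : finType) (U : {set T})
    (lab : T -> Y) (pr : T -> I) (num : I -> D) (l : R -> Z) (c0 c1 : T) :
  continuous u -> f (u (lab c0)) = f (num (pr c0)) ->
  {in U &, injective lab} -> injective num -> c0 \in U -> c1 \in U ->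
  fibres_are u (f @^-1` [set f (num (pr c0))]) lab
    (fun k : I => U :&: [set c | pr c == k])%SET ->
  path_in (~` S) (f (num (pr c0))) (f (num (pr c0))) l ->
  lift_ends (f \o u) l (lab c0) (lab c1) ->
  lift_ends f l (num (pr c0)) (num (pr c1)) ->
  lift_ends f l (u (lab c0)) (u (lab c0)) <->
  lift_ends f l (num (pr c0)) (num (pr c0)).
Proof.
move=> cu fu ilab inum c0U c1U fib pl Lu Ln.
have hD := @rs_hausdorff _ D.
have cF : covering_on f (~` S).
  apply: holo_covering => //; apply: (proj1 (@accessible_finite_set_closed Z)) => //.
  exact/hausdorff_accessible/rs_hausdorff.
have lS t : 0 <= t <= 1 -> (~` S) (l t).
  by move=> tt; case: pl => _ _ _; apply; exists t; rewrite //= in_itv.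
have {}Lu := lift_comp cu Lu.
have : [set u @^-1` [set y] | y in f @^-1` [set f (num (pr c0))]]
    (u @^-1` [set u (lab c0)]) by exists (u (lab c0)).
rewrite fib => -[k _ kE].
have c0k : (u @^-1` [set u (lab c0)]) (lab c0) by [].
rewrite -kE in c0k; have [c /=] := c0k.
rewrite !inE => /andP[cU /eqP ck] /(ilab _ _ cU c0U) cc0; rewrite cc0 in ck.
have key : u (lab c1) = u (lab c0) <-> pr c1 = pr c0.
  split=> e.
    have c1k : (u @^-1` [set u (lab c0)]) (lab c1) by [].
    rewrite -kE in c1k; have [d /=] := c1k.
    by rewrite !inE => /andP[dU /eqP dk] /(ilab _ _ dU c1U) <-; rewrite dk ck.
  have : (lab @` [set` (U :&: [set c | pr c == k])%SET]) (lab c1).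
    by exists c1 => //=; rewrite !inE c1U e ck eqxx.
  by rewrite kE.
split=> L.
  suff e : pr c1 = pr c0 by rewrite e in Ln.
  by apply/key; exact: (lift_ends_unique hD cF lS Lu L).
suff e : u (lab c1) = u (lab c0) by rewrite e in Lu.
by apply/key/inum; exact: (lift_ends_unique hD cF lS Ln L).
Qed.

End Deck.

Section Blocks.
Variables (n m r : nat) (alf : 'I_r -> 'S_n) (alg : 'I_r -> 'S_m).

Lemma Gamma_orbit_index c : exists j : 'I_(o_fg alf alg), c \in U_ j.
Proof.
have cO : orbit 'P (Gamma alf alg) c \in Gamma_orbits alf alg.
  by apply/imsetP; exists c.
exists (enum_rank_in cO (orbit 'P (Gamma alf alg) c)).
by rewrite /U_ enum_rankK_in// orbit_refl.
Qed.

Lemma delta_closed (j : 'I_(o_fg alf alg)) i c :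
  (delta_ j i c \in U_ j) = (c \in U_ j).
Proof. exact/perm_closed/restr_perm_on. Qed.

Lemma delta_E (j : 'I_(o_fg alf alg)) i c : c \in U_ j ->
  delta_ j i c = (alf i c.1, alg i c.2).
Proof.
move=> cU; rewrite /delta_ restr_permE ?permE//.
have /imsetP[c0 _ ->] : U_ j \in Gamma_orbits alf alg by exact: enum_valP.
have := acts_orbit 'P c0 (finset.subsetT (Gamma alf alg)) => /fintype.subsetP; apply.
by apply: mem_gen; apply/imsetP; exists i.
Qed.

Lemma word_act_delta (j : 'I_(o_fg alf alg)) s c : c \in U_ j ->
  word_act (delta_ j) s c = (word_act alf s c.1, word_act alg s c.2).
Proof.
elim: s c => [|[i b] s ih] c cU; first by case: c cU.
have step : letter_perm (delta_ j) (i, b) c =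
    (letter_perm alf (i, b) c.1, letter_perm alg (i, b) c.2).
  case: b; rewrite /letter_perm/=; first exact: delta_E.
  have dU : (delta_ j i)^-1%g c \in U_ j by rewrite -(delta_closed j i) permKV.
  have cE := delta_E i dU; rewrite permKV in cE.
  have [-> ->] : c.1 = alf i ((delta_ j i)^-1%g c).1 /\
      c.2 = alg i ((delta_ j i)^-1%g c).2 by split; rewrite [in LHS]cE.
  by rewrite !permK -surjective_pairing.
rewrite /word_act/= -!/(word_act _ _ _) ih.
  by rewrite step.
case: b step => _; rewrite /letter_perm/=; first by rewrite delta_closed.
by rewrite -(delta_closed j i) permKV.
Qed.

End Blocks.

Theorem theorem2p2 (R : realType)
  (* the functions f, g and their degrees *)
  (C1 C2 : riemann_surface R) (f : C1 -> CP1 R) (g : C2 -> CP1 R)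
  (hol_f : holomorphic f) (hol_g : holomorphic g)
  (n m : nat) (deg_f : has_degree f n) (deg_g : has_degree g m)
  (* branch points, base point and loops *)
  (r : nat) (z : 'I_r -> CP1 R) (S : set (CP1 R))
  (z_inj : injective z) (z_S : range z = S)
  (S_def : S = critical_values f `|` critical_values g)
  (z0 : CP1 R) (z0_S : ~ S z0)
  (beta : 'I_r -> R -> CP1 R) (beta_loops : standard_loops S z0 z beta)
  (* numbering of the fibres over z0 and monodromy permutations *)
  (numf : 'I_n -> C1) (numf_fibre : fibre_labelling f z0 [set: 'I_n]%SET numf)
  (numg : 'I_m -> C2) (numg_fibre : fibre_labelling g z0 [set: 'I_m]%SET numg)
  (alf : 'I_r -> {perm 'I_n}) (alg : 'I_r -> {perm 'I_m})
  (alf_mon : forall i, monodromy f (beta i) [set: 'I_n]%SET numf (alf i))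
  (alg_mon : forall i, monodromy g (beta i) [set: 'I_m]%SET numg (alg i))
  (* the associated functions h_j = f \o u_j = g \o v_j *)
  (R_ : 'I_(o_fg alf alg) -> riemann_surface R)
  (h_ : forall j, R_ j -> CP1 R) (u_ : forall j, R_ j -> C1)
  (v_ : forall j, R_ j -> C2) (lab : forall j, 'I_n * 'I_m -> R_ j)
  (hol_h_ : forall j, holomorphic (h_ j))
  (hol_u_ : forall j, holomorphic (u_ j))
  (hol_v_ : forall j, holomorphic (v_ j))
  (h_unram : forall j, unramified_outside S (h_ j))
  (lab_fibre : forall j, fibre_labelling (h_ j) z0 (U_ j) (lab j))
  (h_mon : forall j i, monodromy (h_ j) (beta i) (U_ j) (lab j) (delta_ j i))
  (h_fu : forall j, h_ j = f \o u_ j) (h_gv : forall j, h_ j = g \o v_ j)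
  (u_fibres : forall j, fibres_are (u_ j) (f @^-1` [set z0]) (lab j)
                          (fun k : 'I_n => U_ j :&: mrow m k)%SET)
  (v_fibres : forall j, fibres_are (v_ j) (g @^-1` [set z0]) (lab j)
                          (fun k : 'I_m => U_ j :&: mcol n k)%SET)
  (* the given common left multiple *)
  (X : riemann_surface R) (h : X -> CP1 R) (p : X -> C1) (q : X -> C2)
  (hol_h : holomorphic h) (hol_p : holomorphic p) (hol_q : holomorphic q)
  (h_fp : h = f \o p) (h_gq : h = g \o q) :
  exists (j : 'I_(o_fg alf alg)) (w : X -> R_ j) (p' : R_ j -> C1)
         (q' : R_ j -> C2),
    [/\ holomorphic w, holomorphic p' & holomorphic q'] /\
    [/\ h = h_ j \o w, p = p' \o w & q = q' \o w] /\
    decomp_equiv f p' f (u_ j) /\ decomp_equiv g q' g (v_ j).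
Proof.
have fS : finite_set S by rewrite -z_S; exact: finite_image.
have uf : unramified_outside S f by rewrite /unramified_outside S_def => y; left.
have ug : unramified_outside S g by rewrite /unramified_outside S_def => y; right.
have cS : closed S.
  apply: (proj1 (@accessible_finite_set_closed (CP1 R))) => //.
  exact/hausdorff_accessible/rs_hausdorff.
have [_ _ gen] := beta_loops.
have [x0 hx0] := holo_onto hol_h z0.
have [_ injf surf] := numf_fibre; have [_ injg surg] := numg_fibre.
have fpx : f (p x0) = z0 by rewrite -hx0 h_fp.
have gqx : g (q x0) = z0 by rewrite -hx0 h_gq.
have [j1 _ pj1] := surf _ fpx; have [j2 _ qj2] := surg _ gqx.
have [j cU] := Gamma_orbit_index alf alg (j1, j2).
set c0 := (j1, j2) in cU.
have [labz injl _] := lab_fibre j.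
have hlab c : c \in U_ j -> h_ j (lab j c) = z0 by move=> cj; exact: labz.
have injlab : {in U_ j &, injective (lab j)}.
  by move=> a b aU bU; apply: injl; rewrite inE.
have inumf : injective numf by move=> a b; apply: injf; rewrite inE/= finset.in_setT.
have inumg : injective numg by move=> a b; apply: injg; rewrite inE/= finset.in_setT.
have fnum k : f (numf k) = z0.
  by have [H _ _] := numf_fibre; apply: H; rewrite /= finset.in_setT.
have gnum k : g (numg k) = z0.
  by have [H _ _] := numg_fibre; apply: H; rewrite /= finset.in_setT.
(* c1 is the image of c0 under the action of l *)
have key (l : R -> CP1 R) : path_in (~` S) z0 z0 l -> exists c1 : 'I_n * 'I_m, [/\ c1 \in U_ j,
    lift_ends (h_ j) l (lab j c0) (lab j c1), lift_ends f l (numf j1) (numf c1.1) &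
    lift_ends g l (numg j2) (numg c1.2)].
  move=> pl; have [s hs] := loop_word gen pl.
  exists (word_act (delta_ j) s c0).
  have [sU sL] := hs _ _ _ _ _ _ (@rs_hausdorff _ (R_ j))
    (holo_covering (hol_h_ j) cS (@h_unram j)) (@delta_closed n m r alf alg j) (h_mon j) hlab
    _ cU.
  have [_ fL] := hs _ _ _ _ _ _ (@rs_hausdorff _ C1) (holo_covering hol_f cS uf)
    (fun i c => etrans (finset.in_setT _) (esym (finset.in_setT _))) alf_mon
    (fun k _ => fnum k) j1 (finset.in_setT _).
  have [_ gL] := hs _ _ _ _ _ _ (@rs_hausdorff _ C2) (holo_covering hol_g cS ug)
    (fun i c => etrans (finset.in_setT _) (esym (finset.in_setT _))) alg_mon
    (fun k _ => gnum k) j2 (finset.in_setT _).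
  by split => //; rewrite word_act_delta.
have lS (l : R -> CP1 R) t : path_in (~` S) z0 z0 l -> 0 <= t <= 1 -> (~` S) (l t).
  by move=> [_ _ _ lS] tt; apply: lS; exists t; rewrite //= in_itv.
have [w [hw Fw wx0]] : exists w : X -> R_ j, [/\ holomorphic w,
    forall x, h_ j (w x) = h x & w x0 = lab j c0].
  apply: (lifting (hol_h_ j) hol_h (@h_unram j) fS); rewrite ?hx0 ?hlab//.
  move=> l pl Lh; have [c1 [c1U L Lf Lg]] := key _ pl.
  have Lp : lift_ends f l (p x0) (p x0).
    by apply: lift_comp; [exact: holo_continuous|rewrite -h_fp].
  have Lq : lift_ends g l (q x0) (q x0).
    by apply: lift_comp; [exact: holo_continuous|rewrite -h_gq].
  rewrite -pj1 in Lp; rewrite -qj2 in Lq.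
  suff c10 : c1 = c0 by rewrite c10 in L.
  rewrite /c0 [c1]surjective_pairing; congr pair.
    apply: inumf; apply: (lift_ends_unique (@rs_hausdorff _ C1)
      (holo_covering hol_f cS uf) _ Lf Lp) => t; exact: lS.
  apply: inumg; apply: (lift_ends_unique (@rs_hausdorff _ C2)
    (holo_covering hol_g cS ug) _ Lg Lq) => t; exact: lS.
have fu y : f (u_ j y) = h_ j y by rewrite h_fu.
have gv y : g (v_ j y) = h_ j y by rewrite h_gv.
have [p' [hp' pE pD]] : exists p' : R_ j -> C1,
    [/\ holomorphic p', p = p' \o w & decomp_equiv f p' f (u_ j)].
  apply: (@lift_factors _ _ _ f S hol_f uf fS X (R_ j) h (h_ j) w p (u_ j) x0) => //.
  - by move=> x; rewrite h_fp.
  - by rewrite hx0.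
  - rewrite hx0 => l pl; have [c1 [c1U L Lf Lg]] := key _ pl.
    rewrite wx0 -pj1; apply: (@row_stabilizer _ _ _ f S hol_f uf fS (R_ j) (u_ j) _ _
      (U_ j) (lab j) fst numf l c0 c1) => //.
    + exact: holo_continuous.
    + by rewrite fu hlab// fnum.
    + by rewrite fnum; exact: u_fibres.
    + by rewrite fnum.
    + by rewrite -h_fu.
have [q' [hq' qE qD]] : exists q' : R_ j -> C2,
    [/\ holomorphic q', q = q' \o w & decomp_equiv g q' g (v_ j)].
  apply: (@lift_factors _ _ _ g S hol_g ug fS X (R_ j) h (h_ j) w q (v_ j) x0) => //.
  - by move=> x; rewrite h_gq.
  - by rewrite hx0.
  - rewrite hx0 => l pl; have [c1 [c1U L Lf Lg]] := key _ pl.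
    rewrite wx0 -qj2; apply: (@row_stabilizer _ _ _ g S hol_g ug fS (R_ j) (v_ j) _ _
      (U_ j) (lab j) snd numg l c0 c1) => //.
    + exact: holo_continuous.
    + by rewrite gv hlab// gnum.
    + by rewrite gnum; exact: v_fibres.
    + by rewrite gnum.
    + by rewrite -h_gv.
exists j, w, p', q'; split; [by split|split; last by split].
by split => //; apply/funext => x; rewrite /= Fw.
Qed.
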